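(* The GIT quotient $\widetilde{\mathcal R}^{cb}_6=|\mathcal O_{\mathbb P}(2)|/\!/\mathrm{Aut}_\sigma S$ is rational.
   Context: We work over $\mathbb C$. Let $\mathbb G\subset\mathbb P^9$ be the Plücker embedding of the Grassmannian of planes of $\mathbb P^4$ and $S=\mathbb P^5\cap\mathbb G$ a smooth two-dimensional linear section (a quintic Del Pezzo surface). For $y\in S$ let $\mathsf P_y\subset\mathbb P^4$ be the corresponding plane, and let $\mathbb P=\{(x,y)\in\mathbb P^4\times S\mid x\in\mathsf P_y\}$ be the universal plane over $S$, with projections $t:\mathbb P\to\mathbb P^4$, $u:\mathbb P\to S$, and $\mathcal O_{\mathbb P}(m)=t^*\mathcal O_{\mathbb P^4}(m)$. One has $\dim|\mathcal O_{\mathbb P}(2)|=15$. The group $\mathrm{Aut}\,S\cong\mathfrak S_5$ acts linearly on $\mathbb P^4$ preserving the family of planes $\{\mathsf P_y\}_{y\in S}$, hence acts on $\mathbb P$ and on $|\mathcal O_{\mathbb P}(2)|$. Let $\sigma:S\to\mathbb P^2$ be a fixed contraction of four disjoint lines of $S$, and let $\mathrm{Aut}_\sigma S\subset\mathrm{Aut}\,S$ be the subgroup leaving invariant the exceptional divisor of $\sigma$; it is isomorphic to $\mathfrak S_4$. *)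

(* Defs.v *)
(* Classical projective geometry over a field K (used with K = R[i],
   algebraically closed).
   A point of P^n is represented by a nonzero row vector of size n.+1, taken up
   to proj_eq; a subset of P^n is a set of nonzero vectors stable under scaling
   (its punctured cone).  All varieties below are reduced and all their points
   are rational, so regular maps and sections of line bundles are determined by
   their values on points. *)
From mathcomp Require Import all_boot all_order all_algebra.
From mathcomp.multinomials Require Import mpoly.
From mathcomp Require Import complex.
From mathcomp Require Import reals.

Set Implicit Arguments.
Unset Strict Implicit.
Unset Printing Implicit Defensive.
Import GRing.Theory.
Local Open Scope ring_scope.

Local Notation "x %:F" := (FracField.tofrac x).

Definition proj_eq (K : fieldType) n (v w : 'rV[K]_n) : Prop :=
  exists2 c : K, c != 0 & w = c *: v.

Definition eval_at (K : fieldType) n (F : {mpoly K[n]}) (v : 'rV[K]_n) : K :=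
  F.@[fun i => v 0 i].

(* f represents a regular map from X, contained in P^(n-1), to Y, contained in
   P^(m-1): near each point it is given by m forms of the same degree without
   common zero.  The neighbourhood may be taken to be the full locus where the
   forms do not all vanish, after multiplying them by a further form.  In
   particular f is compatible with proj_eq on X. *)
Definition regular_map (K : fieldType) n m
    (X : 'rV[K]_n -> Prop) (Y : 'rV[K]_m -> Prop) (f : 'rV[K]_n -> 'rV[K]_m) :=
  (forall v, X v -> Y (f v)) /\
  (forall v0, X v0 ->
     exists (d : nat) (F : 'I_m -> {mpoly K[n]}),
       [/\ forall j, F j \is d.-homog,
           \row_j eval_at (F j) v0 != 0 &
           forall v, X v -> \row_j eval_at (F j) v != 0 ->
             proj_eq (f v) (\row_j eval_at (F j) v)]).

Definition iso_map (K : fieldType) n m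
    (X : 'rV[K]_n -> Prop) (Y : 'rV[K]_m -> Prop) (f : 'rV[K]_n -> 'rV[K]_m) :=
  regular_map X Y f /\
  exists g : 'rV[K]_m -> 'rV[K]_n,
    [/\ regular_map Y X g,
        forall v, X v -> proj_eq v (g (f v)) &
        forall w, Y w -> proj_eq w (f (g w))].

Definition triple (k : 'I_10) (i : 'I_3) : 'I_5 :=
  inord (nth 0%N (nth [::] [:: [:: 0; 1; 2]; [:: 0; 1; 3]; [:: 0; 1; 4];
                               [:: 0; 2; 3]; [:: 0; 2; 4]; [:: 0; 3; 4];
                               [:: 1; 2; 3]; [:: 1; 2; 4]; [:: 1; 3; 4];
                               [:: 2; 3; 4] ]%N k) i).

(* The planes of P^4 are the row spaces of the row-free 3 x 5 matrices. *)
Definition plucker (K : fieldType) (B : 'M[K]_(3, 5)) : 'rV[K]_10 :=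
  \row_k \det (colsub (triple k) B).

Definition grassmannian (K : fieldType) (p : 'rV[K]_10) : Prop :=
  exists2 B : 'M[K]_(3, 5), row_free B & plucker B = p.

(* x lies in P_y, for y the class of p; B is unique up to a left factor of
   determinant 1, so its row space depends only on p (and only on y). *)
Definition in_plane (K : fieldType) (x : 'rV[K]_5) (p : 'rV[K]_10) : Prop :=
  exists B : 'M[K]_(3, 5), [/\ row_free B, plucker B = p & (x <= B)%MS].

Definition replace_row (K : fieldType) (B : 'M[K]_(3, 5)) (k : 'I_3)
    (w : 'rV[K]_5) : 'M[K]_(3, 5) :=
  \matrix_(i, j) if i == k then w 0 j else B i j.

(* Affine tangent space (of dimension 7) to the cone over the Grassmannian at
   plucker B: the image of the differential at B of the trilinear map plucker. *)
Definition tangent_space (K : fieldType) (B : 'M[K]_(3, 5)) : 'M[K]_10 :=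
  (\sum_(k < 3) \sum_(j < 5) <<plucker (replace_row B k (delta_mx 0 j))>>)%MS.

(* The linear section cut out by the subspace P(V), with V the row space of a
   row-free 6 x 10 matrix. *)
Definition linear_section (K : fieldType) (V : 'M[K]_(6, 10)) (p : 'rV[K]_10)
  : Prop :=
  grassmannian p /\ (p <= V)%MS.

(* The scheme-theoretic intersection is smooth of dimension 2: its Zariski
   tangent space, which is the intersection of those of P(V) and of the
   Grassmannian, has (projective) dimension 2 at each point.  The section is
   automatically nonempty with all components of dimension at least
   5 + 6 - 9 = 2. *)
Definition smooth_surface_section (K : fieldType) (V : 'M[K]_(6, 10)) : Prop :=
  row_free V /\
  forall B : 'M[K]_(3, 5), row_free B -> (plucker B <= V)%MS ->
    \rank (tangent_space B :&: V)%MS = 3.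

(* The line number i is P(L i). *)
Definition on_lines (K : fieldType) (L : 'I_4 -> 'M[K]_(2, 10)) (p : 'rV[K]_10)
  : Prop := p != 0 /\ exists i, (p <= L i)%MS.

(* sigma is a contraction S -> P^2 with exceptional divisor the union of the
   four disjoint lines L i. *)
Definition contraction (K : fieldType) (V : 'M[K]_(6, 10))
    (L : 'I_4 -> 'M[K]_(2, 10)) (sigma : 'rV[K]_10 -> 'rV[K]_3) : Prop :=
  [/\ forall i, row_free (L i) /\
        (forall p, p != 0 -> (p <= L i)%MS -> linear_section V p),
      forall i j, i != j -> (L i :&: L j)%MS = 0,
      regular_map (linear_section V) (fun w => w != 0) sigma &
      exists q : 'I_4 -> 'rV[K]_3,
        [/\ forall i, q i != 0,
            forall i j, i != j -> ~ proj_eq (q i) (q j),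
            forall i p, p != 0 -> (p <= L i)%MS -> proj_eq (q i) (sigma p) &
            iso_map (fun p => linear_section V p /\ ~ on_lines L p)
                    (fun w => w != 0 /\ forall i, ~ proj_eq (q i) w)
                    sigma]].

(* alpha is an automorphism of S leaving the exceptional divisor invariant. *)
Definition Aut_sigma (K : fieldType) (V : 'M[K]_(6, 10))
    (L : 'I_4 -> 'M[K]_(2, 10)) (alpha : 'rV[K]_10 -> 'rV[K]_10) : Prop :=
  iso_map (linear_section V) (linear_section V) alpha /\
  forall p, linear_section V p -> (on_lines L (alpha p) <-> on_lines L p).

(* Punctured cone over the universal plane in P^4 x S. *)
Definition univ_plane (K : fieldType) (V : 'M[K]_(6, 10))
    (x : 'rV[K]_5) (p : 'rV[K]_10) : Prop :=
  [/\ x != 0, linear_section V p & in_plane x p].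

Definition bihomog (K : fieldType) (a b : nat) (F : {mpoly K[5 + 10]}) : Prop :=
  forall m, m \in msupp F ->
    (\sum_(i < 5) m (lshift 10 i))%N = a /\
    (\sum_(j < 10) m (rshift 5 j))%N = b.

(* Global sections of the pullback of O(m) to the universal plane: functions on
   its cone which are locally quotients of bihomogeneous forms, of total
   bidegree (m, 0).  Only the values on univ_plane V matter. *)
Definition O_section (K : fieldType) (V : 'M[K]_(6, 10)) (m : nat)
    (s : 'rV[K]_5 -> 'rV[K]_10 -> K) : Prop :=
  forall x0 p0, univ_plane V x0 p0 ->
    exists (a b : nat) (F G : {mpoly K[5 + 10]}),
      [/\ bihomog (a + m) b F, bihomog a b G, eval_at G (row_mx x0 p0) != 0 &
          forall x p, univ_plane V x p -> eval_at G (row_mx x p) != 0 ->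
            s x p = eval_at F (row_mx x p) / eval_at G (row_mx x p)].

Definition O_section_basis (K : fieldType) (V : 'M[K]_(6, 10)) (m n : nat)
    (s : 'I_n -> 'rV[K]_5 -> 'rV[K]_10 -> K) : Prop :=
  (forall i, O_section V m (s i)) /\
  forall t, O_section V m t ->
    exists! z : 'rV[K]_n, forall x p, univ_plane V x p ->
      t x p = \sum_(i < n) z 0 i * s i x p.

(* M is the matrix, in the basis s of H^0(O(m)), of pullback by (g, alpha) for
   some alpha in Aut_sigma S, where g is the linear automorphism of P^4 (unique
   up to a scalar) by which alpha acts compatibly with the family of planes. *)
Definition acts_by (K : fieldType) (V : 'M[K]_(6, 10))
    (L : 'I_4 -> 'M[K]_(2, 10)) (n : nat)
    (s : 'I_n -> 'rV[K]_5 -> 'rV[K]_10 -> K) (M : 'M[K]_n) : Prop :=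
  exists (alpha : 'rV[K]_10 -> 'rV[K]_10) (g : 'M[K]_5),
    [/\ Aut_sigma V L alpha,
        g \in unitmx,
        forall p, linear_section V p -> forall x,
          in_plane (x *m g) (alpha p) <-> in_plane x p &
        forall j x p, univ_plane V x p ->
          s j (x *m g) (alpha p) = \sum_(i < n) M i j * s i x p].

(* Degree d part of the ring of invariants of a subset H of GL_n (acting on
   column vectors of coordinates). *)
Definition invariant_form (K : fieldType) n (H : 'M[K]_n -> Prop) (d : nat)
    (f : {mpoly K[n]}) : Prop :=
  f \is d.-homog /\
  forall M, H M -> f \mPo [tuple \sum_(j < n) M i j *: 'X_j | i < n] = f.

(* An action of a finite group on P^(n-1) is linearized by its preimage in
   SL_n: here H is any set of linear lifts of the group that contains lifts of
   determinant 1 of all its elements.  The GIT quotient of P^(n-1) is Proj of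
   the graded ring formed by the following pieces. *)
Definition git_ring (K : fieldType) n (H : 'M[K]_n -> Prop)
  : nat -> {mpoly K[n]} -> Prop :=
  invariant_form (fun M => H M /\ \det M = 1).

(* Function field of Proj A, for A a graded subring of a polynomial ring with
   homogeneous pieces A d: the degree 0 part of its homogeneous localization at
   the zero ideal. *)
Definition Proj_function_field (K : fieldType) n
    (A : nat -> {mpoly K[n]} -> Prop) (phi : {fraction {mpoly K[n]}}) : Prop :=
  exists d f g, [/\ A d f, A d g, g != 0 & phi = f%:F / g%:F].

(* Proj A is rational: its function field is K-isomorphic to K(t_1, .., t_r). *)
Definition rational_Proj (K : fieldType) n (A : nat -> {mpoly K[n]} -> Prop)
  : Prop :=
  exists (r : nat)
      (h : {rmorphism {fraction {mpoly K[r]}} -> {fraction {mpoly K[n]}}}),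
    (forall c : K, h (c%:MP)%:F = (c%:MP)%:F) /\
    (forall phi, Proj_function_field A phi <-> exists psi, h psi = phi).

(* Main.v *)
(* Dually, a plane of P^4 is a wedge u ^ v of two linear forms, and a line of planes on S is a
   pencil b ^ P, with P a 3-dimensional space of forms containing b. Smoothness of S, i.e. the
   fact that tangent spaces of the Grassmannian meet V in dimension 3, forces four disjoint lines
   into a normal form, unique up to scalars: their centers satisfy b_0 + b_1 + b_2 + b_3 = 0 and
   the configuration is the same for every ordering of the lines. Hence each permutation of the
   b_i is induced by a g in GL_5, and Aut_sigma S is S_4. On H^0(O(2)) the sections b_i^2 span a
   copy of the permutation representation, which is a direct factor, with equivariant coordinates
   y_0, .., y_3. By the no-name lemma, twisting the remaining 12 coordinates by an invertible
   matrix that depends equivariantly on y makes them invariant, and the invariant field is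
   generated by the ratios of these and of the elementary symmetric functions of the y_i to
   powers of the sum of the y_i. All rational functions are handled through their values at
   general points. *)
Require Import Defs.
From HB Require Import structures.
From mathcomp Require Import all_boot all_order all_fingroup all_algebra.
From mathcomp.multinomials Require Import mpoly.
From mathcomp Require Import cyclic complex.
From mathcomp Require Import reals.
From mathcomp Require Import ring.

Set Implicit Arguments.
Unset Strict Implicit.
Unset Printing Implicit Defensive.
Import GRing.Theory Num.Theory.
Local Open Scope ring_scope.

(** * Fraction fields of polynomial rings *)

Local Notation "x %:F" := (FracField.tofrac x).

Section NonzeroPoint.
Variable K : numFieldType.

(** Smoothness enters in one form: at a point of the section no four independent vectors of the
    6-dimensional space V are tangent to the cone over the Grassmannian. A degenerate position of
    the lines is excluded by exhibiting such a quadruple in adapted coordinates. The delicate case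
    is that of three disjoint lines meeting a common line: smoothness allows it, and only the
    presence of a fourth disjoint line forbids it. On the invariant side the obstacle is the
    linearization, made of lifts of determinant 1, whereas the natural action is a genuine
    representation D of S_4. If c D(s) has determinant 1 then c^(24 n) = 1 for n = 16, so both have
    the same invariants in degrees divisible by 24 n, and every quotient of forms is brought to such
    a degree. Division is postponed in the same spirit: the inverse of the twisting matrix is
    replaced by its adjugate, whose extra factor cancels in quotients. Determinants occur through
    their 24th powers, from which the characters of S_4 disappear. *)

Lemma poly_nonroot (p : {poly K}) : p != 0 -> exists x, p.[x] != 0.
Proof.
move=> p0; pose s := [seq (i%:R : K) | i <- iota 0 (size p)].
have us : uniq s.
  by rewrite map_inj_in_uniq ?iota_uniq // => i j _ _ /eqP; rewrite eqr_nat => /eqP.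
have [al|/allPn[x _ rx]] := boolP (all (root p) s); last by exists x.
by have := max_poly_roots p0 al us; rewrite size_map size_iota ltnn.
Qed.

Local Notation widen := (widen_ord (leqnSn _)).

(** The leading coefficient of [p] survives in [muni p]: it sits in degree [m ord_max], at the
    monomial [m] deprived of its last exponent. *)
Lemma muni_neq0 n (p : {mpoly K[n.+1]}) : p != 0 -> muni p != 0.
Proof.
move=> p0; have mp := mlead_supp p0; set m := mlead p in mp.
apply/eqP => /(congr1 (fun q : {poly {mpoly K[n]}} => (q`_(m ord_max))@_[multinom m (widen i) | i < n])).
rewrite muniE coef0 mcoeff0 coef_sum raddf_sum (bigD1_seq m) //= big1.
  rewrite addr0 coefZ coefXn eqxx mulr1 mcoeffZ mcoeffX eqxx mulr1 => /eqP.
  by rewrite mcoeff_eq0 mp.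
move=> m' nm; rewrite coefZ coefXn; have [e|] := eqVneq; last by rewrite mulr0 mcoeff0.
rewrite mulr1 mcoeffZ mcoeffX; case: eqP => [/mnmP E|]; last by rewrite mulr0.
case/eqP: nm; apply/mnmP => i.
have [j ->|->] := unliftP ord_max i; last by [].
have := E j; rewrite !mnmE.
by have -> : widen j = lift ord_max j by apply/val_inj; rewrite /= /bump leqNgt ltn_ord.
Qed.

Lemma meval_muni n (p : {mpoly K[n.+1]}) (v : 'I_n.+1 -> K) :
  p.@[v] = (map_poly (meval (fun i => v (widen i))) (muni p)).[v ord_max].
Proof.
rewrite mevalE muniE raddf_sum horner_sum; apply: eq_bigr => m _ /=.
rewrite map_polyZ hornerZ map_polyXn hornerXn [X in _ = X * _]mevalZ mevalX big_ord_recr /= mulrA.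
by congr (_ * _ * _); apply: eq_bigr => i _; rewrite mnmE.
Qed.

(** Induction on the number of variables: at a point where the leading coefficient of [muni p] does
    not vanish, a nonzero polynomial in the last variable is left. *)
Lemma mpoly_nonroot n (p : {mpoly K[n]}) : p != 0 -> exists v, p.@[v] != 0.
Proof.
elim: n p => [|n IH] p p0.
  have E : p = (p@_0%MM)%:MP.
    apply/mpolyP => m; rewrite mcoeffC; have -> : m = 0%MM by apply/mnmP; case.
    by rewrite eqxx mulr1.
  by exists (fun=> 0); rewrite E mevalC; apply: contra p0 => /eqP E0; rewrite E E0 mpolyC0.
have q0 := muni_neq0 p0; rewrite -lead_coef_eq0 in q0.
have [u u0] := IH _ q0.
have : map_poly (meval u) (muni p) != 0.
  apply/eqP => /polyP/(_ (size (muni p)).-1).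
  by rewrite coef_map /= coef0; apply/eqP.
case/poly_nonroot => x rx.
exists (fun i => oapp u x (unlift ord_max i)); rewrite meval_muni unlift_none /=.
apply: contra rx => /eqP E; apply/eqP; rewrite -E; congr (_.[_]).
apply/polyP => i; rewrite !coef_map /=; apply: meval_eq => j.
have -> : widen j = lift ord_max j by apply/val_inj; rewrite /= /bump leqNgt ltn_ord.
by rewrite liftK.
Qed.

Lemma mpoly_eq_eval n (p q : {mpoly K[n]}) : (forall v, p.@[v] = q.@[v]) -> p = q.
Proof.
move=> E; apply/eqP; rewrite -subr_eq0; apply/negPn/negP => /mpoly_nonroot[v].
by rewrite mevalB E subrr eqxx.
Qed.
End NonzeroPoint.

Lemma frac_repr (R : idomainType) (x : {fraction R}) :
  x = (\n_(generic_quotient.repr x))%:F / (\d_(generic_quotient.repr x))%:F.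
Proof.
set r := generic_quotient.repr x; have d0 : \d_r != 0 by apply: denom_ratioP.
rewrite -[LHS]reprK -/r; apply: (@mulIf _ (\d_r)%:F); first by rewrite tofrac_eq0.
rewrite divfK ?tofrac_eq0 // /FracField.tofrac; unlock.
rewrite -[LHS]FracField.pi_mul; apply/eqmodP; rewrite /= FracField.equivfE.
by rewrite /FracField.mulf !numden_Ratio ?(oner_neq0, mulr1, mul1r) // mulrC.
Qed.

Lemma fracP (R : idomainType) (x : {fraction R}) : exists a b, b != 0 /\ x = a%:F / b%:F.
Proof. by exists \n_(generic_quotient.repr x), \d_(generic_quotient.repr x); split; [apply: denom_ratioP | apply: frac_repr]. Qed.

Lemma frac_eq (R : idomainType) (a b c d : R) : b != 0 -> d != 0 ->
  (a%:F / b%:F == c%:F / d%:F) = (a * d == c * b).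
Proof.
move=> b0 d0; rewrite GRing.eqr_div ?tofrac_eq0 //.
by rewrite -!tofracM tofrac_eq.
Qed.

Section FracLift.
Variables (R : idomainType) (F : fieldType) (f : {rmorphism R -> F}).
Hypothesis f_inj : forall x, f x = 0 -> x = 0.

(** Defined through the chosen representative; injectivity of [f] keeps denominators nonzero and, by
    [frac_liftE], makes the choice irrelevant. *)
Definition frac_lift (x : {fraction R}) : F := f (\n_(generic_quotient.repr x)) / f (\d_(generic_quotient.repr x)).

Lemma frac_lift_neq0 c : c != 0 -> f c != 0.
Proof. by move=> c0; apply: contra_neq c0 => /f_inj. Qed.

Lemma frac_liftE a b : b != 0 -> frac_lift (a%:F / b%:F) = f a / f b.
Proof.
move=> b0; rewrite /frac_lift; set r := generic_quotient.repr _.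
have d0 : \d_r != 0 by apply: denom_ratioP.
have /eqP := frac_repr (a%:F / b%:F); rewrite -/r frac_eq // => /eqP /(congr1 f).
by rewrite !rmorphM => E; apply/eqP; rewrite GRing.eqr_div ?frac_lift_neq0 // E.
Qed.

Lemma frac_lift_zmod : zmod_morphism frac_lift.
Proof.
move=> x y; have [a [b [b0 ->]]] := fracP x; have [c [d [d0 ->]]] := fracP y.
rewrite -mulNr -tofracN addf_div ?tofrac_eq0 // -!tofracM -tofracD.
rewrite !frac_liftE ?mulf_neq0 // -mulNr addf_div ?frac_lift_neq0 //.
by rewrite !rmorphD !rmorphM rmorphN.
Qed.

Lemma frac_lift_monoid : monoid_morphism frac_lift.
Proof.
split=> [|x y].
  by rewrite -tofrac1 -[1%:F]divr1 -tofrac1 frac_liftE ?oner_eq0 // divff ?frac_lift_neq0 ?oner_eq0.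
have [a [b [b0 ->]]] := fracP x; have [c [d [d0 ->]]] := fracP y.
by rewrite mulf_div -!tofracM !frac_liftE ?mulf_neq0 // !rmorphM mulf_div.
Qed.

HB.instance Definition _ := GRing.isZmodMorphism.Build {fraction R} F frac_lift frac_lift_zmod.
HB.instance Definition _ := GRing.isMonoidMorphism.Build {fraction R} F frac_lift frac_lift_monoid.

Lemma frac_lift_tofrac a : frac_lift a%:F = f a.
Proof. by rewrite -[a%:F]divr1 -tofrac1 frac_liftE ?oner_eq0 // rmorph1 divr1. Qed.

Lemma frac_lift_exists : exists h : {rmorphism {fraction R} -> F}, forall a, h a%:F = f a.
Proof. by exists frac_lift; exact: frac_lift_tofrac. Qed.
End FracLift.

(** * Functions given by polynomials *)

Section PolyFun.
Variables (K : numFieldType) (m : nat).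
Implicit Types (G H : ('I_m -> K) -> K).

(** Polynomials are built from their values: the closure properties below replace computations with
    matrices over a polynomial ring. *)
Definition polyfun G := exists p : {mpoly K[m]}, forall v, G v = p.@[v].

Lemma polyfun_ext G H : G =1 H -> polyfun G -> polyfun H.
Proof. by move=> E [p Hp]; exists p => v; rewrite -E. Qed.

Lemma polyfun_cst c : polyfun (fun=> c).
Proof. by exists c%:MP => v; rewrite mevalC. Qed.

Lemma polyfun_var i : polyfun (fun v => v i).
Proof. by exists 'X_i => v; rewrite mevalXU. Qed.

Lemma polyfunD G H : polyfun G -> polyfun H -> polyfun (fun v => G v + H v).
Proof. by move=> [p Hp] [q Hq]; exists (p + q) => v; rewrite mevalD Hp Hq. Qed.

Lemma polyfunM G H : polyfun G -> polyfun H -> polyfun (fun v => G v * H v).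
Proof. by move=> [p Hp] [q Hq]; exists (p * q) => v; rewrite mevalM Hp Hq. Qed.

Lemma polyfunX G k : polyfun G -> polyfun (fun v => G v ^+ k).
Proof. by move=> [p Hp]; exists (p ^+ k) => v; rewrite rmorphXn Hp. Qed.

Lemma polyfun_sum (I : Type) (r : seq I) (P : pred I) (G : I -> ('I_m -> K) -> K) :
  (forall i, polyfun (G i)) -> polyfun (fun v => \sum_(i <- r | P i) G i v).
Proof.
move=> HG; elim: r => [|i r IH].
  by apply: polyfun_ext (polyfun_cst 0) => v; rewrite big_nil.
have [Pi|nPi] := boolP (P i).
  by apply: polyfun_ext (polyfunD (HG i) IH) => v; rewrite big_cons Pi.
by apply: polyfun_ext IH => v; rewrite big_cons (negPf nPi).
Qed.

Lemma polyfun_prod (I : Type) (r : seq I) (P : pred I) (G : I -> ('I_m -> K) -> K) :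
  (forall i, polyfun (G i)) -> polyfun (fun v => \prod_(i <- r | P i) G i v).
Proof.
move=> HG; elim: r => [|i r IH].
  by apply: polyfun_ext (polyfun_cst 1) => v; rewrite big_nil.
have [Pi|nPi] := boolP (P i).
  by apply: polyfun_ext (polyfunM (HG i) IH) => v; rewrite big_cons Pi.
by apply: polyfun_ext IH => v; rewrite big_cons (negPf nPi).
Qed.

Lemma polyfun_det k (A : ('I_m -> K) -> 'M[K]_k) :
  (forall i j, polyfun (fun v => A v i j)) -> polyfun (fun v => \det (A v)).
Proof.
move=> HA; apply: polyfun_sum => s; apply: polyfunM; first exact: polyfun_cst.
exact: polyfun_prod.
Qed.

Lemma polyfun_adj k (A : ('I_m -> K) -> 'M[K]_k) :
  (forall i j, polyfun (fun v => A v i j)) ->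
  forall i j, polyfun (fun v => (\adj (A v)) i j).
Proof.
move=> HA i j; apply: (@polyfun_ext (fun v => cofactor (A v) j i)) => [v|].
  by rewrite mxE.
apply: polyfunM; first exact: polyfun_cst.
apply: polyfun_det => a b; apply: polyfun_ext (HA (lift j a) (lift i b)) => v.
by rewrite !mxE.
Qed.

Lemma polyfun_comp k (p : {mpoly K[k]}) (G : 'I_k -> ('I_m -> K) -> K) :
  (forall i, polyfun (G i)) -> polyfun (fun v => p.@[fun i => G i v]).
Proof.
move=> HG.
apply: (@polyfun_ext (fun v => \sum_(e <- msupp p) p@_e * \prod_i G i v ^+ e i)) => [v|].
  by rewrite mevalE.
apply: polyfun_sum => e; apply: polyfunM; first exact: polyfun_cst.
by apply: polyfun_prod => i; apply: polyfunX.
Qed.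

End PolyFun.

Section HomogEval.
Variables (K : numFieldType) (n : nat).

Lemma dhomog_eval (p : {mpoly K[n]}) d c v : p \is d.-homog ->
  p.@[fun i => c * v i] = c ^+ d * p.@[v].
Proof.
move=> /dhomogP Hp; rewrite !mevalE mulr_sumr !big_seq; apply: eq_bigr => m Hm.
rewrite (eq_bigr (fun i => c ^+ m i * v i ^+ m i)) => [|i _]; last by rewrite exprMn.
rewrite big_split prodrXr /= mulrCA; congr (_ ^+ _ * _).
by have := Hp m Hm; rewrite /= mdegE.
Qed.

(** Scaling by 2 already separates the degrees, powers of 2 being distinct in characteristic 0; [q]
    is [p] with all variables doubled. *)
Lemma eval_dhomog (p : {mpoly K[n]}) d :
  (forall c v, p.@[fun i => c * v i] = c ^+ d * p.@[v]) -> p \is d.-homog.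
Proof.
move=> H; pose q := \sum_(m <- msupp p) ((2%:R ^+ mdeg m) * p@_m) *: 'X_[m].
have Eq : q = 2%:R ^+ d *: p.
  apply: mpoly_eq_eval => v; rewrite mevalZ -H /q raddf_sum /= mevalE.
  apply: eq_bigr => m _; rewrite [LHS]mevalZ mevalX [_ * p@_m]mulrC -mulrA.
  congr (_ * _); rewrite mdegE -prodrXr -big_split /=.
  by apply: eq_bigr => i _; rewrite exprMn mulrC.
apply/dhomogP => m Hm /=; have := congr1 (fun r => r@_m) Eq.
rewrite mcoeffZ /q raddf_sum (bigD1_seq m) //= big1 => [|m' nm]; last first.
  by rewrite mcoeffZ mcoeffX (negPf nm) mulr0.
rewrite addr0 mcoeffZ mcoeffX eqxx mulr1 => /mulIf E.
have : (2%:R : K) ^+ mdeg m = 2%:R ^+ d by apply: E; rewrite mcoeff_eq0 Hm.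
by rewrite -!natrX => /eqP; rewrite eqr_nat eqn_exp2l // => /eqP.
Qed.

End HomogEval.

(** * Values of rational functions at points *)

Section Val.
Variables (K : numFieldType) (n : nat).
Local Notation F := {fraction {mpoly K[n]}}.
Implicit Types (x y : F) (v : 'I_n -> K).

(* The rational function x is regular at v, with value c. *)
Definition val_at x v (c : K) := exists p q : {mpoly K[n]},
  [/\ q.@[v] != 0, x = p%:F / q%:F & c = p.@[v] / q.@[v]].

Lemma meval_neq0 (q : {mpoly K[n]}) v : q.@[v] != 0 -> q != 0.
Proof. by apply: contraNneq => ->; rewrite meval0. Qed.

Lemma val_frac (p q : {mpoly K[n]}) v : q.@[v] != 0 -> val_at (p%:F / q%:F) v (p.@[v] / q.@[v]).
Proof. by exists p, q. Qed.

Lemma val_poly (p : {mpoly K[n]}) v : val_at p%:F v p.@[v].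
Proof.
have := @val_frac p 1 v; rewrite meval1 tofrac1 !divr1; apply; exact: oner_neq0.
Qed.

Lemma val_cst c v : val_at (c%:MP)%:F v c.
Proof. by have := val_poly c%:MP v; rewrite mevalC. Qed.

Lemma val_atD x y v c d : val_at x v c -> val_at y v d -> val_at (x + y) v (c + d).
Proof.
move=> [p [q [q0 -> ->]]] [r [s [s0 -> ->]]].
rewrite addf_div ?tofrac_eq0 ?(meval_neq0 q0) ?(meval_neq0 s0) // addf_div //.
by rewrite -!mevalM -mevalD -!tofracM -tofracD; apply: val_frac; rewrite mevalM mulf_neq0.
Qed.

Lemma val_atM x y v c d : val_at x v c -> val_at y v d -> val_at (x * y) v (c * d).
Proof.
move=> [p [q [q0 -> ->]]] [r [s [s0 -> ->]]].
rewrite !mulf_div -!mevalM -!tofracM; apply: val_frac; by rewrite mevalM mulf_neq0.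
Qed.

Lemma val_atX x v c k : val_at x v c -> val_at (x ^+ k) v (c ^+ k).
Proof.
move=> H; elim: k => [|k IH]; last by rewrite !exprS; apply: val_atM.
by rewrite !expr0; have := val_cst 1 v; rewrite mpolyC1 tofrac1.
Qed.

Lemma val_atV x v c : c != 0 -> val_at x v c -> val_at x^-1 v c^-1.
Proof.
move=> c0 [p [q [q0 -> E]]]; rewrite E !invf_div; apply: val_frac.
by apply: contraNneq c0 => p0; rewrite E p0 mul0r.
Qed.

Lemma val_neq0 x v c : c != 0 -> val_at x v c -> x != 0.
Proof.
move=> c0 [p [q [q0 -> E]]]; rewrite mulf_neq0 ?invr_eq0 ?tofrac_eq0 ?(meval_neq0 q0) //.
apply: (@meval_neq0 _ v); by apply: contraNneq c0 => p0; rewrite E p0 mul0r.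
Qed.

Lemma val_mmap r (P : {mpoly K[r]}) (t : 'I_r -> F) (u : 'I_r -> K) v :
  (forall k, val_at (t k) v (u k)) ->
  val_at (mmap ((@FracField.tofrac _) \o (@mpolyC n K)) t P) v P.@[u].
Proof.
move=> H; rewrite /mmap mevalE.
elim/big_rec2: _ => [|m c x _ IH]; first by have := val_cst 0 v; rewrite mpolyC0 tofrac0.
apply: val_atD IH; apply: val_atM; first exact: val_cst.
rewrite /mmap1; elim/big_rec2: _ => [|i d y _ IH]; first by have := val_cst 1 v; rewrite mpolyC1 tofrac1.
by apply: val_atM IH; apply: val_atX.
Qed.

(** If the two fractions differed, the product of their cross difference, of [w] and of both
    denominators would be nonzero at some point, where the values have to agree. *)
Lemma val_eq x y (w : {mpoly K[n]}) : w != 0 ->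
  (forall v, w.@[v] != 0 -> exists2 c, val_at x v c & val_at y v c) -> x = y.
Proof.
move=> w0 H; have [p [q [q0 Ex]]] := fracP x; have [r [s [s0 Ey]]] := fracP y.
apply/eqP; rewrite Ex Ey frac_eq // -subr_eq0.
apply: contraTT isT => d0.
have := mulf_neq0 (mulf_neq0 d0 w0) (mulf_neq0 q0 s0).
case/mpoly_nonroot => v; rewrite !mevalM !mulf_eq0 !negb_or.
case/andP=> /andP[dv wv] /andP[qv sv].
have E (p1 p2 q1 q2 : {mpoly K[n]}) : q1.@[v] != 0 -> q2.@[v] != 0 ->
    p1%:F / q1%:F = p2%:F / q2%:F -> p1.@[v] / q1.@[v] = p2.@[v] / q2.@[v].
  move=> h1 h2 /eqP; rewrite frac_eq ?(meval_neq0 h1) ?(meval_neq0 h2) // => /eqP.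
  by move/(congr1 (meval v)); rewrite !mevalM => E; apply/eqP; rewrite GRing.eqr_div // E.
have [c [p1 [q1 [h1 E1 F1]]] [p2 [q2 [h2 E2 F2]]]] := H v wv.
rewrite Ex in E1; rewrite Ey in E2.
have := E _ _ _ _ qv h1 E1; have := E _ _ _ _ sv h2 E2; rewrite -F1 -F2 => <- /eqP.
by rewrite GRing.eqr_div // => /eqP e; case/negP: dv; rewrite mevalB !mevalM e subrr.
Qed.

End Val.

(** * Symmetric functions on a slice *)

Section SymEval.
Variables (K : numFieldType).

Lemma meval_msym n (s : 'S_n) (p : {mpoly K[n]}) a :
  (msym s p).@[a] = p.@[fun i => a (s i)].
Proof.
rewrite /msym /mmap raddf_sum mevalE; apply: eq_bigr => m _.
rewrite [LHS]mevalM mevalC; congr (_ * _); rewrite /mmap1 rmorph_prod.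
by apply: eq_bigr => i _; rewrite rmorphXn /= mevalXU.
Qed.

Lemma symmetric_eval n (p : {mpoly K[n]}) :
  (forall (s : 'S_n) a, p.@[fun i => a (s i)] = p.@[a]) -> p \is symmetric.
Proof. by move=> H; apply/issymP => s; apply: mpoly_eq_eval => a; rewrite meval_msym. Qed.

Lemma eval_symmetric n (p : {mpoly K[n]}) (s : 'S_n) a :
  p \is symmetric -> p.@[fun i => a (s i)] = p.@[a].
Proof. by move=> /issymP/(_ s) {2}<-; rewrite meval_msym. Qed.

Section Join.
Variables (m q : nat).

Definition join (a : 'I_m -> K) (z : 'I_q -> K) (i : 'I_(m + q)) : K :=
  match split i with inl j => a j | inr j => z j end.

Lemma join_l a z j : join a z (lshift q j) = a j.
Proof. by rewrite /join; case: splitP => [k /= /val_inj -> //|k /= E]; have := ltn_ord j; rewrite E ltnNge leq_addr. Qed.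

Lemma join_r a z j : join a z (rshift m j) = z j.
Proof.
rewrite /join; case: splitP => [k /= E|k /= /addnI /val_inj -> //].
by have := ltn_ord k; rewrite -E ltnNge leq_addr.
Qed.

Lemma join_eta (v : 'I_(m + q) -> K) : join (fun j => v (lshift q j)) (fun j => v (rshift m j)) =1 v.
Proof. by move=> i; rewrite -(splitK i); case: (split i) => j /=; rewrite ?join_l ?join_r. Qed.

Lemma join_eq (a b : 'I_m -> K) (z w : 'I_q -> K) : a =1 b -> z =1 w -> join a z =1 join b w.
Proof. by move=> E F i; rewrite /join; case: split. Qed.

End Join.

Variable q : nat.

(* On the slice [e_1 = 1], the functions of (a, z) that are symmetric in the four
   variables a are polynomials in these coordinates. *)
Definition slice_coord (a : 'I_4 -> K) (z : 'I_q -> K) : 'I_(3 + q) -> K :=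
  join (fun j : 'I_3 => (mesym 4 K j.+2).@[a]) z.

(** Each monomial of [f] is averaged over S_4 in the variables a, the average is written in
    elementary symmetric functions, and e_1 is replaced by 1. The symmetry of [f] is asked only at
    the point considered, where averaging changes nothing; [P] itself does not depend on that point.
    This matters because symmetry will be known only where a determinant is nonzero. *)
Lemma symmetric_slice (f : {mpoly K[4 + q]}) :
  exists P : {mpoly K[3 + q]}, forall a z, \sum_i a i = 1 ->
    (forall s : 'S_4, f.@[join (fun i => a (s i)) z] = f.@[join a z]) ->
    f.@[join a z] = P.@[slice_coord a z].
Proof.
pose S (m : 'X_{1..4 + q}) : {mpoly K[4]} :=
  \sum_(s : 'S_4) \prod_i 'X_(s i) ^+ m (lshift q i).
have evS m a : (S m).@[a] = \sum_(s : 'S_4) \prod_i a (s i) ^+ m (lshift q i).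
  rewrite /S raddf_sum; apply: eq_bigr => s _; rewrite [LHS](rmorph_prod (meval a)).
  by apply: eq_bigr => i _; rewrite rmorphXn /= mevalXU.
have symS m : S m \is symmetric.
  apply: symmetric_eval => s a; rewrite !evS (reindex_inj (mulIg (s^-1)%g)) /=.
  by apply: eq_bigr => t _; apply: eq_bigr => i _; rewrite permM permKV.
(* The variable of index 0 stands for e_1 and is sent to 1; the other three become the first
   variables of [P]. *)
pose U : 4.-tuple {mpoly K[3 + q]} :=
  [tuple (if unlift ord0 i is Some j then 'X_(lshift q j) else 1) | i < 4].
pose P := \sum_(m <- msupp f) (24%:R^-1 * f@_m) *:
  ((tag (sym_fundamental (symS m)) \mPo U) * \prod_j 'X_(rshift 3 j) ^+ m (rshift 4 j)).
exists P => a z a1 fsym.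
have n24 : (24%:R : K) != 0 by rewrite pnatr_eq0.
have -> : f.@[join a z] = 24%:R^-1 * \sum_(s : 'S_4) f.@[join (fun i => a (s i)) z].
  rewrite (eq_bigr (fun=> f.@[join a z])) => [|s _]; last exact: fsym.
  by rewrite sumr_const card_Sn -[X in _ * X]mulr_natl mulKf.
rewrite /P raddf_sum /= mulr_sumr.
under eq_bigr do rewrite mevalE.
rewrite -mulr_sumr exchange_big mulr_sumr /=; apply: eq_bigr => m _.
rewrite [RHS]mevalZ -mulrA. congr (_ * _); rewrite -mulr_sumr; congr (_ * _).
have -> : ((tag (sym_fundamental (symS m)) \mPo U) * \prod_j 'X_(rshift 3 j) ^+ m (rshift 4 j)).@[slice_coord a z]
   = (S m).@[a] * \prod_j z j ^+ m (rshift 4 j).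
  rewrite mevalM; congr (_ * _).
    case: (sym_fundamental (symS m)) => t /= [<- _]; rewrite !comp_mpoly_meval.
    apply: meval_eq => i; rewrite !tnth_mktuple.
    case: unliftP => [j ->|->]; first by rewrite mevalXU /slice_coord join_l.
    by rewrite meval1 mesym1E raddf_sum /= -a1; apply: eq_bigr => k _; rewrite mevalXU.
  rewrite rmorph_prod; apply: eq_bigr => j _.
  by rewrite rmorphXn /= mevalXU /slice_coord join_r.
rewrite evS mulr_suml; apply: eq_bigr => s _.
rewrite /mmap1 big_split_ord /=; congr (_ * _); apply: eq_bigr => i _; by rewrite ?join_l ?join_r.
Qed.

End SymEval.

(** * Quotients by S_4 *)

Section Equivariant.
Variables (K : numFieldType) (n : nat) (D : 'S_4 -> 'M[K]_n).
Hypotheses (D1 : D 1%g = 1%:M) (DM : forall s t, D (s * t)%g = D t *m D s).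

Lemma row_perm_mul m p r (s : 'S_m) (A : 'M[K]_(m, p)) (B : 'M_(p, r)) :
  row_perm s A *m B = row_perm s (A *m B).
Proof. by apply/matrixP => i j; rewrite !mxE; apply: eq_bigr => k _; rewrite mxE. Qed.

(* Maschke averaging *)
Lemma equivariant_retraction (Z : 'M[K]_(n, 4)) (Y0 : 'M[K]_(4, n)) :
  (forall s, D s *m Z = col_perm s Z) -> Y0 *m Z = 1%:M ->
  exists Y : 'M[K]_(4, n), Y *m Z = 1%:M /\ forall s, Y *m D s = row_perm s^-1 Y.
Proof.
move=> DZ Y0Z; pose Y := 24%:R^-1 *: \sum_(s : 'S_4) row_perm s (Y0 *m D s).
exists Y; split.
  rewrite /Y -scalemxAl mulmx_suml (eq_bigr (fun=> 1%:M)) => [|s _].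
    by rewrite sumr_const card_Sn -scaler_nat scalerA mulVf ?scale1r // pnatr_eq0.
  rewrite row_perm_mul -mulmxA DZ; apply/matrixP => i j.
  have := congr1 (fun M : 'M_4 => M (s i) (s j)) Y0Z.
  rewrite !mxE (inj_eq perm_inj) => <-.
  by apply: eq_bigr => k _; rewrite mxE.
move=> t; rewrite /Y -scalemxAl [RHS]linearZ /=; congr (_ *: _).
rewrite mulmx_suml linear_sum [RHS](reindex_inj (mulgI t)) /=; apply: eq_bigr => s _.
rewrite row_perm_mul -mulmxA -DM; apply/matrixP => i j.
by rewrite !mxE permM permKV.
Qed.

End Equivariant.

Section ApplyMx.
Variable K : numFieldType.

Definition apply_mx m p (M : 'M[K]_(m, p)) (v : 'I_p -> K) : 'I_m -> K :=
  fun i => \sum_j M i j * v j.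

Lemma apply_mxE m p (M : 'M[K]_(m, p)) v i : apply_mx M v i = (M *m \col_j v j) i 0.
Proof. by rewrite mxE; apply: eq_bigr => j _; rewrite mxE. Qed.

Lemma apply_mxM m p r (M : 'M[K]_(m, p)) (N : 'M[K]_(p, r)) v :
  apply_mx M (apply_mx N v) =1 apply_mx (M *m N) v.
Proof.
move=> i; rewrite !apply_mxE -mulmxA; congr ((_ *m _) _ _).
by apply/colP => j; rewrite mxE apply_mxE.
Qed.

Lemma apply_mx_eq m p (M : 'M[K]_(m, p)) v w : v =1 w -> apply_mx M v =1 apply_mx M w.
Proof. by move=> E i; apply: eq_bigr => j _; rewrite E. Qed.

Lemma apply_mxZ m p (M : 'M[K]_(m, p)) c v i : apply_mx M (fun j => c * v j) i = c * apply_mx M v i.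
Proof. by rewrite /apply_mx mulr_sumr; apply: eq_bigr => j _; rewrite mulrCA. Qed.

Lemma apply_mxZl m p (M : 'M[K]_(m, p)) c v i : apply_mx (c *: M) v i = c * apply_mx M v i.
Proof. by rewrite /apply_mx mulr_sumr; apply: eq_bigr => j _; rewrite mxE mulrA. Qed.

Lemma polyfun_apply m p r (M : ('I_m -> K) -> 'M[K]_(p, r)) (g : 'I_r -> ('I_m -> K) -> K) i :
  (forall i j, polyfun (fun v => M v i j)) -> (forall j, polyfun (g j)) ->
  polyfun (fun v => apply_mx (M v) (fun j => g j v) i).
Proof. by move=> HM Hg; apply: polyfun_sum => j; apply: polyfunM. Qed.

End ApplyMx.

(** * The twisting matrix *)

Section Generators.
Variables (K : numClosedFieldType) (q : nat).
Local Notation n := (4 + q)%N.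
Variables (D : 'S_4 -> 'M[K]_n) (Y : 'M[K]_(4, n)) (Lam : 'M[K]_(q, n)).
Hypotheses (D1 : D 1%g = 1%:M) (DM : forall s t, D (s * t)%g = D t *m D s).
Hypothesis YD : forall s, Y *m D s = row_perm s^-1 Y.
Hypothesis YLam : col_mx Y Lam \in unitmx.
Implicit Types (a : 'I_4 -> K) (v : 'I_n -> K) (s t : 'S_4).

(* Separates the 24 rearrangements of the point (1/10, 2/10, 3/10, 4/10). *)
Definition theta a : K :=
  \prod_(i < 4) \prod_(j < 4 | j != i) (10%:R * a i - j.+1%:R * \sum_k a k).

Definition a0 (i : 'I_4) : K := i.+1%:R / 10%:R.

Lemma sum_a0 : \sum_i a0 i = 1.
Proof.
rewrite -mulr_suml -natr_sum !big_ord_recl big_ord0 /=.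
by rewrite divff // pnatr_eq0.
Qed.

(** At the rearrangement of [a0] by s the factor of index (i, j) is s(i) - j; if s is not the
    identity, some s(i) = j differs from i and kills the product. *)
Lemma theta_a0 s : (theta (fun i => a0 (s i)) != 0) = (s == 1%g).
Proof.
have S : \sum_k a0 (s k) = 1 by rewrite -sum_a0 [RHS](reindex_inj (@perm_inj _ s)).
have E i (j : 'I_4) : (10%:R * a0 (s i) - j.+1%:R * \sum_k a0 (s k) == 0) = (s i == j).
  rewrite S mulr1 /a0 mulrC divfK ?pnatr_eq0 // subr_eq0 eqr_nat eqSS.
  by apply/eqP/eqP => [/val_inj|->].
apply/idP/eqP => [/prodf_neq0 H|s1].
  apply/permP => i; rewrite perm1; apply/eqP; apply: contraT => ni.
  by have /prodf_neq0/(_ (s i) ni) := H i isT; rewrite E eqxx.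
apply/prodf_neq0 => i _; apply/prodf_neq0 => j ji.
by rewrite /= E s1 perm1 eq_sym.
Qed.

Lemma polyfun_theta m (g : 'I_4 -> ('I_m -> K) -> K) :
  (forall i, polyfun (g i)) -> polyfun (fun w => theta (fun i => g i w)).
Proof.
move=> Hg; apply: polyfun_prod => i; apply: polyfun_prod => j.
apply: polyfunD; first by apply: polyfunM (Hg i); apply: polyfun_cst.
apply: (@polyfun_ext _ _ (fun w => - j.+1%:R * \sum_k g k w)) => [w|]; first by rewrite mulNr.
by apply: polyfunM; [apply: polyfun_cst|apply: polyfun_sum].
Qed.

(** There are 12 = 4 * 3 factors, each homogeneous of degree 1 because the constants are multiplied
    by the sum of the entries. *)
Lemma thetaZ c a : theta (fun i => c * a i) = c ^+ 12 * theta a.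
Proof.
have -> : c ^+ 12 = \prod_(i < 4) \prod_(j < 4 | j != i) c.
  rewrite (eq_bigr (fun=> c ^+ 3)) => [|i _]; first by rewrite prodr_const card_ord -exprM.
  by rewrite prodr_const cardC1 card_ord.
rewrite /theta -big_split; apply: eq_bigr => i _; rewrite -big_split; apply: eq_bigr => j _ /=.
by rewrite -mulr_sumr mulrBr (mulrCA 10%:R) (mulrCA j.+1%:R).
Qed.

Lemma theta_eq a b : a =1 b -> theta a = theta b.
Proof.
move=> E; apply: eq_bigr => i _; apply: eq_bigr => j _.
by rewrite E (eq_bigr _ (fun k _ => E k)).
Qed.

(* theta vanishes at all nontrivial rearrangements of a0, so that twist is invertible at a0; and
   twist intertwines the permutation of a with the action of D. *)
Definition twist a : 'M[K]_n := \sum_(s : 'S_4) theta (fun i => a (s^-1%g i)) *: D s.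

Lemma twist_eq a b : a =1 b -> twist a = twist b.
Proof. by move=> E; apply: eq_bigr => s _; congr (_ *: _); apply: theta_eq => i; rewrite E. Qed.

Lemma twist_perm a t : twist (fun i => a (t^-1%g i)) *m D t = twist a.
Proof.
rewrite /twist mulmx_suml [RHS](reindex_inj (mulgI t)); apply: eq_bigr => s _ /=.
by rewrite -scalemxAl -DM; congr (_ *: _); apply: theta_eq => i; rewrite invMg permM.
Qed.

Lemma twistZ c a : twist (fun i => c * a i) = c ^+ 12 *: twist a.
Proof. by rewrite /twist scaler_sumr; apply: eq_bigr => s _; rewrite scalerA -thetaZ. Qed.

Lemma twist_a0 : twist a0 = theta a0 *: 1%:M.
Proof.
rewrite /twist (bigD1 1%g) //= big1 ?addr0 => [|s ns].
  by rewrite D1; congr (_ *: _); apply: theta_eq => i; rewrite invg1 perm1.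
have : theta (fun i => a0 (s^-1%g i)) == 0 by rewrite -[_ == 0]negbK theta_a0 eq_invg1.
by move/eqP->; rewrite scale0r.
Qed.

(** Applied to v, with a = Y v, the upper block gives the coordinates that S_4 permutes and the
    lower block gives invariant ones. *)
Definition twisted_frame a : 'M[K]_n := col_mx Y (Lam *m twist a).

Lemma frame_eq a b : a =1 b -> twisted_frame a = twisted_frame b.
Proof. by move=> E; rewrite /twisted_frame (twist_eq E). Qed.

Lemma det_frame_a0 : \det (twisted_frame a0) != 0.
Proof.
have -> : twisted_frame a0 = block_mx 1%:M 0 0 (theta a0)%:M *m col_mx Y Lam.
  rewrite mul_block_col !mul1mx !mul0mx addr0 add0r /twisted_frame twist_a0.
  by rewrite -scalemxAr mulmx1 mul_scalar_mx.
rewrite det_mulmx det_ublock det1 mul1r det_scalar mulf_neq0 //.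
  apply: expf_neq0; rewrite (@theta_eq _ (fun i => a0 ((1%g : 'S_4) i))) ?theta_a0 // => i.
  by rewrite perm1.
by rewrite -unitfE -unitmxE.
Qed.

Definition perm_block s : 'M[K]_n := block_mx (perm_mx s) 0 0 1%:M.

Lemma frame_perm a t : twisted_frame (fun i => a (t^-1%g i)) *m D t = perm_block t^-1 *m twisted_frame a.
Proof.
rewrite /twisted_frame mul_col_mx mul_block_col !mul0mx addr0 add0r mul1mx.
by rewrite YD -mulmxA twist_perm row_permE.
Qed.

Lemma det_perm_block s : \det (perm_block s) ^+ 24 = 1.
Proof. by rewrite det_ublock det1 mulr1 det_perm -exprM mulnC exprM -signr_odd expr0 expr1n. Qed.

Lemma det_D s : \det (D s) ^+ 24 = 1.
Proof.
have H k : \det (D s) ^+ k = \det (D (s ^+ k)%g).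
  elim: k => [|k IH]; first by rewrite expr0 expg0 D1 det1.
  by rewrite exprSr expgSr DM det_mulmx IH mulrC.
rewrite H; have -> : (s ^+ 24 = 1)%g.
  by have := expg_cardG (in_setT s); rewrite cardsT card_Sn.
by rewrite D1 det1.
Qed.

Lemma D_unit s : D s \in unitmx.
Proof.
rewrite unitmxE unitfE; apply: contra_eq_neq (det_D s) => ->.
by rewrite expr0n eq_sym oner_neq0.
Qed.

(** The determinants of [perm_block] and of [D] are 24th roots of unity, so only the 24th power of
    the determinant is a symmetric function of a. *)
Lemma frame_perm_sym a t :
  \det (twisted_frame (fun i => a (t^-1%g i))) ^+ 24 = \det (twisted_frame a) ^+ 24.
Proof.
have := congr1 (fun M => \det M ^+ 24) (frame_perm a t).
by rewrite !det_mulmx !exprMn det_perm_block det_D mulr1 mul1r.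
Qed.

Lemma polyfun_frame m (g : 'I_4 -> ('I_m -> K) -> K) i j :
  (forall i, polyfun (g i)) -> polyfun (fun w => twisted_frame (fun i => g i w) i j).
Proof.
move=> Hg; rewrite /twisted_frame; case: (split_ordP i) => k ->.
  by apply: polyfun_ext (polyfun_cst _ (Y k j)) => w; rewrite col_mxEu.
apply: (@polyfun_ext _ _ (fun w => \sum_l Lam k l * twist (fun i => g i w) l j)) => [w|].
  by rewrite col_mxEd mxE.
apply: polyfun_sum => l; apply: polyfunM; first exact: polyfun_cst.
apply: (@polyfun_ext _ _ (fun w => \sum_(s : 'S_4) theta (fun i => g (s^-1%g i) w) * D s l j)) => [w|].
  by rewrite summxE; apply: eq_bigr => s _; rewrite mxE.
by apply: polyfun_sum => s; apply: polyfunM; [apply: polyfun_theta | apply: polyfun_cst].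
Qed.

End Generators.

(** * Function fields of Proj, and GIT rings *)

Section ProjField.
Variables (K : fieldType) (n : nat) (A : nat -> {mpoly K[n]} -> Prop).
Hypotheses (AM : forall d e f g, A d f -> A e g -> A (d + e)%N (f * g))
  (AD : forall d f g, A d f -> A d g -> A d (f + g)) (AC : forall c, A 0%N c%:MP).
Local Notation P := (Proj_function_field A).

Lemma Proj_cst c : P (c%:MP)%:F.
Proof. by exists 0%N, c%:MP, 1; rewrite tofrac1 divr1 oner_neq0 -mpolyC1. Qed.

Lemma ProjD x y : P x -> P y -> P (x + y).
Proof.
move=> [d [f [g [Af Ag g0 ->]]]] [e [f' [g' [Af' Ag' g'0 ->]]]].
exists (d + e)%N, (f * g' + f' * g), (g * g'); split.
- by apply: AD; [apply: AM | rewrite addnC; apply: AM].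
- exact: AM.
- exact: mulf_neq0.
by rewrite addf_div ?tofrac_eq0 // tofracD !tofracM.
Qed.

Lemma ProjM x y : P x -> P y -> P (x * y).
Proof.
move=> [d [f [g [Af Ag g0 ->]]]] [e [f' [g' [Af' Ag' g'0 ->]]]].
exists (d + e)%N, (f * f'), (g * g'); split; [exact: AM | exact: AM | exact: mulf_neq0 |].
by rewrite mulf_div !tofracM.
Qed.

Lemma ProjV x : P x -> P x^-1.
Proof.
(* The inverse of 0 is 0 by convention, and 0 belongs to the field. *)
move=> [d [f [g [Af Ag g0 ->]]]]; have [->|f0] := eqVneq f 0.
  by rewrite tofrac0 mul0r invr0 -tofrac0 -mpolyC0; apply: Proj_cst.
by exists d, g, f; rewrite invf_div.
Qed.

Lemma Proj_mmap r (p : {mpoly K[r]}) (t : 'I_r -> {fraction {mpoly K[n]}}) :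
  (forall k, P (t k)) -> P (mmap ((@FracField.tofrac _) \o (@mpolyC n K)) t p).
Proof.
move=> Pt; have P1 : P 1 by rewrite -tofrac1 -mpolyC1; apply: Proj_cst.
rewrite /mmap; elim/big_ind: _ => [|x y|m _]; [by rewrite -tofrac0 -mpolyC0; apply: Proj_cst | exact: ProjD |].
apply: ProjM; first exact: Proj_cst.
rewrite /mmap1; elim/big_ind: _ => // [x y|i _]; first exact: ProjM.
by elim: (m i) => [|k IH]; rewrite ?expr0 // exprS; apply: ProjM.
Qed.

End ProjField.

Lemma meval_comp_lin (K : numFieldType) n (M : 'M[K]_n) (f : {mpoly K[n]}) v :
  (f \mPo [tuple \sum_(j < n) M i j *: 'X_j | i < n]).@[v] = f.@[apply_mx M v].
Proof.
rewrite comp_mpoly_meval; apply: meval_eq => i; rewrite tnth_mktuple raddf_sum.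
by apply: eq_bigr => j _; rewrite [LHS]mevalZ mevalXU.
Qed.

Lemma invariant_formP (K : numFieldType) n (H : 'M[K]_n -> Prop) d (f : {mpoly K[n]}) :
  invariant_form H d f <->
  f \is d.-homog /\ forall M, H M -> forall v, f.@[apply_mx M v] = f.@[v].
Proof.
split=> -[hf H']; split=> // M HM.
  by move=> v; rewrite -meval_comp_lin H'.
by apply: mpoly_eq_eval => v; rewrite meval_comp_lin H'.
Qed.

Lemma git_ringM (K : numFieldType) n (H : 'M[K]_n -> Prop) d e f g :
  git_ring H d f -> git_ring H e g -> git_ring H (d + e) (f * g).
Proof.
move=> /invariant_formP[hf Hf] /invariant_formP[hg Hg]; apply/invariant_formP.
split=> [|M HM v]; first exact: dhomogM.
by rewrite !mevalM Hf ?Hg.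
Qed.

Lemma git_ringD (K : numFieldType) n (H : 'M[K]_n -> Prop) d f g :
  git_ring H d f -> git_ring H d g -> git_ring H d (f + g).
Proof.
move=> /invariant_formP[hf Hf] /invariant_formP[hg Hg]; apply/invariant_formP.
split=> [|M HM v]; first exact: dhomogD.
by rewrite !mevalD Hf ?Hg.
Qed.

Lemma git_ringC (K : numFieldType) n (H : 'M[K]_n -> Prop) c : git_ring H 0 c%:MP.
Proof.
apply/invariant_formP; split=> [|M HM v]; last by rewrite !mevalC.
by apply: eval_dhomog => x v; rewrite !mevalC expr0 mul1r.
Qed.

(** Vieta: a lists the roots of X^4 - X^3 + t_0 X^2 - t_1 X + t_2. Thus every value of the symmetric
    slice coordinates is attained. *)
Lemma mesym_roots (K : numClosedFieldType) (t : 'I_3 -> K) : exists a : 'I_4 -> K,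
  \sum_i a i = 1 /\ forall j : 'I_3, (mesym 4 K j.+2).@[a] = t j.
Proof.
pose p : {poly K} := \poly_(k < 5)
  (if k == 4%N then 1 else if k == 3%N then -1 else (-1) ^+ k * t (inord (2 - k))).
have sp : size p = 5%N by rewrite size_poly_eq //= oner_eq0.
have lp : lead_coef p = 1 by rewrite lead_coefE sp coef_poly.
have [r Er] := closed_field_poly_normal p; rewrite lp scale1r in Er.
have sr : size r = 4%N by have := sp; rewrite Er size_prod_XsubC => -[].
pose cs := Tuple (introT eqP sr); have Ec := mroots_coeff cs.
have Ep k : (\prod_(c <- cs) ('X - c%:P))`_k = p`_k by rewrite Er.
exists (tnth cs); split.
  by rewrite -(big_tuple _ _ cs xpredT id) mroots_sum Ep coef_poly opprK.
move=> j; have := Ec (inord j.+2); rewrite inordK; last exact: (ltn_ord j).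
rewrite Ep coef_poly; case: j => [[|[|[|//]]] hj] /=.
- rewrite sqrrN expr1n !mul1r => <-; by congr t; apply/val_inj; rewrite /= inordK.
- rewrite expr1 mulN1r exprS sqrrN expr1n mulr1 mulN1r => /oppr_inj <-.
  by congr t; apply/val_inj; rewrite /= inordK.
- rewrite expr0 (exprM (-1) 2 2) sqrrN !expr1n !mul1r => <-.
  by congr t; apply/val_inj; rewrite /= inordK.
Qed.

(** Multiplies the common degree of [f] and [g] by N without changing the quotient. *)
Lemma meval_ratio (K : fieldType) m (f g : {mpoly K[m]}) v N : (0 < N)%N -> g.@[v] != 0 ->
  (f * g ^+ N.-1).@[v] / (g ^+ N).@[v] = f.@[v] / g.@[v].
Proof.
move=> N0 g0; rewrite -[X in _ / (_ ^+ X).@[_]](prednK N0) exprS !mevalM rmorphXn -mulf_div divff ?mulr1 //.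
exact: expf_neq0.
Qed.

(** * Rationality of the quotient *)

Section RationalQuotient.
Variables (K : numClosedFieldType) (q : nat).
Local Notation n := (4 + q)%N.
Variables (D : 'S_4 -> 'M[K]_n) (Y : 'M[K]_(4, n)) (Lam : 'M[K]_(q, n)).
Hypotheses (D1 : D 1%g = 1%:M) (DM : forall s t, D (s * t)%g = D t *m D s).
Hypothesis YD : forall s, Y *m D s = row_perm s^-1 Y.
Hypothesis YLam : col_mx Y Lam \in unitmx.
Implicit Types (a : 'I_4 -> K) (z : 'I_q -> K) (v : 'I_n -> K) (s t : 'S_4).

Local Notation twist := (twist D).
Local Notation frame := (twisted_frame D Y Lam).

Definition ycoord v : 'I_4 -> K := apply_mx Y v.
Definition zcoord v : 'I_q -> K := apply_mx (Lam *m twist (ycoord v)) v.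
Definition ysum v : K := \sum_i ycoord v i.

(** Degrees of the numerators of the generators: j + 2 for an elementary symmetric function, and 13
    = 12 + 1 for a twisted coordinate, [theta] being of degree 12. *)
Definition weight (k : 'I_(3 + q)) : nat :=
  match split k with inl j => j.+2 | inr _ => 13 end.

Lemma ycoord_D s v i : ycoord (apply_mx (D s) v) i = ycoord v (s^-1%g i).
Proof.
rewrite /ycoord apply_mxM YD; apply: eq_bigr => j _; by rewrite mxE.
Qed.

Lemma zcoord_D s v i : zcoord (apply_mx (D s) v) i = zcoord v i.
Proof.
rewrite /zcoord apply_mxM -mulmxA (twist_eq _ (ycoord_D s v)) twist_perm //.
Qed.

Lemma ysum_D s v : ysum (apply_mx (D s) v) = ysum v.
Proof.
rewrite /ysum (eq_bigr _ (fun i _ => ycoord_D s v i)).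
by rewrite [RHS](reindex_inj (@perm_inj _ s^-1)).
Qed.

Lemma ycoordZ c v i : ycoord (fun j => c * v j) i = c * ycoord v i.
Proof. exact: apply_mxZ. Qed.

Lemma ysumZ c v : ysum (fun j => c * v j) = c * ysum v.
Proof. by rewrite /ysum mulr_sumr; apply: eq_bigr => i _; rewrite ycoordZ. Qed.

Lemma zcoordZ c v i : zcoord (fun j => c * v j) i = c ^+ 13 * zcoord v i.
Proof.
rewrite /zcoord (twist_eq _ (ycoordZ c v)) twistZ -scalemxAr apply_mxZl apply_mxZ.
by rewrite mulrA -exprSr.
Qed.

Definition numer v : 'I_(3 + q) -> K := slice_coord (ycoord v) (zcoord v).

Lemma numer_D s v k : numer (apply_mx (D s) v) k = numer v k.
Proof.
rewrite /numer /slice_coord; apply: join_eq => [j|j]; last exact: zcoord_D.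
rewrite (meval_eq _ (ycoord_D s v)) eval_symmetric //; exact: mesym_sym.
Qed.

Lemma slice_coordZ c a z k :
  slice_coord (fun i => c * a i) (fun j => c ^+ 13 * z j) k = c ^+ weight k * slice_coord a z k.
Proof.
rewrite /slice_coord /weight -(splitK k); case: (split k) => j; rewrite /= ?join_l ?join_r.
  by rewrite (dhomog_eval _ _ (dhomog_mesym _ _ _)) (unsplitK (inl j)).
by rewrite (unsplitK (inr j)).
Qed.

Lemma numerZ c v k : numer (fun j => c * v j) k = c ^+ weight k * numer v k.
Proof.
rewrite -slice_coordZ; apply: join_eq => j; last exact: zcoordZ.
exact: meval_eq (ycoordZ c v).
Qed.

(** The invariants are evaluated on the multiple of v whose y-coordinates add up to 1; by
    [gen_valueE] this divides each numerator by a power of [ysum]. *)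
Definition gen_value v : 'I_(3 + q) -> K :=
  slice_coord (fun i => (ysum v)^-1 * ycoord v i) (fun j => (ysum v)^-1 ^+ 13 * zcoord v j).

Lemma gen_valueE v k : gen_value v k = numer v k / ysum v ^+ weight k.
Proof. by rewrite /gen_value slice_coordZ exprVn mulrC. Qed.

Lemma polyfun_ycoord i : polyfun (fun v => ycoord v i).
Proof. by apply: polyfun_apply => *; [apply: polyfun_cst | apply: polyfun_var]. Qed.

Lemma polyfun_ysum : polyfun ysum.
Proof. apply: polyfun_sum => i; exact: polyfun_ycoord. Qed.

Lemma polyfun_numer k : polyfun (fun v => numer v k).
Proof.
rewrite /numer /slice_coord -(splitK k); case: (split k) => j /=.
  apply: (@polyfun_ext _ _ (fun v => (mesym 4 K j.+2).@[ycoord v])) => [v|].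
    by rewrite join_l.
  exact: (polyfun_comp _ polyfun_ycoord).
apply: (@polyfun_ext _ _ (fun v => zcoord v j)) => [v|]; first by rewrite join_r.
apply: polyfun_apply => [i l|]; last exact: polyfun_var.
apply: (@polyfun_ext _ _ (fun v => frame (ycoord v) (rshift 4 i) l)) => [v|].
  by rewrite /twisted_frame col_mxEd.
exact: (polyfun_frame _ _ _ _ _ polyfun_ycoord).
Qed.

(** This recovers v from its normalized coordinates (a, z): applying the adjugate of the matrix to
    the pair gives a multiple of v. *)
Lemma frame_slice v : ysum v != 0 ->
  apply_mx (frame (fun i => (ysum v)^-1 * ycoord v i)) v
  =1 (fun k => ysum v * join (fun i => (ysum v)^-1 * ycoord v i)
                              (fun j => (ysum v)^-1 ^+ 13 * zcoord v j) k).
Proof.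
move=> e0 k; rewrite -(splitK k); case: (split k) => j; rewrite /= ?join_l ?join_r.
  rewrite mulVKf //; apply: eq_bigr => l _; by rewrite col_mxEu.
rewrite (exprS _ 12) -(mulrA (ysum v)^-1) mulVKf // -apply_mxZl; apply: eq_bigr => l _.
by rewrite col_mxEd twistZ scalemxAr.
Qed.

Lemma perm_block_join s a z :
  apply_mx (perm_block K q s) (join a z) =1 join (fun i => a (s i)) z.
Proof.
move=> k; rewrite -(splitK k); case: (split k) => j /=; rewrite ?join_l ?join_r.
  rewrite /apply_mx big_split_ord /= [X in _ + X]big1 ?addr0 => [|l _]; last first.
    by rewrite block_mxEur mxE mul0r.
  rewrite (bigD1 (s j)) //= big1 ?addr0 => [|l /negPf nl].
    by rewrite block_mxEul join_l !mxE eqxx mul1r.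
  by rewrite block_mxEul !mxE eq_sym nl mul0r.
rewrite /apply_mx big_split_ord /= [X in X + _]big1 ?add0r => [|l _]; last first.
  by rewrite block_mxEdl mxE mul0r.
rewrite (bigD1 j) //= big1 ?addr0 => [|l /negPf nl].
  by rewrite block_mxEdr join_r !mxE eqxx mul1r.
by rewrite block_mxEdr !mxE eq_sym nl mul0r.
Qed.

(** Permuting a moves the reconstructed point by [D t] and by the scalar c, a 24th root of unity by
    [frame_perm_sym]. A form invariant under D therefore takes the same value at both points when
    its degree is divisible by 24. *)
Lemma adj_frame_perm a z t : \det (frame a) != 0 ->
  let c := \det (frame (fun i => a (t^-1%g i))) / \det (frame a) in
  apply_mx (\adj (frame (fun i => a (t^-1%g i)))) (join (fun i => a (t^-1%g i)) z) =1
  (fun k => c * apply_mx (D t) (apply_mx (\adj (frame a)) (join a z)) k).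
Proof.
move=> d0 c; set a' := fun i => a _; move=> k.
rewrite -(apply_mx_eq _ (perm_block_join (t^-1)%g a z)) apply_mxM.
rewrite apply_mxM -apply_mxZl; congr (apply_mx _ _ _).
have E : \adj (frame a') *m perm_block K q t^-1 *m frame a = \det (frame a') *: D t.
  by rewrite -mulmxA -(frame_perm Lam DM YD) mulmxA mul_adj_mx mul_scalar_mx.
have := congr1 (fun M => (\det (frame a))^-1 *: (M *m \adj (frame a))) E.
rewrite /= -mulmxA mul_mx_adj mul_mx_scalar scalerA mulVf // scale1r => ->.
by rewrite -scalemxAl scalerA mulrC.
Qed.

Variable H : 'M[K]_n -> Prop.
Hypothesis HD : forall M, H M <-> exists s (c : K), c != 0 /\ M = c *: D s.
Local Notation N := (24 * n)%N.

Lemma git_ring_of_invariant d (f : {mpoly K[n]}) : (N %| d)%N -> f \is d.-homog ->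
  (forall s v, f.@[apply_mx (D s) v] = f.@[v]) -> git_ring H d f.
Proof.
move=> Nd hf Hf; apply/invariant_formP; split=> // M [/HD[s [c [c0 ->]]] dM] v.
rewrite (meval_eq _ (apply_mxZl _ _ _)) (dhomog_eval _ _ hf) Hf.
have cN : c ^+ N = 1.
  have := congr1 (fun x => x ^+ 24) dM.
  by rewrite detZ exprMn (det_D D1 DM) mulr1 expr1n -exprM mulnC.
by case/dvdnP: Nd => k ->; rewrite mulnC exprM cN expr1n mul1r.
Qed.

(** Any n-th root c of the inverse of det D(s) gives the lift c D(s) of determinant 1, and c acts
    trivially on forms of degree divisible by N. *)
Lemma invariant_of_git_ring d (f : {mpoly K[n]}) : (N %| d)%N -> git_ring H d f ->
  forall s v, f.@[apply_mx (D s) v] = f.@[v].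
Proof.
move=> /dvdnP[k Ed] /invariant_formP[hf Hf] s v.
have D0 : \det (D s) != 0 by have := D_unit D1 DM s; rewrite unitmxE unitfE.
pose c := n.-root (\det (D s))^-1.
have cn : c ^+ n = (\det (D s))^-1 by rewrite rootCK.
have c0 : c != 0 by rewrite rootC_eq0 // invr_eq0.
have := Hf (c *: D s); rewrite detZ cn mulVf // => /(_ (conj _ erefl) v).
rewrite (meval_eq _ (apply_mxZl _ _ _)) (dhomog_eval _ _ hf) => <-; last first.
  by apply/HD; exists s, c.
have -> : c ^+ d = 1.
  by rewrite Ed mulnC [(24 * _)%N]mulnC -mulnA exprM cn exprM exprVn (det_D D1 DM) invr1 expr1n.
by rewrite mul1r.
Qed.

(** The equations are not linear in v, but once the y-coordinates are prescribed to be a they become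
    the linear system frame(a) v = (a, z). *)
Lemma exists_generic_ycoord a z : \det (frame a) != 0 -> \sum_i a i = 1 ->
  exists v, [/\ ycoord v =1 a, ysum v = 1 & zcoord v =1 z].
Proof.
move=> d0 a1; have uC : frame a \in unitmx by rewrite unitmxE unitfE.
pose v := apply_mx (invmx (frame a)) (join a z).
have E k : apply_mx (frame a) v k = join a z k.
  rewrite apply_mxM mulmxV //; rewrite /apply_mx (bigD1 k) //= big1 => [|l /negPf nl].
    by rewrite mxE eqxx mul1r addr0.
  by rewrite mxE eq_sym nl mul0r.
have Ey : ycoord v =1 a.
  move=> i; rewrite -(join_l a z i) -E; apply: eq_bigr => l _; by rewrite col_mxEu.
exists v; split=> // [|j].
  by rewrite /ysum (eq_bigr _ (fun i _ => Ey i)).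
rewrite -(join_r a z j) -E; apply: eq_bigr => l _; by rewrite col_mxEd (twist_eq _ Ey).
Qed.

Lemma det_frameZ c a : \det (frame (fun i => c * a i)) = (c ^+ 12) ^+ q * \det (frame a).
Proof.
have -> : frame (fun i => c * a i) = block_mx 1%:M 0 0 (c ^+ 12)%:M *m frame a.
  rewrite mul_block_col !mul1mx !mul0mx addr0 add0r mul_scalar_mx.
  by rewrite /twisted_frame twistZ scalemxAr.
by rewrite det_mulmx det_ublock det1 mul1r det_scalar.
Qed.

(** [P] comes from the polynomial f(adj(frame a) (a, z)). At the normalized coordinates of v the
    argument of f is (e / ysum v) v, whence the factor. It depends only on v and d, so it cancels in
    a quotient of two invariants of the same degree. *)
Lemma invariant_slice d (f : {mpoly K[n]}) : (N %| d)%N -> git_ring H d f ->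
  exists P : {mpoly K[3 + q]}, forall v, ysum v != 0 ->
    let e := \det (frame (fun i => (ysum v)^-1 * ycoord v i)) in
    e != 0 -> P.@[gen_value v] = (e / ysum v) ^+ d * f.@[v].
Proof.
move=> Nd Af; have fD := invariant_of_git_ring Nd Af.
have [hf _] := iffLR (invariant_formP _ _ _) Af.
pose adjv (w : 'I_(4 + q) -> K) := apply_mx (\adj (frame (fun i => w (lshift q i)))) w.
have [ft Hft] : polyfun (fun w => f.@[adjv w]).
  apply: polyfun_comp => i; apply: polyfun_apply => [j l|j]; last exact: polyfun_var.
  by apply: polyfun_adj => k m; exact: (polyfun_frame D Y Lam k m (fun k => polyfun_var K (lshift q k))).
have Hft' a z : ft.@[join a z] = f.@[apply_mx (\adj (frame a)) (join a z)].
  rewrite -Hft; apply: meval_eq => i; rewrite /adjv.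
  by rewrite (@frame_eq _ _ _ _ _ (fun i => join a z (lshift q i)) a) // => j; rewrite join_l.
have [P HP] := symmetric_slice ft; exists P => v e0 e eN0.
pose a i := (ysum v)^-1 * ycoord v i; pose z j := (ysum v)^-1 ^+ 13 * zcoord v j.
have a1 : \sum_i a i = 1 by rewrite -mulr_sumr mulVf.
have -> : P.@[gen_value v] = ft.@[join a z].
  rewrite (HP a z) // => s; rewrite !Hft'.
  have := adj_frame_perm z s^-1 eN0; rewrite -/a invgK => E.
  rewrite (meval_eq _ E) (dhomog_eval _ _ hf) fD.
  case/dvdnP: Nd => k ->; rewrite mulnC -mulnA exprM expr_div_n.
  have := frame_perm_sym Lam D1 DM YD a s^-1; rewrite invgK => ->.
  by rewrite divff ?expr1n ?mul1r // expf_neq0.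
have Ev : apply_mx (\adj (frame a)) (join a z) =1 (fun j => e / ysum v * v j).
  move=> j; have /apply_mx_eq E := frame_slice e0.
  have := E _ (\adj (frame a)) j; rewrite apply_mxM mul_adj_mx apply_mxZ -/a -/z => E2.
  apply: (mulfI e0); rewrite -E2 mulrA [_ * (e / _)]mulrC divfK //.
  rewrite /apply_mx (bigD1 j) //= big1 => [|l /negPf nl]; first by rewrite mxE eqxx addr0.
  by rewrite mxE eq_sym nl mul0r.
by rewrite Hft' (meval_eq _ Ev) (dhomog_eval _ _ hf).
Qed.

(** The generators [tau] are algebraically independent because their values fill an open set; they
    generate because [invariant_slice] writes numerator and denominator of an invariant fraction
    with the same factor. *)
Theorem rational_quotient : rational_Proj (git_ring H).
Proof.
have [num Hnum] := fin_all_exists polyfun_numer.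
have [e1 He1] := polyfun_ysum.
have e1_0 : e1 != 0.
  have [v [_ v1 _]] := exists_generic_ycoord (fun=> 0) (det_frame_a0 D1 YLam) (sum_a0 K).
  by apply: (@meval_neq0 _ _ _ v); rewrite -He1 v1 oner_neq0.
pose tau k : {fraction {mpoly K[n]}} := (num k)%:F / (e1 ^+ weight k)%:F.
have val_tau k v : e1.@[v] != 0 -> val_at (tau k) v (gen_value v k).
  move=> e0; rewrite gen_valueE Hnum He1 -rmorphXn; apply: val_frac.
  by rewrite rmorphXn expf_neq0.
pose h0 : {rmorphism {mpoly K[3 + q]} -> {fraction {mpoly K[n]}}} :=
  mmap ((@FracField.tofrac _) \o (@mpolyC n K)) tau.
have val_h0 p v : e1.@[v] != 0 -> val_at (h0 p) v p.@[gen_value v].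
  by move=> e0; apply: val_mmap => k; apply: val_tau.
have gen_val1 a z v : ycoord v =1 a -> ysum v = 1 -> zcoord v =1 z ->
    gen_value v =1 slice_coord a z.
  move=> Ea e Ez; rewrite /gen_value e invr1; apply: join_eq => j; last by rewrite expr1n mul1r Ez.
  by apply: meval_eq => i; rewrite mul1r Ea.
have h0_inj p : h0 p = 0 -> p = 0.
  move=> hp0; apply/eqP/negPn/negP => p0.
  (* The 24th power of the determinant is symmetric in a, hence a polynomial [P] on the slice. A
     target point t where neither [p] nor [P] vanishes is attained at some v, which contradicts h0 p
     = 0. *)
  have [delta Hdelta] : exists f : {mpoly K[4 + q]}, forall a z,
      \det (frame a) ^+ 24 = f.@[join a z].
    have [f Hf] : polyfun (fun w : 'I_(4 + q) -> K => \det (frame (fun i => w (lshift q i))) ^+ 24).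
      apply: polyfunX; apply: polyfun_det => i j.
      by exact: (polyfun_frame D Y Lam i j (fun k => polyfun_var K (lshift q k))).
    exists f => a z; rewrite -Hf; congr (\det _ ^+ _).
    by apply: frame_eq => i; rewrite join_l.
  have [P HP] := symmetric_slice delta.
  have HP' a z : \sum_i a i = 1 -> \det (frame a) ^+ 24 = P.@[slice_coord a z].
    move=> a1; rewrite (Hdelta a z); apply: HP => // s; rewrite -!Hdelta.
    by rewrite -(frame_perm_sym Lam D1 DM YD a s^-1) invgK.
  have P0 : P != 0.
    apply: (@meval_neq0 _ _ _ (slice_coord (a0 K) (fun=> 0))).
    by rewrite -HP' ?sum_a0 // expf_neq0 // det_frame_a0.
  have [t] := mpoly_nonroot (mulf_neq0 p0 P0); rewrite mevalM mulf_eq0 negb_or => /andP[pt Pt].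
  have [a [a1 Ha]] := mesym_roots (fun j => t (lshift q j)).
  pose z j := t (rshift 3 j).
  have Et : slice_coord a z =1 t.
    by move=> k; rewrite -[RHS]join_eta; apply: join_eq.
  have da : \det (frame a) != 0.
    by apply: contraNneq Pt => d0; rewrite -(meval_eq _ Et) -HP' // d0 expr0n.
  have [v [Ea e Ez]] := exists_generic_ycoord z da a1.
  have ev : e1.@[v] != 0 by rewrite -He1 e oner_neq0.
  have := val_h0 p v ev; rewrite (meval_eq _ (gen_val1 _ _ _ Ea e Ez)) (meval_eq _ Et).
  by move/(val_neq0 pt); rewrite hp0 eqxx.
have [h Hh] := frac_lift_exists h0_inj.
exists (3 + q)%N, h; split=> [c|phi].
  by rewrite Hh /h0 /= mmapC.
split=> [[d [f [g [Af Ag g0 ->]]]]|[psi <-]]; last first.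
  have [a [b [b0 ->]]] := fracP psi; rewrite fmorph_div !Hh.
  have Ptau k : Proj_function_field (git_ring H) (tau k).
    (* r lifts the degree of the denominator to a multiple of N; it is N, not 0, when N already
       divides the weight. *)
    pose r := (N - weight k %% N)%N; have N0 : (0 < N)%N by rewrite muln_gt0.
   
    have Nd : (N %| weight k + r)%N.
      by rewrite /dvdn -modnDml subnKC ?modnn // ltnW // ltn_mod.
    have he1 : e1 \is 1.-homog.
      by apply: eval_dhomog => c v; rewrite -!He1 ysumZ expr1.
    exists (weight k + r)%N, (num k * e1 ^+ r), (e1 ^+ (weight k + r)); split.
    - apply: git_ring_of_invariant => // [|s v].
        apply: dhomogM; last by have := dhomogMn r he1; rewrite mul1n.
        by apply: eval_dhomog => c v; rewrite -!Hnum numerZ.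
      by rewrite !mevalM !rmorphXn /= -!Hnum -!He1 numer_D ysum_D.
    - apply: git_ring_of_invariant => // [|s v].
        by have := dhomogMn (weight k + r) he1; rewrite mul1n.
      by rewrite !rmorphXn /= -!He1 ysum_D.
    - by rewrite expf_neq0.
    by apply/eqP; rewrite frac_eq ?expf_neq0 // exprD mulrA mulrAC.
  have Pm := Proj_mmap (@git_ringM _ _ H) (@git_ringD _ _ H) (@git_ringC _ _ H).
  apply: ProjM; [exact: git_ringM | exact: Pm | apply: ProjV; [exact: git_ringC | exact: Pm]].
have N0 : (0 < N)%N by [].
have AX k p e : git_ring H e p -> git_ring H (e * k) (p ^+ k).
  move=> Ap; elim: k => [|k IH]; first by rewrite muln0 expr0 -mpolyC1; apply: git_ringC.
  by rewrite mulnS exprS; apply: git_ringM.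
(* The degree d need not be divisible by N, so f / g is replaced by f g^(N-1) / g^N. *)
have Ag1 : git_ring H (d * N) (g ^+ N) by apply: AX.
have Af1 : git_ring H (d * N) (f * g ^+ N.-1).
  by rewrite -(prednK N0) mulnS; apply: git_ringM => //; apply: AX.
have [Pf HPf] := invariant_slice (dvdn_mull d (dvdnn N)) Af1.
have [Pg HPg] := invariant_slice (dvdn_mull d (dvdnn N)) Ag1.
have [dp Hdp] : polyfun (fun v => \det (frame (ycoord v))).
  by apply: polyfun_det => i j; exact: (polyfun_frame D Y Lam i j polyfun_ycoord).
have dp0 : dp != 0.
  have [v [Ey _ _]] := exists_generic_ycoord (fun=> 0) (det_frame_a0 D1 YLam) (sum_a0 K).
  by apply: (@meval_neq0 _ _ _ v); rewrite -Hdp (frame_eq _ _ _ Ey) det_frame_a0.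
(* w gathers what must not vanish at a general point: the denominator, [ysum] and the determinant of
   the frame. *)
pose w := g * e1 * dp; have w0 : w != 0 by rewrite !mulf_neq0.
have generic v : w.@[v] != 0 -> [/\ g.@[v] != 0, e1.@[v] != 0 &
   \det (frame (fun i => (ysum v)^-1 * ycoord v i)) != 0].
  rewrite !mevalM !mulf_eq0 !negb_or -andbA => /and3P[gv ev dv]; split=> //.
  by rewrite det_frameZ Hdp mulf_neq0 // !expf_neq0 // invr_eq0 He1.
have Pgv v : g.@[v] != 0 -> e1.@[v] != 0 ->
    \det (frame (fun i => (ysum v)^-1 * ycoord v i)) != 0 -> Pg.@[gen_value v] != 0.
  move=> gv ev dv; have e0 : ysum v != 0 by rewrite He1.
  rewrite HPg //; apply: mulf_neq0.
    by rewrite expf_neq0 // mulf_neq0 // invr_eq0.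
  by rewrite rmorphXn expf_neq0.
have Pg0 : Pg != 0.
  have [v /generic[gv ev dv]] := mpoly_nonroot w0.
  apply: (@meval_neq0 _ _ _ (gen_value v)).
  exact: Pgv v gv ev dv.
exists (Pf%:F / Pg%:F); rewrite fmorph_div !Hh.
apply: (val_eq w0) => v /generic[gv ev dv].
have {}Pgv := Pgv v gv ev dv.
exists (f.@[v] / g.@[v]); last exact: val_frac.
have -> : f.@[v] / g.@[v] = Pf.@[gen_value v] / Pg.@[gen_value v].
  have e0 : ysum v != 0 by rewrite He1.
  rewrite HPf // HPg // -mulf_div divff ?mul1r; last first.
    by rewrite expf_neq0 // mulf_neq0 // invr_eq0.
  by rewrite (meval_ratio _ N0).
exact: val_atM (val_h0 _ _ ev) (val_atV Pgv (val_h0 _ _ ev)).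
Qed.

End RationalQuotient.

(** * Planes of P^4 as wedges of linear forms *)

Lemma row_free_complete (K : fieldType) m p (A : 'M[K]_(m, m + p)) :
  row_free A -> exists B, col_mx A B \in unitmx.
Proof.
move=> fA; exists (dsubmx (row_ebase A)).
have -> : col_mx A (dsubmx (row_ebase A)) = block_mx (col_ebase A) 0 0 1%:M *m row_ebase A.
  rewrite -[in RHS](vsubmxK (row_ebase A)) mul_block_col !mul0mx addr0 add0r mul1mx.
  congr col_mx; rewrite -{1}(mulmx_ebase A) (eqP fA) pid_mx_row.
  by rewrite -{1}[row_ebase A]vsubmxK -mulmxA mul_row_col mul1mx mul0mx addr0.
rewrite unitmx_mul row_ebase_unit andbT unitmxE det_ublock det1 mulr1 -unitmxE.
exact: col_ebase_unit.
Qed.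

Notation o5 i := (@Ordinal 5 i isT).
Notation o10 i := (@Ordinal 10 i isT).
Notation o3 i := (@Ordinal 3 i isT).

(* Coordinate k of P^9 belongs to the triple number k of columns; (wfst k, wsnd k) is the
   complementary pair, ordered so that it completes the triple to an even permutation. *)
Definition wfst (k : 'I_10) : 'I_5 :=
  nth ord0 [:: o5 3; o5 4; o5 2; o5 1; o5 3; o5 1; o5 4; o5 0; o5 2; o5 0] k.
Definition wsnd (k : 'I_10) : 'I_5 :=
  nth ord0 [:: o5 4; o5 2; o5 3; o5 4; o5 1; o5 2; o5 0; o5 3; o5 0; o5 1] k.

Lemma ord10_ind (P : 'I_10 -> Prop) : P (o10 0) -> P (o10 1) -> P (o10 2) -> P (o10 3) -> P (o10 4)
  -> P (o10 5) -> P (o10 6) -> P (o10 7) -> P (o10 8) -> P (o10 9) -> forall k, P k.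
Proof.
move=> H0 H1 H2 H3 H4 H5 H6 H7 H8 H9; case=> m.
by do 10! (case: m => [|m]; first by move=> h; rewrite (bool_irrelevance h isT)).
Qed.

Lemma ord5_ind (P : 'I_5 -> Prop) : P (o5 0) -> P (o5 1) -> P (o5 2) -> P (o5 3) -> P (o5 4) -> forall k, P k.
Proof.
move=> H0 H1 H2 H3 H4; case=> m.
by do 5! (case: m => [|m]; first by move=> h; rewrite (bool_irrelevance h isT)).
Qed.

Lemma ord3_ind (P : 'I_3 -> Prop) : P (o3 0) -> P (o3 1) -> P (o3 2) -> forall k, P k.
Proof.
move=> H0 H1 H2; case=> m.
by do 3! (case: m => [|m]; first by move=> h; rewrite (bool_irrelevance h isT)).
Qed.

Ltac ord10 k := elim/ord10_ind: k.
Ltac ord5 k := elim/ord5_ind: k.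
Ltac ord3 k := elim/ord3_ind: k.

Section Wedge.
Variable K : fieldType.
Implicit Types (u v w a b x : 'rV[K]_5) (p : 'rV[K]_10).

(** With these complementary indices, u ^ v is up to a scalar the vector of Plucker coordinates of
    the plane where both forms vanish. *)
Definition wedge u v : 'rV[K]_10 :=
  \row_k (u 0 (wfst k) * v 0 (wsnd k) - u 0 (wsnd k) * v 0 (wfst k)).

(** The second exterior power of E: row k is the image of the k-th basis bivector. *)
Definition wedge_mx (E : 'M[K]_5) : 'M[K]_10 :=
  \matrix_(k, l) wedge (row (wfst k) E) (row (wsnd k) E) 0 l.

Lemma sum5 (V : nmodType) (F : 'I_5 -> V) :
  \sum_i F i = F (o5 0) + F (o5 1) + F (o5 2) + F (o5 3) + F (o5 4).
Proof.
rewrite !big_ord_recl big_ord0 addr0 !addrA.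
by do !congr (_ + _); congr F; apply/val_inj.
Qed.

Lemma sum10 (V : nmodType) (F : 'I_10 -> V) :
  \sum_i F i = F (o10 0) + F (o10 1) + F (o10 2) + F (o10 3) + F (o10 4)
     + F (o10 5) + F (o10 6) + F (o10 7) + F (o10 8) + F (o10 9).
Proof.
rewrite !big_ord_recl big_ord0 addr0 !addrA.
by do !congr (_ + _); congr F; apply/val_inj.
Qed.

Lemma sum3 (V : nmodType) (F : 'I_3 -> V) :
  \sum_i F i = F (o3 0) + F (o3 1) + F (o3 2).
Proof.
rewrite !big_ord_recl big_ord0 addr0 !addrA.
by do !congr (_ + _); congr F; apply/val_inj.
Qed.

Lemma wedge_mulmx u v (E : 'M[K]_5) : wedge (u *m E) (v *m E) = wedge u v *m wedge_mx E.
Proof. by apply/rowP => k; rewrite !mxE sum10 !sum5 !mxE /=; ring. Qed.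

Lemma wedgeC u v : wedge u v = - wedge v u.
Proof. by apply/rowP => k; rewrite !mxE; ring. Qed.

Lemma wedgexx u : wedge u u = 0.
Proof. by apply/rowP => k; rewrite !mxE; ring. Qed.

Lemma wedgeDl u v w : wedge (u + v) w = wedge u w + wedge v w.
Proof. by apply/rowP => k; rewrite !mxE; ring. Qed.

Lemma wedgeDr u v w : wedge u (v + w) = wedge u v + wedge u w.
Proof. by apply/rowP => k; rewrite !mxE; ring. Qed.

Lemma wedgeZl c u v : wedge (c *: u) v = c *: wedge u v.
Proof. by apply/rowP => k; rewrite !mxE; ring. Qed.

Lemma wedgeZr c u v : wedge u (c *: v) = c *: wedge u v.
Proof. by apply/rowP => k; rewrite !mxE; ring. Qed.

Lemma wedge_mx1 : wedge_mx 1%:M = 1%:M.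
Proof. by apply/matrixP => k l; ord10 k; ord10 l; rewrite !mxE /=; ring. Qed.

Lemma wedge_mxM E F : wedge_mx (E *m F) = wedge_mx E *m wedge_mx F.
Proof.
apply/row_matrixP => k; rewrite row_mul.
have R G : row k (wedge_mx G) = wedge (row (wfst k) G) (row (wsnd k) G).
  by apply/rowP => l; rewrite !mxE.
by rewrite !R !row_mul wedge_mulmx.
Qed.

Lemma wedge_mx_unit E : E \in unitmx -> wedge_mx E \in unitmx.
Proof.
move=> uE; suff /mulmx1_unit[] : wedge_mx E *m wedge_mx (invmx E) = 1%:M by [].
by rewrite -wedge_mxM mulmxV // wedge_mx1.
Qed.

Lemma wedge_mxV E : E \in unitmx -> wedge_mx (invmx E) = invmx (wedge_mx E).
Proof.
move=> uE; rewrite -[RHS]mul1mx -wedge_mx1 -(mulVmx uE) wedge_mxM mulmxK //.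
exact: wedge_mx_unit.
Qed.

End Wedge.

(** * Plucker coordinates and the associated skew form *)

Section Plucker.
Variable K : fieldType.
Implicit Types (u v w a b x : 'rV[K]_5) (p : 'rV[K]_10) (B : 'M[K]_(3, 5)).

Lemma det2 (A : 'M[K]_2) : \det A = A ord0 ord0 * A ord_max ord_max - A ord0 ord_max * A ord_max ord0.
Proof.
(* Indexing by natural numbers makes equal ordinals yield identical terms, which [ring] can then
   match. *)
pose f (i j : nat) := A (inord i) (inord j).
have fE i j : A i j = f i j by rewrite /f !inord_val.
rewrite (expand_det_row _ ord0) !big_ord_recl big_ord0 /cofactor !det_mx11 !mxE !fE /= /bump /=; ring.
Qed.

Lemma det3 (A : 'M[K]_3) : \det A =
  A (o3 0) (o3 0) * (A (o3 1) (o3 1) * A (o3 2) (o3 2) - A (o3 1) (o3 2) * A (o3 2) (o3 1))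
  - A (o3 0) (o3 1) * (A (o3 1) (o3 0) * A (o3 2) (o3 2) - A (o3 1) (o3 2) * A (o3 2) (o3 0))
  + A (o3 0) (o3 2) * (A (o3 1) (o3 0) * A (o3 2) (o3 1) - A (o3 1) (o3 1) * A (o3 2) (o3 0)).
Proof.
pose f (i j : nat) := A (inord i) (inord j).
have fE i j : A i j = f i j by rewrite /f !inord_val.
rewrite (expand_det_row _ ord0) !big_ord_recl big_ord0 /cofactor.
rewrite !det2 !mxE !fE /= /bump /=; ring.
Qed.

(** [triple] with literal ordinals in place of [inord], so that it reduces by computation. *)
Definition triple_tab (k : 'I_10) (i : 'I_3) : 'I_5 :=
  nth ord0 (nth [::] [:: [:: o5 0; o5 1; o5 2]; [:: o5 0; o5 1; o5 3]; [:: o5 0; o5 1; o5 4];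
     [:: o5 0; o5 2; o5 3]; [:: o5 0; o5 2; o5 4]; [:: o5 0; o5 3; o5 4]; [:: o5 1; o5 2; o5 3];
     [:: o5 1; o5 2; o5 4]; [:: o5 1; o5 3; o5 4]; [:: o5 2; o5 3; o5 4]] k) i.

Lemma tripleE k i : triple k i = triple_tab k i.
Proof. by apply/val_inj; ord10 k; ord3 i; rewrite /= inordK. Qed.

Lemma pluckerE B k : plucker B 0 k = let t := triple_tab k in
  B (o3 0) (t (o3 0)) * (B (o3 1) (t (o3 1)) * B (o3 2) (t (o3 2)) - B (o3 1) (t (o3 2)) * B (o3 2) (t (o3 1)))
  - B (o3 0) (t (o3 1)) * (B (o3 1) (t (o3 0)) * B (o3 2) (t (o3 2)) - B (o3 1) (t (o3 2)) * B (o3 2) (t (o3 0)))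
  + B (o3 0) (t (o3 2)) * (B (o3 1) (t (o3 0)) * B (o3 2) (t (o3 1)) - B (o3 1) (t (o3 1)) * B (o3 2) (t (o3 0))).
Proof. by rewrite mxE det3 !mxE !tripleE. Qed.

(* Cauchy-Binet *)
Lemma det_mul_plucker B (C : 'M[K]_(3, 5)) :
  \det (B *m C^T) = \sum_k plucker B 0 k * plucker C 0 k.
Proof. by rewrite det3 sum10 !pluckerE /= !mxE !sum5 !mxE; ring. Qed.

(** Cauchy-Binet against a right inverse of [B] writes 1 as a combination of its Plucker
    coordinates. *)
Lemma plucker_neq0 B : row_free B -> plucker B != 0.
Proof.
case/row_freeP => C BC; apply/eqP => p0.
have := det_mul_plucker B C^T; rewrite trmxK BC det1 p0 => /eqP.
by rewrite big1 ?oner_eq0 // => k _; rewrite mxE mul0r.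
Qed.

(** The bivector p written as an alternating matrix, with p_k at position (wfst k, wsnd k); when p
    comes from a plane, the matrix kills that plane. *)
Definition skew_mx p : 'M[K]_5 :=
  let c (i : nat) := p 0 (inord i) in
  \matrix_(i, j) (nth [::] [:: [:: 0; c 9%N; - c 8%N; c 7%N; - c 6%N];
                              [:: - c 9%N; 0; c 5%N; - c 4%N; c 3%N];
                              [:: c 8%N; - c 5%N; 0; c 2%N; - c 1%N];
                              [:: - c 7%N; c 4%N; - c 2%N; 0; c 0%N];
                              [:: c 6%N; - c 3%N; c 1%N; - c 0%N; 0]] i)`_j.

Lemma skew_mx_tr p : (skew_mx p)^T = - skew_mx p.
Proof. by apply/matrixP => i j; ord5 i; ord5 j; rewrite !mxE /= ?oppr0 ?opprK. Qed.

Lemma skew_mxE p k : skew_mx p (wfst k) (wsnd k) = p 0 k.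
Proof. by rewrite mxE; ord10 k; rewrite /= ?opprK; congr (p 0 _); apply/val_inj; rewrite /= inordK. Qed.

Lemma inord10 i (h : (i < 10)%N) : inord i = Ordinal h :> 'I_10.
Proof. by apply/val_inj; rewrite /= inordK. Qed.

Definition inord10s := (inord10 (isT : (0 < 10)%N), inord10 (isT : (1 < 10)%N), inord10 (isT : (2 <
  10)%N), inord10 (isT : (3 < 10)%N), inord10 (isT : (4 < 10)%N), inord10 (isT : (5 < 10)%N),
  inord10 (isT : (6 < 10)%N), inord10 (isT : (7 < 10)%N), inord10 (isT : (8 < 10)%N), inord10 (isT :
  (9 < 10)%N)).

(** Up to sign each entry is the expansion of a 4 x 4 minor in which a row of [B] is repeated. *)
Lemma mul_skew_plucker B : B *m skew_mx (plucker B) = 0.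
Proof.
move: (plucker B) (pluckerE B) => p Ep.
apply/matrixP => i j; rewrite mxE sum5; ord3 i; ord5 j; rewrite !mxE /= ?inord10s !Ep /=; ring.
Qed.

End Plucker.

Section Dictionary.
Variable K : numFieldType.
Implicit Types (u v w a b x : 'rV[K]_5) (p : 'rV[K]_10) (B : 'M[K]_(3, 5)).

Definition orth x u := x *m u^T == 0.

Lemma skew_mx_wedge u v : skew_mx (wedge u v) = u^T *m v - v^T *m u.
Proof.
have Ep k : wedge u v 0 k = u 0 (wfst k) * v 0 (wsnd k) - u 0 (wsnd k) * v 0 (wfst k).
  by rewrite mxE.
move: (wedge u v) Ep => p Ep; apply/matrixP => i j; rewrite !mxE !big_ord1 !mxE.
by ord5 i; ord5 j; rewrite /= ?inord10s ?Ep /=; ring.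
Qed.

Lemma plucker_mulmx (A : 'M[K]_3) B : plucker (A *m B) = \det A *: plucker B.
Proof.
apply/rowP => k; rewrite !mxE -det_mulmx; congr (\det _).
by apply/matrixP => i j; rewrite !mxE; apply: eq_bigr => l _; rewrite !mxE.
Qed.

Lemma wedge_comb u v (a1 a2 b1 b2 : K) :
  wedge (a1 *: u + a2 *: v) (b1 *: u + b2 *: v) = (a1 * b2 - a2 * b1) *: wedge u v.
Proof. by apply/rowP => k; rewrite !mxE; ring. Qed.

Lemma sub_col_mx2 u a b : (u <= col_mx a b)%MS -> exists c d, u = c *: a + d *: b.
Proof.
case/submxP => x ->; rewrite -[x]hsubmxK mul_row_col.
exists (lsubmx x 0 0), (rsubmx x 0 0).
by rewrite {1}[lsubmx x]mx11_scalar {1}[rsubmx x]mx11_scalar !mul_scalar_mx.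
Qed.

Lemma sub_wedge u v a b : (u <= col_mx a b)%MS -> (v <= col_mx a b)%MS ->
  exists c, wedge u v = c *: wedge a b.
Proof.
move=> /sub_col_mx2[c [d ->]] /sub_col_mx2[e [f ->]].
by rewrite wedge_comb; eexists.
Qed.

Lemma row_free2P u v : reflect (forall c d, c *: u + d *: v = 0 -> c = 0 /\ d = 0)
  (row_free (col_mx u v)).
Proof.
rewrite -kermx_eq0; apply: (iffP idP) => [/eqP k0 c d E|H].
  have : (row_mx c%:M d%:M <= kermx (col_mx u v))%MS.
    by apply/sub_kermxP; rewrite mul_row_col !mul_scalar_mx.
  rewrite k0 submx0 => /eqP/eqP; rewrite row_mx_eq0 => /andP[/eqP c0 /eqP d0].
  by split; [have := congr1 (fun M : 'M_1 => M 0 0) c0 | have := congr1 (fun M : 'M_1 => M 0 0) d0]; rewrite !mxE.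
apply/rowV0P => x /sub_kermxP; rewrite -{1}[x]hsubmxK mul_row_col.
rewrite {1}[lsubmx x]mx11_scalar {1}[rsubmx x]mx11_scalar !mul_scalar_mx => /H[c0 d0].
rewrite -[x]hsubmxK; apply/eqP; rewrite row_mx_eq0.
by rewrite [lsubmx x]mx11_scalar [rsubmx x]mx11_scalar c0 d0 !raddf0 !eqxx.
Qed.

Lemma row_free_wedge u v : row_free (col_mx u v) = (wedge u v != 0).
Proof.
apply/row_free2P/idP => [H|uv0 c d E].
  apply/eqP => uv0; have D i j : u 0 i * v 0 j = u 0 j * v 0 i.
    have := congr1 (fun M : 'M_5 => M i j) (skew_mx_wedge u v); rewrite uv0.
    have -> : skew_mx (0 : 'rV[K]_10) = 0.
      by apply/matrixP => k l; ord5 k; ord5 l; rewrite !mxE /= ?oppr0.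
    rewrite !mxE !big_ord1 !mxE (mulrC (v 0 i)) => /esym/eqP.
    by rewrite subr_eq0 => /eqP.
  have U j : u 0 j = 0.
    have [] // := H (v 0 j) (- u 0 j).
      by apply/rowP => i; rewrite !mxE mulNr mulrC D mulrC subrr.
    by move=> _ /eqP; rewrite oppr_eq0 => /eqP.
  have u0 : u = 0 by apply/rowP => j; rewrite U mxE.
  have [] := H 1 0; first by rewrite u0 scaler0 scale0r addr0.
  by move/eqP; rewrite oner_eq0.
have X (e f : K) : (c * f - d * e) *: wedge u v = 0.
  by rewrite -wedge_comb E; apply/rowP => k; rewrite !mxE; ring.
have Y (e : K) : e *: wedge u v = 0 -> e = 0 by move/eqP; rewrite scaler_eq0 (negPf uv0) orbF => /eqP.
have := Y _ (X 0 1); have := Y _ (X 1 0).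
by rewrite !mulr1 !mulr0 subr0 sub0r => /eqP; rewrite oppr_eq0 => /eqP.
Qed.

(** The columns of [U] are two independent forms vanishing on the row space of [B]. The skew matrix
    of [plucker B] kills this space on both sides, so it is U S U^T with S alternating of size 2,
    that is, a multiple of the wedge of the two columns. *)
Lemma plucker_wedge B : row_free B -> exists u v,
  plucker B = wedge u v /\ forall x, (x <= B)%MS = orth x u && orth x v.
Proof.
move=> fB; have [G2 uG] := @row_free_complete _ 3 2 B fB.
set G := col_mx B G2 in uG; pose I : 'M[K]_(5, 3 + 2) := invmx G.
pose U := rsubmx I; pose W := lsubmx I.
have GI : G *m row_mx W U = 1%:M by rewrite hsubmxK mulmxV.
have IG : row_mx W U *m G = 1%:M by rewrite hsubmxK mulVmx.
rewrite mul_row_col in IG; rewrite mul_col_row scalar_mx_block in GI.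
have [_ BU _ G2U] := eq_block_mx GI.
set p := plucker B; pose S := G2 *m skew_mx p *m G2^T.
have E1 : skew_mx p = U *m (G2 *m skew_mx p).
  by rewrite -{1}[skew_mx p]mul1mx -IG mulmxDl -!mulmxA mul_skew_plucker mulmx0 add0r.
have E1' : skew_mx p = skew_mx p *m G2^T *m U^T.
  by have := congr1 trmx E1; rewrite !trmx_mul skew_mx_tr !mulNmx => /oppr_inj.
have E2 : skew_mx p = U *m S *m U^T by rewrite {1}E1 {1}E1' /S !mulmxA.
have ST : S^T = - S by rewrite /S !trmx_mul trmxK skew_mx_tr mulNmx mulmxN mulmxA.
clearbody S U W.
have S00 i : S i i = 0.
  have /eqP := congr1 (fun M : 'M_2 => M i i) ST; rewrite !mxE -addr_eq0 -mulr2n.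
  by rewrite mulrn_eq0 /= => /eqP.
have S10 : S ord_max ord0 = - S ord0 ord_max.
  by have := congr1 (fun M : 'M_2 => M ord0 ord_max) ST; rewrite !mxE.
pose s := S ord0 ord_max; pose u0 := (col ord0 U)^T; pose v := (col ord_max U)^T.
have Ep : p = wedge (s *: u0) v.
  apply/rowP => k; rewrite -skew_mxE E2 !mxE !big_ord_recl big_ord0 /=.
  rewrite !mxE !big_ord_recl !big_ord0 /= (_ : lift ord0 ord0 = ord_max :> 'I_2); last exact/val_inj.
  by rewrite !S00 S10 -/s; ring.
have s0 : s != 0.
  apply: contra_neq (plucker_neq0 fB) => s0; rewrite -/p Ep s0 scale0r.
  by apply/rowP => k; rewrite !mxE; ring.
exists (s *: u0), v; split=> // x; apply/idP/andP => [/submxP[y ->]|[]].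
  have BU' j : B *m col j U = 0 by rewrite colE mulmxA BU mul0mx.
  by rewrite /orth linearZ /= !trmxK -scalemxAr -!mulmxA !BU' !mulmx0 scaler0.
rewrite /orth linearZ /= !trmxK -scalemxAr scaler_eq0 (negPf s0) /= => /eqP x0 /eqP x1.
have xU : x *m U = 0.
  apply/row_matrixP => i; apply/rowP => j; rewrite row0 [RHS]mxE mxE.
  have E l : x *m col l U = 0 -> (x *m U) i l = 0.
    by rewrite colE mulmxA -colE => /colP/(_ i); rewrite !mxE.
  have [->|->] : j = ord0 \/ j = ord_max; [|exact: E..].
  by case: j => [[|[|//]] ?]; [left|right]; apply/val_inj.
by apply/submxP; exists (x *m W); rewrite -{1}[x]mulmx1 -IG mulmxDr !mulmxA xU mul0mx addr0.
Qed.

Lemma sub_annihilator u v w : wedge u v != 0 ->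
  (forall x, orth x u -> orth x v -> orth x w) -> (w <= col_mx u v)%MS.
Proof.
rewrite -row_free_wedge => fuv H; have [G2 uG] := @row_free_complete _ 2 3 _ fuv.
set G := col_mx _ G2 in uG; pose I : 'M[K]_(5, 2 + 3) := invmx G.
have GI : G *m row_mx (lsubmx I) (rsubmx I) = 1%:M by rewrite hsubmxK mulmxV.
have IG : row_mx (lsubmx I) (rsubmx I) *m G = 1%:M by rewrite hsubmxK mulVmx.
rewrite mul_row_col in IG; rewrite mul_col_row scalar_mx_block in GI.
have [_ uvR _ _] := eq_block_mx GI.
have [uR vR] : u *m rsubmx I = 0 /\ v *m rsubmx I = 0.
  have : @mulmx K (1 + 1) 5 3 (col_mx u v) (rsubmx I) = 0 by exact: uvR.
  by rewrite mul_col_mx => /eqP; rewrite col_mx_eq0 => /andP[/eqP ? /eqP ?].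
have tr0 (y z : 'rV[K]_5) : y *m z^T = 0 -> z *m y^T = 0.
  by move=> E; apply: trmx_inj; rewrite trmx_mul trmxK E trmx0.
have wR : w *m rsubmx I = 0.
  apply: trmx_inj; apply/row_matrixP => i; rewrite trmx_mul row_mul trmx0 row0.
  have o y : y *m rsubmx I = 0 -> orth (row i (rsubmx I)^T) y.
    by move=> E; rewrite /orth -row_mul -trmx_mul E trmx0 row0.
  by apply/eqP/H; apply: o.
by apply/submxP; exists (w *m lsubmx I); rewrite -{1}[w]mulmx1 -IG mulmxDr !mulmxA wR mul0mx addr0.
Qed.

Lemma wedge_plucker u v : wedge u v != 0 -> exists B,
  [/\ row_free B, plucker B = wedge u v & forall x, (x <= B)%MS = orth x u && orth x v].
Proof.
move=> uv0; have fuv := uv0; rewrite -row_free_wedge in fuv; have [G2 uG] := @row_free_complete _ 2 3 _ fuv.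
set G := col_mx _ G2 in uG; pose I : 'M[K]_(5, 2 + 3) := invmx G.
pose R := rsubmx I; pose W := lsubmx I.
have GI : G *m row_mx W R = 1%:M by rewrite hsubmxK mulmxV.
have IG : row_mx W R *m G = 1%:M by rewrite hsubmxK mulVmx.
rewrite mul_row_col in IG; rewrite mul_col_row scalar_mx_block in GI.
have [_ uvR _ G2R] := eq_block_mx GI.
have [uR vR] : u *m R = 0 /\ v *m R = 0.
  have : @mulmx K (1 + 1) 5 3 (col_mx u v) R = 0 by exact: uvR.
  by rewrite mul_col_mx => /eqP; rewrite col_mx_eq0 => /andP[/eqP ? /eqP ?].
have fB : row_free R^T by apply/row_freeP; exists G2^T; rewrite -trmx_mul G2R trmx1.
have subB x : (x <= R^T)%MS = orth x u && orth x v.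
  apply/idP/andP => [/submxP[y ->]|[/eqP xu /eqP xv]].
    by rewrite /orth -!mulmxA -!trmx_mul uR vR !trmx0 !mulmx0.
  have tr0 (y w : 'rV[K]_5) : y *m w^T = 0 -> w *m y^T = 0.
    by move=> E; apply: trmx_inj; rewrite trmx_mul trmxK E trmx0.
  apply/submxP; exists (G2 *m x^T)^T; apply: trmx_inj; rewrite -trmx_mul trmxK mulmxA.
  have C0 : @mulmx K (1 + 1) 5 1 (col_mx u v) x^T = 0 by rewrite mul_col_mx (tr0 _ _ xu) (tr0 _ _ xv) col_mx0.
  have C1 : @mulmx K 2 5 1 (col_mx u v) x^T = 0 by exact: C0.
  have := congr1 (mulmx^~ x^T) IG; rewrite /= mulmxDl mul1mx -(mulmxA W) C1 mulmx0 add0r.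
  by rewrite -mulmxA => ->.
have [u0 [v0 [E0 sub0]]] := plucker_wedge fB.
have [c Ec] : exists c, wedge u0 v0 = c *: wedge u v.
  by apply: sub_wedge; apply: sub_annihilator => // x xu xv;
    have := subB x; rewrite xu xv sub0 => /andP[].
have c0 : c != 0.
  apply: contraNneq (plucker_neq0 fB) => c0; by rewrite E0 Ec c0 scale0r.
(* Multiplying one row by the inverse of c keeps the plane and corrects the scalar. *)
pose A : 'M[K]_3 := diag_mx (\row_i (if i == ord0 then c^-1 else 1)).
have dA : \det A = c^-1 by rewrite det_diag (bigD1 ord0) //= big1 => [|i /negPf ni]; rewrite mxE ?ni ?mulr1.
have uA : A \in unitmx by rewrite unitmxE dA unitfE invr_eq0.
exists (A *m R^T); split.
- by rewrite /row_free mxrankMfree // mxrank_unit.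
- by rewrite plucker_mulmx dA E0 Ec scalerA mulVf // scale1r.
by move=> x; rewrite eqmxMfull ?row_full_unit // subB.
Qed.

End Dictionary.

Section Dictionary2.
Variable K : numFieldType.
Implicit Types (u v w a b x : 'rV[K]_5) (p : 'rV[K]_10) (B : 'M[K]_(3, 5)).

Lemma grassmannianP p : grassmannian p <-> exists u v, wedge u v != 0 /\ p = wedge u v.
Proof.
split=> [[B fB <-]|[u [v [uv0 ->]]]].
  have [u [v [E _]]] := plucker_wedge fB.
  by exists u, v; rewrite -E plucker_neq0.
by have [B [fB <- _]] := wedge_plucker uv0; exists B.
Qed.

(** A point x annihilated by u and v contracts u ^ v to 0, hence also a ^ b; as a and b are
    independent, a vanishes at x. *)
Lemma wedge_inj u v a b : wedge u v != 0 -> wedge a b = wedge u v -> (a <= col_mx u v)%MS.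
Proof.
move=> uv0 E; apply: sub_annihilator => // x /eqP xu /eqP xv.
have dot (y z : 'rV[K]_5) : y *m z^T = (\sum_i y 0 i * z 0 i)%:M.
  apply/matrixP => i j; rewrite (ord1 i) (ord1 j) !mxE eqxx mulr1n.
  by apply: eq_bigr => k _; rewrite mxE.
have S : skew_mx (wedge a b) = skew_mx (wedge u v) by rewrite E.
rewrite !skew_mx_wedge in S; have := congr1 (fun M => x *m M) S.
rewrite !mulmxBr !mulmxA xu xv !mul0mx subrr; move: (dot x a) (dot x b) => -> ->.
rewrite !mul_scalar_mx => E2.
have fab : row_free (col_mx a b) by rewrite row_free_wedge E.
have [|_ /eqP] := row_free2P _ _ fab (- (\sum_i x 0 i * b 0 i)) (\sum_i x 0 i * a 0 i) _.
  by rewrite scaleNr addrC.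
by move/eqP=> d0; rewrite /orth (dot x a) d0 raddf0.
Qed.

Lemma in_planeP x p : in_plane x p <->
  exists u v, [/\ wedge u v != 0, p = wedge u v, orth x u & orth x v].
Proof.
split=> [[B [fB <- xB]]|[u [v [uv0 -> xu xv]]]].
  have [u [v [E H]]] := plucker_wedge fB.
  exists u, v; move: xB; rewrite H => /andP[xu xv]; split=> //.
  by rewrite -E plucker_neq0.
by have [B [fB E H]] := wedge_plucker uv0; exists B; rewrite H xu xv.
Qed.

Lemma orth_sub x u v w : orth x u -> orth x v -> (w <= col_mx u v)%MS -> orth x w.
Proof.
move=> /eqP xu /eqP xv /sub_col_mx2[c [d ->]].
by rewrite /orth linearD /= !linearZ /= mulmxDr -!scalemxAr xu xv !scaler0 addr0.
Qed.

Lemma in_plane_wedge x u v : wedge u v != 0 -> in_plane x (wedge u v) <-> orth x u /\ orth x v.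
Proof.
move=> uv0; split=> [/in_planeP[a [b [ab0 E xa xb]]]|[xu xv]]; last by apply/in_planeP; exists u, v.
split; apply: (orth_sub xa xb); first exact: wedge_inj E.
by apply: (wedge_inj ab0 (b := - u)); rewrite -scaleN1r wedgeZr scaleN1r -wedgeC E.
Qed.

(** Derivative at g = 1, in the direction X, of the rule that the skew matrix of [plucker (B *m g)]
    is det g times g^-1 S g^-T, where S is that of [plucker B]. *)
Lemma plucker_replace_row B (X : 'M[K]_5) k :
  \sum_(i < 3) plucker (replace_row B i (row i (B *m X))) 0 k =
  (\tr X *: skew_mx (plucker B) - X *m skew_mx (plucker B) - skew_mx (plucker B) *m X^T)
    (wfst k) (wsnd k).
Proof.
have Ep := pluckerE B; move: (plucker B) Ep => p Ep.
have Y i j : row i (B *m X) 0 j = B i (o5 0) * X (o5 0) j + B i (o5 1) * X (o5 1) j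
    + B i (o5 2) * X (o5 2) j + B i (o5 3) * X (o5 3) j + B i (o5 4) * X (o5 4) j.
  by rewrite !mxE sum5.
have RR i w l j : replace_row B i w l j = if l == i then w 0 j else B l j by rewrite mxE.
have Er i := pluckerE (replace_row B i (row i (B *m X))) k.
rewrite sum3 !Er /= !RR /= !Y {Er RR Y}.
have RHS i j : (\tr X *: skew_mx p - X *m skew_mx p - skew_mx p *m X^T) i j =
   (X (o5 0) (o5 0) + X (o5 1) (o5 1) + X (o5 2) (o5 2) + X (o5 3) (o5 3) + X (o5 4) (o5 4))
     * skew_mx p i j
   - (X i (o5 0) * skew_mx p (o5 0) j + X i (o5 1) * skew_mx p (o5 1) j
      + X i (o5 2) * skew_mx p (o5 2) j + X i (o5 3) * skew_mx p (o5 3) j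
      + X i (o5 4) * skew_mx p (o5 4) j)
   - (skew_mx p i (o5 0) * X j (o5 0) + skew_mx p i (o5 1) * X j (o5 1)
      + skew_mx p i (o5 2) * X j (o5 2) + skew_mx p i (o5 3) * X j (o5 3)
      + skew_mx p i (o5 4) * X j (o5 4)).
  by move: (skew_mx p) => S; rewrite !mxE !sum5 /mxtrace sum5 !mxE.
rewrite RHS {RHS}.
have S i j : skew_mx p i j = (nth [::]
   [:: [:: 0; p 0 (o10 9); - p 0 (o10 8); p 0 (o10 7); - p 0 (o10 6)];
       [:: - p 0 (o10 9); 0; p 0 (o10 5); - p 0 (o10 4); p 0 (o10 3)];
       [:: p 0 (o10 8); - p 0 (o10 5); 0; p 0 (o10 2); - p 0 (o10 1)];
       [:: - p 0 (o10 7); p 0 (o10 4); - p 0 (o10 2); 0; p 0 (o10 0)];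
       [:: p 0 (o10 6); - p 0 (o10 3); p 0 (o10 1); - p 0 (o10 0); 0]] i)`_j.
  by rewrite mxE !inord10s.
rewrite !S {S}; ord10 k; rewrite /= !Ep /=; ring.
Qed.

End Dictionary2.

(** * Tangent spaces and smoothness *)

Section Tangent.
Variable K : numFieldType.
Implicit Types (u v w a b x : 'rV[K]_5) (p : 'rV[K]_10) (B : 'M[K]_(3, 5)).

Lemma replace_row_id B k : replace_row B k (row k B) = B.
Proof. by apply/matrixP => i j; rewrite mxE; case: eqP => // ->; rewrite mxE. Qed.

Lemma plucker_replace_row_lin B k w :
  plucker (replace_row B k w) = \sum_j w 0 j *: plucker (replace_row B k (delta_mx 0 j)).
Proof.
apply/rowP => l; rewrite summxE.
under [RHS]eq_bigr do rewrite mxE pluckerE.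
rewrite pluckerE; move: (triple_tab l) => t /=.
have RR y i j : replace_row B k y i j = if i == k then y 0 j else B i j by rewrite mxE.
have dE i j : (delta_mx 0 i : 'rV[K]_5) 0 j = (j == i)%:R by rewrite mxE.
have W i : w 0 (t i) = \sum_j w 0 j * (t i == j)%:R.
  by rewrite (bigD1 (t i)) //= eqxx mulr1 big1 ?addr0 // => j /negPf; rewrite eq_sym => ->; rewrite mulr0.
under [RHS]eq_bigr do rewrite !RR !dE.
rewrite !RR {RR}; ord3 k; rewrite /= !W !sum5; ring.
Qed.

Lemma plucker_replace_tangent B k w : (plucker (replace_row B k w) <= tangent_space B)%MS.
Proof.
rewrite plucker_replace_row_lin; apply: summx_sub => j _; apply: scalemx_sub.
by rewrite /tangent_space (sumsmx_sup k) // (sumsmx_sup j) // genmxE.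
Qed.

(** The plane is moved infinitesimally by some X with u X^T = a and v X^T = 0; the derivative
    formula then produces a ^ v up to a multiple of [plucker B]. *)
Lemma tangent_wedge_l B u v a : row_free B -> plucker B = wedge u v ->
  (wedge a v <= tangent_space B)%MS.
Proof.
move=> fB E; have uv0 : wedge u v != 0 by rewrite -E plucker_neq0.
have /row_freeP[R uvR] : row_free (col_mx u v) by rewrite row_free_wedge.
pose X : 'M[K]_5 := (R *m (col_mx a 0 : 'M_(1 + 1, 5)))^T.
have UX : (col_mx u v : 'M_(1 + 1, 5)) *m X^T = col_mx a 0.
  by rewrite trmxK mulmxA; move: uvR => ->; rewrite mul1mx.
rewrite mul_col_mx in UX; have [uX vX] := eq_col_mx UX.
have -> : wedge a v = \tr X *: plucker B -
    \sum_(i < 3) plucker (replace_row B i (row i (B *m X))).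
  apply/rowP => k; rewrite [RHS]mxE [X in _ = _ + X]mxE summxE plucker_replace_row E skew_mx_wedge.
  rewrite mulmxBr mulmxBl !mulmxA -(mulmxA u^T) -(mulmxA v^T) uX vX mulmx0.
  have Xu : X *m u^T = a^T by rewrite -uX trmx_mul trmxK.
  have Xv : X *m v^T = 0 by apply: trmx_inj; rewrite trmx_mul trmxK vX trmx0.
  rewrite Xu Xv mul0mx !subr0 sub0r opprK !mxE !big_ord1 !mxE; ring.
apply: addmx_sub.
  by rewrite scalemx_sub // -{1}(replace_row_id B ord0) plucker_replace_tangent.
rewrite -scaleN1r scalemx_sub // summx_sub // => i _; exact: plucker_replace_tangent.
Qed.

Lemma tangent_wedge B u v a b : row_free B -> plucker B = wedge u v ->
  ((wedge u a + wedge v b)%R <= tangent_space B)%MS.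
Proof.
move=> fB E; apply: addmx_sub.
  rewrite wedgeC -scaleN1r scalemx_sub //; apply: (@tangent_wedge_l _ (- v)) => //.
  by rewrite E; apply/rowP => k; rewrite !mxE; ring.
rewrite wedgeC -scaleN1r scalemx_sub //; exact: tangent_wedge_l E.
Qed.

(* These p form the tangent space at u ^ v of the cone over the Grassmannian. *)
Definition tangent u v p := exists a b, p = wedge u a + wedge v b.

Definition smooth_section (V : 'M[K]_(6, 10)) := row_free V /\
  forall u v p1 p2 p3 p4, wedge u v != 0 -> (wedge u v <= V)%MS ->
    [/\ (p1 <= V)%MS, (p2 <= V)%MS, (p3 <= V)%MS & (p4 <= V)%MS] ->
    [/\ tangent u v p1, tangent u v p2, tangent u v p3 & tangent u v p4] ->
    ~ forall c1 c2 c3 c4 : K, c1 *: p1 + c2 *: p2 + c3 *: p3 + c4 *: p4 = 0 ->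
        [/\ c1 = 0, c2 = 0, c3 = 0 & c4 = 0].

Lemma smooth_sectionP (V : 'M[K]_(6, 10)) : smooth_surface_section V -> smooth_section V.
Proof.
case=> fV SV; split=> // u v p1 p2 p3 p4 uv0 uvV [V1 V2 V3 V4] [T1 T2 T3 T4] ind.
have [B [fB EB _]] := wedge_plucker uv0.
pose P : 'M[K]_(1 + (1 + (1 + 1)), 10) := col_mx p1 (col_mx p2 (col_mx p3 p4)).
have fP : row_free P.
  rewrite -kermx_eq0; apply/rowV0P => x /sub_kermxP.
  rewrite -{1}[x]hsubmxK -{1}[rsubmx x]hsubmxK -{1}[rsubmx (rsubmx x)]hsubmxK !mul_row_col.
  rewrite [lsubmx x]mx11_scalar [lsubmx (rsubmx x)]mx11_scalar.
  rewrite [lsubmx (rsubmx (rsubmx x))]mx11_scalar [rsubmx (rsubmx (rsubmx x))]mx11_scalar.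
  rewrite !mul_scalar_mx !addrA => /ind[h1 h2 h3 h4].
  rewrite -[x]hsubmxK -[rsubmx x]hsubmxK -[rsubmx (rsubmx x)]hsubmxK.
  rewrite [lsubmx x]mx11_scalar [lsubmx (rsubmx x)]mx11_scalar.
  rewrite [lsubmx (rsubmx (rsubmx x))]mx11_scalar [rsubmx (rsubmx (rsubmx x))]mx11_scalar.
  by rewrite h1 h2 h3 h4 !raddf0 !row_mx0.
have TT p : tangent u v p -> (p <= tangent_space B)%MS.
  by case=> a [b ->]; apply: tangent_wedge.
have : (P <= tangent_space B :&: V)%MS by rewrite sub_capmx !col_mx_sub !TT //= V1 V2 V3 V4.
by move/mxrankS; rewrite (SV B) // ?EB // (eqP fP).
Qed.

End Tangent.

(** * Linear algebra and adapted coordinates *)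

Section LinAlg.
Variable K : fieldType.

Lemma exists_notin_sub m1 m2 n (A : 'M[K]_(m1, n)) (P : 'M[K]_(m2, n)) :
  (\rank A < \rank P)%N -> exists2 v : 'rV_n, (v <= P)%MS & ~~ (v <= A)%MS.
Proof.
move=> rAP; have : ~~ (P <= A)%MS by apply: contraTN rAP => /mxrankS; rewrite leqNgt.
by case/row_subPn => i ni; exists (row i P); rewrite ?row_sub.
Qed.

Lemma rank_col_mx1 m n (A : 'M[K]_(m, n)) (v : 'rV_n) :
  ~~ (v <= A)%MS -> \rank (col_mx v A) = (\rank A).+1.
Proof.
move=> nvA; have v0 : v != 0 by apply: contraNneq nvA => ->; exact: sub0mx.
have : \rank (col_mx v A) = \rank (v + A)%MS by apply/eqP; rewrite -addsmxE.
move=> ->; rewrite mxrank_disjoint_sum ?rank_rV ?v0 //.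
apply/eqP; rewrite -submx0; apply/rV_subP => w; rewrite sub_capmx => /andP[/sub_rVP[c ->] cA].
have [->|c0] := eqVneq c 0; first by rewrite scale0r sub0mx.
by rewrite -(scale1r v) -(mulVf c0) -scalerA scalemx_sub in nvA.
Qed.

Lemma sub_col_mx_l m1 m2 n (A : 'M[K]_(m1, n)) (B : 'M[K]_(m2, n)) : (A <= col_mx A B)%MS.
Proof. by apply/submxP; exists (row_mx 1%:M 0); rewrite mul_row_col mul1mx mul0mx addr0. Qed.

Lemma sub_col_mx_r m1 m2 n (A : 'M[K]_(m1, n)) (B : 'M[K]_(m2, n)) : (B <= col_mx A B)%MS.
Proof. by apply/submxP; exists (row_mx 0 1%:M); rewrite mul_row_col mul1mx mul0mx add0r. Qed.

Lemma row_free_row n (v : 'rV[K]_n) : row_free v = (v != 0).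
Proof. by rewrite /row_free rank_rV; case: (v != 0). Qed.

Lemma row_free_col1 m n (A : 'M[K]_(m, n)) (v : 'rV_n) :
  row_free (col_mx v A) = row_free A && ~~ (v <= A)%MS.
Proof.
have [vA|nvA] := boolP (v <= A)%MS.
  have -> : row_free (col_mx v A) = (\rank A == m.+1).
    rewrite /row_free; congr (_ == _); apply/eqP; rewrite eqn_leq !mxrankS //.
      exact: sub_col_mx_r.
    by rewrite col_mx_sub vA submx_refl.
  by rewrite andbF; apply/negbTE; rewrite neq_ltn ltnS rank_leq_row.
by rewrite /row_free rank_col_mx1 // andbT -addn1 addnC eqn_add2l.
Qed.

Lemma sub_col2P n (u a b : 'rV[K]_n) :
  reflect (exists c d, u = c *: a + d *: b) (u <= col_mx a b)%MS.
Proof.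
apply: (iffP idP) => [/submxP[x ->]|[c [d ->]]].
  rewrite -[x]hsubmxK mul_row_col; exists (lsubmx x 0 0), (rsubmx x 0 0).
  by rewrite {1}[lsubmx x]mx11_scalar {1}[rsubmx x]mx11_scalar !mul_scalar_mx.
have [sa sb] : (a <= col_mx a b)%MS /\ (b <= col_mx a b)%MS.
  by rewrite sub_col_mx_l sub_col_mx_r.
by rewrite addmx_sub // scalemx_sub.
Qed.

Lemma sub_col3P n (u a b c : 'rV[K]_n) :
  reflect (exists x y z, u = x *: a + y *: b + z *: c) (u <= col_mx a (col_mx b c))%MS.
Proof.
apply: (iffP idP) => [/submxP[x ->]|[x [y [z ->]]]].
  rewrite -[x]hsubmxK mul_row_col; exists (lsubmx x 0 0).
  have /sub_col2P[y [z ->]] := submxMl (rsubmx x) (col_mx b c).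
  by exists y, z; rewrite {1}[lsubmx x]mx11_scalar mul_scalar_mx addrA.
have [sa sbc] : (a <= col_mx a (col_mx b c))%MS /\ (col_mx b c <= col_mx a (col_mx b c))%MS.
  by rewrite sub_col_mx_l sub_col_mx_r.
rewrite -addrA addmx_sub ?scalemx_sub //; apply: submx_trans sbc.
by apply/sub_col2P; exists y, z.
Qed.

Lemma eqmx_of_rank m1 m2 n (A : 'M[K]_(m1, n)) (B : 'M[K]_(m2, n)) :
  (A <= B)%MS -> (\rank B <= \rank A)%N -> (A :=: B)%MS.
Proof. by move=> AB rBA; apply/eqmxP; rewrite AB /= -(mxrank_leqif_sup AB) eqn_leq rBA mxrankS. Qed.

Lemma exists_killed m n k (V : 'M[K]_(m, n)) (W : 'M[K]_(n, k)) : row_free V -> (k < m)%N ->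
  exists v : 'rV_n, [/\ v != 0, (v <= V)%MS & v *m W = 0].
Proof.
move=> fV km.
have : kermx (V *m W) != 0.
  rewrite -mxrank_eq0 mxrank_ker subn_eq0 -ltnNge.
  by apply: leq_ltn_trans km; rewrite (leq_trans (mxrankM_maxr _ _)) // rank_leq_col.
case/rowV0Pn => x /sub_kermxP E x0; exists (x *m V); split; rewrite ?submxMl // -?mulmxA //.
by apply: contra_neq x0 => xV; apply: (row_free_inj fV); rewrite mul0mx.
Qed.

(** Since V has dimension 6, up to five coordinates of a nonzero vector of V can be prescribed to
    vanish; this is the source of the extra tangent directions used below. *)
Lemma exists_coords0 m n k (V : 'M[K]_(m, n)) (s : k.-tuple 'I_n) : row_free V -> (k < m)%N ->
  exists v : 'rV_n, [/\ v != 0, (v <= V)%MS & forall i, i \in s -> v 0 i = 0].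
Proof.
move=> fV km; have [v [v0 vV vW]] := exists_killed (\matrix_(i, j) (i == tnth s j)%:R) fV km.
exists v; split=> // i /tnthP[j ->]; have := congr1 (fun M : 'rV_k => M 0 j) vW.
rewrite !mxE (bigD1 (tnth s j)) //= mxE eqxx mulr1 big1 ?addr0 // => l /negPf nl.
by rewrite mxE nl mulr0.
Qed.

End LinAlg.

Section Coords.
Variable K : numFieldType.

Definition r5 (a b c d e : K) : 'rV[K]_5 := \row_i [:: a; b; c; d; e]`_i.

Definition basis5 (a b c d e : 'rV[K]_5) : 'M[K]_5 :=
  \matrix_(i, j) (nth 0 [:: a; b; c; d; e] i) 0 j.

Lemma r5_basis a b c d e (v0 v1 v2 v3 v4 : 'rV[K]_5) :
  r5 a b c d e *m basis5 v0 v1 v2 v3 v4 = a *: v0 + b *: v1 + c *: v2 + d *: v3 + e *: v4.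
Proof. by apply/rowP => j; rewrite !mxE sum5 !mxE. Qed.

Lemma r5_eta (v : 'rV[K]_5) : v = r5 (v 0 (o5 0)) (v 0 (o5 1)) (v 0 (o5 2)) (v 0 (o5 3)) (v 0 (o5 4)).
Proof. by apply/rowP => j; ord5 j; rewrite mxE. Qed.

Lemma basis5_unit (v0 v1 v2 v3 v4 : 'rV[K]_5) :
  (forall a b c d e : K, a *: v0 + b *: v1 + c *: v2 + d *: v3 + e *: v4 = 0 ->
     [/\ a = 0, b = 0 & [/\ c = 0, d = 0 & e = 0]]) ->
  basis5 v0 v1 v2 v3 v4 \in unitmx.
Proof.
move=> H; rewrite -row_free_unit -kermx_eq0; apply/rowV0P => x /sub_kermxP.
rewrite (r5_eta x) r5_basis => /H[-> -> [-> -> ->]].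
by apply/rowP => j; ord5 j; rewrite !mxE.
Qed.

(** V read in the coordinates given by the rows of E. *)
Definition transport (V : 'M[K]_(6, 10)) (E : 'M[K]_5) := V *m wedge_mx (invmx E).

Lemma transport_sub V E (p : 'rV[K]_10) : E \in unitmx ->
  (p <= transport V E)%MS = (p *m wedge_mx E <= V)%MS.
Proof.
move=> uE; have uW := wedge_mx_unit uE; rewrite /transport wedge_mxV //.
apply/idP/idP => [/submxP[x ->]|/submxP[x E1]].
  by rewrite -mulmxA mulmxKV // submxMl.
by rewrite -(mulmxK uW p) E1 -mulmxA submxMl.
Qed.

Lemma transport_wedge V E u v : E \in unitmx ->
  (wedge u v <= transport V E)%MS = (wedge (u *m E) (v *m E) <= V)%MS.
Proof. by move=> uE; rewrite transport_sub // wedge_mulmx. Qed.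

Lemma smooth_transport V E : E \in unitmx -> smooth_section V -> smooth_section (transport V E).
Proof.
move=> uE [fV SV]; have uW := wedge_mx_unit uE.
split=> [|u v p1 p2 p3 p4 uv0 uvV].
  rewrite /transport /row_free mxrankMfree ?(eqP fV) // row_free_unit.
  by rewrite wedge_mx_unit // unitmx_inv.
rewrite !transport_sub // in uvV *; rewrite -wedge_mulmx in uvV => V4 T4 ind.
have inj0 (p : 'rV[K]_10) : p *m wedge_mx E = 0 -> p = 0.
  by move=> p0; rewrite -(mulmxK uW p) p0 mul0mx.
apply: (SV _ _ _ _ _ _ _ uvV V4).
- by apply: contraNneq uv0; rewrite wedge_mulmx => /inj0 ->.
- have TT p : tangent u v p -> tangent (u *m E) (v *m E) (p *m wedge_mx E).
    by move=> [a [b ->]]; exists (a *m E), (b *m E); rewrite mulmxDl !wedge_mulmx.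
  by case: T4 => *; split; apply: TT.
by move=> c1 c2 c3 c4; rewrite !scalemxAl -!mulmxDl => /inj0 /ind.
Qed.

Lemma coordE (p q : 'rV[K]_10) (k : 'I_10) : p = q -> p 0 k = q 0 k.
Proof. by move=> ->. Qed.

Lemma cancel0 (x y : K) : y != 0 -> y * x = 0 -> x = 0.
Proof. by move=> y0 E; apply: (mulfI y0); rewrite mulr0. Qed.

(** This and the lemma below let [ring] check an explicit combination of vanishing quantities. *)
Lemma lin1 (a x y : K) : x = 0 -> y = a * x -> y = 0.
Proof. by move=> -> ->; rewrite mulr0. Qed.

Lemma lin4 (a b c d x1 x2 x3 x4 y : K) : x1 = 0 -> x2 = 0 -> x3 = 0 -> x4 = 0 ->
  y = a * x1 + b * x2 + c * x3 + d * x4 -> y = 0.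
Proof. by move=> -> -> -> -> ->; rewrite !mulr0 !addr0. Qed.

End Coords.

Notation e0 := (r5 1 0 0 0 0).
Notation e1 := (r5 0 1 0 0 0).
Notation e2 := (r5 0 0 1 0 0).
Notation e3 := (r5 0 0 0 1 0).
Notation e4 := (r5 0 0 0 0 1).

Arguments coordE [K p q] k _.
Ltac coord H k := move: (coordE (o10 k) H); rewrite !mxE /=.
Ltac byrow := apply/rowP; elim/ord10_ind; rewrite !mxE /=; ring.

(** * Four disjoint lines on the section *)

Section Lines.
Variable K : numFieldType.
Implicit Types (V : 'M[K]_(6, 10)) (l m n p q u v w y : 'rV[K]_5) (P : 'M[K]_(3, 5)) (L : 'M[K]_(2, 10)).

Definition indep2 (k : nat) (u v : 'rV[K]_k) := forall c d, c *: u + d *: v = 0 -> c = 0 /\ d = 0.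
Definition indep3 (k : nat) (u v w : 'rV[K]_k) :=
  forall x y z : K, x *: u + y *: v + z *: w = 0 -> [/\ x = 0, y = 0 & z = 0].

Lemma indep2_notin (k : nat) (u v : 'rV[K]_k) : u != 0 -> ~~ (v <= u)%MS -> indep2 u v.
Proof.
move=> u0 nv c d E; have d0 : d = 0.
  apply: contraNeq nv => d0; apply/sub_rVP; exists (- d^-1 * c).
  by apply: (scalerI d0); rewrite scalerA mulrA mulrN divff // mulN1r scaleNr; apply/eqP; rewrite -subr_eq0 opprK addrC E.
by split=> //; move/eqP: E; rewrite d0 scale0r addr0 scaler_eq0 (negPf u0) orbF => /eqP.
Qed.

Lemma indep3_notin (k : nat) (u v w : 'rV[K]_k) : indep2 u v -> ~~ (w <= col_mx u v)%MS -> indep3 u v w.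
Proof.
move=> uv nw x y z E; have z0 : z = 0.
  apply: contraNeq nw => z0; apply/sub_col2P; exists (- z^-1 * x), (- z^-1 * y).
  apply: (scalerI z0); rewrite scalerDr !scalerA !mulrA mulrN divff // !mulN1r !scaleNr -opprD.
  by apply/eqP; rewrite -subr_eq0 opprK addrC E.
by move: E; rewrite z0 scale0r addr0 => /uv[-> ->].
Qed.

Lemma indep2_neq0 (k : nat) (u v : 'rV[K]_k) : indep2 u v -> u != 0 /\ v != 0.
Proof.
move=> uv; split; apply/eqP => E; [have [] := uv 1 0 | have [] := uv 0 1];
  by rewrite ?E ?scaler0 ?scale0r ?addr0 // => /eqP; rewrite ?oner_eq0 // => _ /eqP; rewrite oner_eq0.
Qed.

Lemma indep2_rank (k : nat) (u v : 'rV[K]_k) : indep2 u v -> \rank (col_mx u v) = 2%N.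
Proof.
move=> uv; have [u0 v0] := indep2_neq0 uv.
rewrite rank_col_mx1 ?rank_rV ?v0 //; apply/negP => /sub_rVP[c E].
have [] := uv 1 (- c); first by rewrite scale1r E scaleNr subrr.
by move/eqP; rewrite oner_eq0.
Qed.

Lemma wedge_eq0 u v : u != 0 -> wedge u v = 0 -> (v <= u)%MS.
Proof.
move=> u0 /eqP uv0; apply: contraTT uv0 => nv.
by rewrite -row_free_wedge; apply/row_free2P; apply: indep2_notin.
Qed.

Lemma wedge_indep l m n : indep3 l m n -> indep2 (wedge l m) (wedge l n).
Proof.
move=> H c d; rewrite -!wedgeZr -wedgeDr => E.
have l0 : l != 0.
  apply/eqP => l0; have [] := H 1 0 0; first by rewrite l0 !scale0r scaler0 !addr0.
  by move/eqP; rewrite oner_eq0.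
have /sub_rVP[a Ea] := wedge_eq0 l0 E.
have [] := H (- a) c d; last by [].
by rewrite -addrA Ea scaleNr addNr.
Qed.

(* A line on S: the planes that contain the line P = 0 and lie in the hyperplane l = 0. *)
Definition line V l P L := [/\ row_free P, (l <= P)%MS, l != 0, row_free L /\ (L <= V)%MS &
  forall y, (y <= P)%MS -> (wedge l y <= L)%MS].

Lemma line_extend l m P : row_free P -> indep2 l m -> exists2 n, (n <= P)%MS & indep3 l m n.
Proof.
move=> fP lm; have := @exists_notin_sub _ _ _ _ (col_mx l m) P.
rewrite (indep2_rank lm) (eqP fP) => /(_ isT)[n nP nn].
by exists n => //; apply: indep3_notin.
Qed.

Lemma line_basis l P : row_free P -> l != 0 -> exists m n,
  [/\ (m <= P)%MS, (n <= P)%MS & indep3 l m n].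
Proof.
move=> fP l0; have := @exists_notin_sub _ _ _ _ l P; rewrite rank_rV l0 (eqP fP) => /(_ isT)[m mP nm].
have [n nP lmn] := line_extend fP (indep2_notin l0 nm).
by exists m, n.
Qed.

Lemma line_span V l P L m n : line V l P L -> (m <= P)%MS -> (n <= P)%MS -> indep3 l m n ->
  (L :=: col_mx (wedge l m) (wedge l n))%MS.
Proof.
move=> [fP lP l0 [fL LV] wL] mP nP lmn; apply/eqmx_sym/eqmx_of_rank.
  by rewrite col_mx_sub !wL.
by rewrite (indep2_rank (wedge_indep lmn)) (eqP fL).
Qed.

Lemma plane_span l P m n : row_free P -> (l <= P)%MS -> (m <= P)%MS -> (n <= P)%MS ->
  indep3 l m n -> (P :=: col_mx l (col_mx m n))%MS.
Proof.
move=> fP lP mP nP lmn; apply/eqmx_sym/eqmx_of_rank; first by rewrite !col_mx_sub lP mP nP.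
have mn : indep2 m n by move=> c d E; have [] := lmn 0 c d; rewrite // scale0r add0r.
rewrite (eqP fP) rank_col_mx1 ?(indep2_rank mn) //; apply/negP => /sub_col2P[c [d E]].
have [] := lmn 1 (- c) (- d); first by rewrite scale1r !scaleNr {1}E -addrA -opprD subrr.
by move/eqP; rewrite oner_eq0.
Qed.

Lemma cap0 (i j k : nat) (A : 'M[K]_(i, k)) (B : 'M[K]_(j, k)) (v : 'rV_k) : (A :&: B = 0)%MS ->
  (v <= A)%MS -> (v <= B)%MS -> v = 0.
Proof. by move=> AB vA vB; apply/eqP; rewrite -submx0 -AB sub_capmx vA vB. Qed.

Lemma disjoint_indep V l1 P1 L1 l2 P2 L2 m1 n1 m2 n2 : line V l1 P1 L1 -> line V l2 P2 L2 ->
  (L1 :&: L2 = 0)%MS -> (m1 <= P1)%MS -> (n1 <= P1)%MS -> (m2 <= P2)%MS -> (n2 <= P2)%MS ->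
  indep3 l1 m1 n1 -> indep3 l2 m2 n2 -> forall c1 c2 c3 c4,
  c1 *: wedge l1 m1 + c2 *: wedge l1 n1 + c3 *: wedge l2 m2 + c4 *: wedge l2 n2 = 0 ->
  [/\ c1 = 0, c2 = 0, c3 = 0 & c4 = 0].
Proof.
move=> [_ _ _ _ w1] [_ _ _ _ w2] L12 m1P n1P m2P n2P i1 i2 c1 c2 c3 c4.
rewrite -addrA => /eqP; rewrite addr_eq0 => /eqP E.
have Z : c1 *: wedge l1 m1 + c2 *: wedge l1 n1 = 0.
  apply: (cap0 L12); first by rewrite addmx_sub // scalemx_sub // w1.
  by rewrite E -scaleN1r scalemx_sub // addmx_sub // scalemx_sub // w2.
have [-> ->] := wedge_indep i1 Z; move/eqP: E; rewrite Z eq_sym oppr_eq0 => /eqP.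
by case/(wedge_indep i2) => -> ->.
Qed.

(** If l1 is in P2 then l2 ^ l1 is a point of the second line, and all l1 ^ y and l2 ^ y are tangent
    there: both lines lie in one tangent space, giving four independent vectors. If l1 and l2 are
    proportional, the point l1 ^ m1 plays this role. *)
Lemma center_notin V l1 P1 L1 l2 P2 L2 : smooth_section V -> line V l1 P1 L1 -> line V l2 P2 L2 ->
  (L1 :&: L2 = 0)%MS -> ~~ (l1 <= P2)%MS.
Proof.
move=> [_ SV] H1 H2 L12; apply/negP => l1P2.
have [fP1 l1P1 l10 [fL1 L1V] w1] := H1; have [fP2 l2P2 l20 [fL2 L2V] w2] := H2.
have [m1 [n1 [m1P n1P i1]]] := line_basis fP1 l10.
have [m2 [n2 [m2P n2P i2]]] := line_basis fP2 l20.
have ind := disjoint_indep H1 H2 L12 m1P n1P m2P n2P i1 i2.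
have inV : [/\ (wedge l1 m1 <= V)%MS, (wedge l1 n1 <= V)%MS, (wedge l2 m2 <= V)%MS & (wedge l2 n2 <= V)%MS].
  by split; [apply: submx_trans L1V; apply: w1 | apply: submx_trans L1V; apply: w1
            | apply: submx_trans L2V; apply: w2 | apply: submx_trans L2V; apply: w2].
have w0 u : wedge u 0 = 0 :> 'rV[K]_10 by rewrite -(scale0r 0) wedgeZr scale0r.
have [E|ne] := eqVneq (wedge l2 l1) 0.
  have /sub_rVP[c Ec] := wedge_eq0 l20 E.
  have c0 : c != 0 by apply: contraNneq l10 => c0; rewrite Ec c0 scale0r.
  apply: (SV l1 m1 _ _ _ _ _ _ inV _ ind).
  - by have [] := indep2_neq0 (wedge_indep i1).
  - by case: inV.
  have T a : tangent l1 m1 (wedge l2 a).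
    by exists (c^-1 *: a), 0; rewrite w0 addr0 wedgeZr Ec wedgeZl scalerA mulVf // scale1r.
  by split; [exists m1, 0 | exists n1, 0 | |]; rewrite ?w0 ?addr0.
apply: (SV l2 l1 _ _ _ _ ne _ inV _ ind).
  by apply: submx_trans L2V; apply: w2.
by split; [exists 0, m1 | exists 0, n1 | exists m2, 0 | exists n2, 0]; rewrite w0 ?addr0 ?add0r.
Qed.

(** Finds u in the pencil of e0, e1 and a form a with u ^ a = x e0 ^ e1 + (g0 e0 + g1 e1) ^ e4, and
    completes u to a basis of the pencil. The form u is proportional to (g0, g1) when this is
    nonzero. *)
Lemma pencil_adapted (g0 g1 x : K) : exists u0 u1 a0 a1 a4 v0 v1 : K,
  [/\ u0 * a1 - u1 * a0 = x, u0 * a4 = g0, u1 * a4 = g1 & u0 * v1 - u1 * v0 = 1].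
Proof.
have [->|g00] := eqVneq g0 0.
  by exists 0, 1, (- x), 0, g1, (- 1), 0; split; rewrite ?mul0r ?mul1r ?opprK ?add0r ?sub0r ?opprK.
exists g0, g1, 0, (x / g0), 1, 0, g0^-1.
by rewrite !mulr1 !mulr0 !subr0 mulrC divfK // divff.
Qed.

(** The section would contain the quadric of points u ^ w, with u in the pencil of e0, e1 and w in
    that of e2, e3. A vector v of V beyond its span can be written u ^ a + w ^ b for a well chosen
    point u ^ w, so it is tangent there besides the three directions of the cone over the
    quadric. *)
Lemma no_quadric V : smooth_section V ->
  (wedge e0 e2 <= V)%MS -> (wedge e0 e3 <= V)%MS ->
  (wedge e1 e2 <= V)%MS -> (wedge e1 e3 <= V)%MS ->
  False :> Prop.
Proof.
move=> [fV SV] V02 V03 V12 V13.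
(* Up to sign, coordinates 8, 7, 5, 4 are those of e0 ^ e2, e0 ^ e3, e1 ^ e2, e1 ^ e3. *)
have [v [v0 vV vz]] := exists_coords0 [tuple o10 8; o10 7; o10 5; o10 4] fV isT.
have [z8 z7 z5 z4] : [/\ v 0 (o10 8) = 0, v 0 (o10 7) = 0, v 0 (o10 5) = 0 & v 0 (o10 4) = 0].
  by split; apply: vz; rewrite !inE.
pose g0 := - v 0 (o10 6); pose g1 := v 0 (o10 3); pose g2 := - v 0 (o10 1); pose g3 := v 0 (o10 0).
pose x := v 0 (o10 9); pose y := v 0 (o10 2).
have Ev : v = x *: wedge e0 e1 + y *: wedge e2 e3
   + wedge (r5 g0 g1 g2 g3 0) e4.
  by rewrite /x /y /g0 /g1 /g2 /g3; apply/rowP; elim/ord10_ind; rewrite ?z8 ?z7 ?z5 ?z4 !mxE /=; ring.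
have [u0 [u1 [a0 [a1 [a4 [u0' [u1' [Ux Ug0 Ug1 Ud]]]]]]]] := pencil_adapted g0 g1 x.
have [w0 [w1 [b0 [b1 [b4 [w0' [w1' [Wy Wg2 Wg3 Wd]]]]]]]] := pencil_adapted g2 g3 y.
have inV (a b c d : K) : (wedge (r5 a b 0 0 0) (r5 0 0 c d 0) <= V)%MS.
  have -> : wedge (r5 a b 0 0 0) (r5 0 0 c d 0) =
     (a * c) *: wedge e0 e2 + (a * d) *: wedge e0 e3
     + (b * c) *: wedge e1 e2 + (b * d) *: wedge e1 e3 :> 'rV[K]_10.
    by byrow.
  by rewrite !addmx_sub // scalemx_sub.
pose u := r5 u0 u1 0 0 0; pose w := r5 0 0 w0 w1 0.
have ind c1 c2 c3 : c1 *: wedge u w + c2 *: wedge u (r5 0 0 w0' w1' 0) + c3 *: wedge (r5 u0' u1' 0 0 0) w = 0 ->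
    [/\ c1 = 0, c2 = 0 & c3 = 0].
  move=> E; coord E 8%N; coord E 7%N; coord E 5%N; coord E 4%N => M13 M12 M03 M02.
  have R x1 : x1 * ((u0 * u1' - u1 * u0') * (w0 * w1' - w1 * w0')) = 0 -> x1 = 0.
    by rewrite Ud Wd !mulr1.
  split; apply: R.
  - by apply: (lin4 (a := - (u1' * w1')) (b := - (u1' * w0')) (c := - (u0' * w1')) (d := - (u0' * w0')) M02 M03 M12 M13); ring.
  - by apply: (lin4 (a := u1' * w1) (b := u1' * w0) (c := u0' * w1) (d := u0' * w0) M02 M03 M12 M13); ring.
  - by apply: (lin4 (a := u1 * w1') (b := u1 * w0') (c := u0 * w1') (d := u0 * w0') M02 M03 M12 M13); ring.
have uw0 : wedge u w != 0.
  apply/eqP => E; have [] := ind 1 0 0; first by rewrite E !scale0r scaler0 !addr0.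
  by move/eqP; rewrite oner_eq0.
apply: (SV u w (wedge u w) (wedge u (r5 0 0 w0' w1' 0)) (wedge (r5 u0' u1' 0 0 0) w) v uw0 (inV _ _ _ _)).
- by split=> //; apply: inV.
- split.
  + by exists w, 0; byrow.
  + by exists (r5 0 0 w0' w1' 0), 0; byrow.
  + by exists 0, (- r5 u0' u1' 0 0 0); byrow.
  exists (r5 a0 a1 0 0 a4), (r5 0 0 b0 b1 b4).
  by rewrite Ev -Ux -Ug0 -Ug1 -Wy -Wg2 -Wg3; byrow.
move=> c1 c2 c3 c4 E.
have c40 : c4 = 0.
  apply: contraNeq v0 => c40; apply/eqP/rowP => k; rewrite [RHS]mxE.
  apply: (mulfI c40); rewrite mulr0; move: (congr1 (fun M : 'rV_10 => M 0 k) E).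
  by ord10 k; rewrite ?z8 ?z7 ?z5 ?z4 ?mulr0 // !mxE /= => <-; ring.
by move: E; rewrite c40 scale0r addr0 => /ind[-> -> ->].
Qed.

End Lines.

Section TripleCore.
Variable K : numFieldType.
Implicit Types (V : 'M[K]_(6, 10)) (l m n p q u v w : 'rV[K]_5).

(** The three given wedges and z ^ (c e0 + e2) are all tangent at e0 ^ e2, so the last one lies in
    the span of the others and its remaining coordinates vanish. *)
Lemma third_line_core V z0 z1 z2 z3 z4 c : smooth_section V ->
  (wedge e0 e2 <= V)%MS -> (wedge e0 e3 <= V)%MS -> (wedge e1 e2 <= V)%MS ->
  (wedge (r5 z0 z1 z2 z3 z4) (r5 c 0 1 0 0) <= V)%MS -> [/\ z3 = 0, z4 = 0 & c * z1 = 0].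
Proof.
move=> [_ SV] V02 V03 V12 Vz.
have H (k : 'I_10) : k != o10 8 -> k != o10 7 -> k != o10 5 ->
    wedge (r5 z0 z1 z2 z3 z4) (r5 c 0 1 0 0) 0 k = 0.
  move=> k8 k7 k5; apply: contraTeq isT => nz; apply/negP => _.
  apply: (SV e0 e2 (wedge e0 e2) (wedge e0 e3) (wedge e1 e2) _ _ V02) => [|||c1 c2 c3 c4 E].
  - by apply/eqP => E; coord E 8%N => /eqP; rewrite !mulr0 mulr1 !sub0r oppr_eq0 oner_eq0.
  - by split; [exact: V02 | exact: V03 | exact: V12 | exact: Vz].
  - split; [exists e2, 0 | exists e3, 0 | exists 0, (- e1) |
      exists (- c *: r5 z0 z1 z2 z3 z4), (- r5 z0 z1 z2 z3 z4)]; byrow.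
  have c40 : c4 = 0.
    apply: (mulIf nz); rewrite mul0r; have := coordE k E; rewrite [X in X = _ -> _]mxE [X in _ + X]mxE.
    rewrite [in X in X + _]mxE => {nz}; move: k8 k7 k5; ord10 k => // _ _ _; rewrite !mxE /= => h; apply: (lin1 (a := 1) h); ring.
  move: E; rewrite c40 => E; coord E 8%N; coord E 7%N; coord E 5%N => h5 h7 h8.
  by split=> //; [apply: (lin1 (a := -1) h8) | apply: (lin1 (a := 1) h7) | apply: (lin1 (a := 1) h5)]; ring.
have := H (o10 1) isT isT isT; have := H (o10 2) isT isT isT; have := H (o10 9) isT isT isT.
rewrite !mxE /= => h9 h2 h1.
by split; [apply: (lin1 (a := -1) h2) | apply: (lin1 (a := 1) h1) | apply: (lin1 (a := -1) h9)]; ring.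
Qed.

Notation o6 i := (@Ordinal 6 i isT).

Lemma ord6_ind (P : 'I_6 -> Prop) : P (o6 0) -> P (o6 1) -> P (o6 2) -> P (o6 3) -> P (o6 4) -> P (o6 5) -> forall k, P k.
Proof.
move=> H0 H1 H2 H3 H4 H5; case=> m.
by do 6! (case: m => [|m]; first by move=> h; rewrite (bool_irrelevance h isT)).
Qed.

Lemma sum6 (W : nmodType) (F : 'I_6 -> W) : \sum_i F i = F (@Ordinal 6 0 isT) + F (@Ordinal 6 1 isT)
  + F (@Ordinal 6 2 isT) + F (@Ordinal 6 3 isT) + F (@Ordinal 6 4 isT) + F (@Ordinal 6 5 isT).
Proof. rewrite !big_ord_recl big_ord0 addr0 !addrA; by do !congr (_ + _); congr F; apply/val_inj. Qed.

Lemma span6 V (v1 v2 v3 v4 v5 v6 w : 'rV[K]_10) : row_free V ->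
  (v1 <= V)%MS -> (v2 <= V)%MS -> (v3 <= V)%MS -> (v4 <= V)%MS -> (v5 <= V)%MS -> (v6 <= V)%MS ->
  (forall x1 x2 x3 x4 x5 x6 : K,
     x1 *: v1 + x2 *: v2 + x3 *: v3 + x4 *: v4 + x5 *: v5 + x6 *: v6 = 0 ->
     [/\ x1 = 0, x2 = 0, x3 = 0 & [/\ x4 = 0, x5 = 0 & x6 = 0]]) ->
  (w <= V)%MS -> exists x1 x2 x3 x4 x5 x6 : K,
     w = x1 *: v1 + x2 *: v2 + x3 *: v3 + x4 *: v4 + x5 *: v5 + x6 *: v6.
Proof.
move=> fV h1 h2 h3 h4 h5 h6 ind wV.
pose N : 'M[K]_(6, 10) := \matrix_(i, j) (nth 0 [:: v1; v2; v3; v4; v5; v6] i) 0 j.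
have EN (x : 'rV[K]_6) : x *m N = x 0 (@Ordinal 6 0 isT) *: v1 + x 0 (@Ordinal 6 1 isT) *: v2
   + x 0 (@Ordinal 6 2 isT) *: v3 + x 0 (@Ordinal 6 3 isT) *: v4 + x 0 (@Ordinal 6 4 isT) *: v5
   + x 0 (@Ordinal 6 5 isT) *: v6.
  by apply/rowP => j; rewrite mxE sum6 !mxE.
have NV : (N <= V)%MS.
  apply/row_subP => i; have -> : row i N = nth 0 [:: v1; v2; v3; v4; v5; v6] i.
    by apply/rowP => j; rewrite !mxE.
  by elim/ord6_ind: i.
have fN : row_free N.
  rewrite -kermx_eq0; apply/rowV0P => x /sub_kermxP; rewrite EN => /ind[x0 x1 x2 [x3 x4 x5]].
  by apply/rowP; elim/ord6_ind; rewrite mxE.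
have /submxP[x ->] : (w <= N)%MS.
  by rewrite (eqmx_of_rank NV) // (eqP fN) (eqP fV).
by rewrite EN; do 6 eexists.
Qed.

Lemma lin_eq3 (a b c x1 x2 x3 y1 y2 y3 z : K) : x1 = y1 -> x2 = y2 -> x3 = y3 ->
  z = a * (x1 - y1) + b * (x2 - y2) + c * (x3 - y3) -> z = 0.
Proof. by move=> -> -> -> ->; rewrite !subrr !mulr0 !addr0. Qed.

Lemma wedge_plucker_rel (u v : 'rV[K]_5) : let w (k : 'I_10) := wedge u v 0 k in
  [/\ w (o10 9) * w (o10 0) - w (o10 7) * w (o10 3) + w (o10 6) * w (o10 4) = 0,
      w (o10 7) * w (o10 1) - w (o10 8) * w (o10 0) - w (o10 6) * w (o10 2) = 0,
      w (o10 5) * w (o10 0) - w (o10 4) * w (o10 1) + w (o10 3) * w (o10 2) = 0,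
      w (o10 9) * w (o10 2) - w (o10 8) * w (o10 4) + w (o10 7) * w (o10 5) = 0 &
      w (o10 8) * w (o10 3) - w (o10 9) * w (o10 1) - w (o10 6) * w (o10 5) = 0].
Proof. by move=> w; rewrite /w !mxE /=; split; ring. Qed.

Lemma addr_scale0 (x : K) (a b : 'rV[K]_10) : x = 0 -> a + x *: b = a.
Proof. by move=> ->; rewrite scale0r addr0. Qed.

Lemma comb12 (x y : K) (a b c d e : 'rV[K]_10) :
  x *: a + y *: b + 0 *: c + 0 *: d + 0 *: e = x *: a + y *: b.
Proof. by rewrite !scale0r !addr0. Qed.

Lemma comb13 (x y : K) (a b c d e : 'rV[K]_10) :
  x *: a + 0 *: b + y *: c + 0 *: d + 0 *: e = x *: a + y *: c.
Proof. by rewrite !scale0r !addr0. Qed.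

Lemma comb24 (x y : K) (a b c d e : 'rV[K]_10) :
  0 *: a + x *: b + 0 *: c + y *: d + 0 *: e = x *: b + y *: d.
Proof. by rewrite !scale0r !addr0 add0r. Qed.

Lemma comb125 (x y : K) (a b c d e f : 'rV[K]_10) : f = a + b ->
  x *: a + x *: b + 0 *: c + 0 *: d + y *: e = x *: f + y *: e.
Proof. by move=> ->; rewrite !scale0r !addr0 scalerDr. Qed.

Lemma comb_cancel (p1 p2 q1 q2 : K) (a b c : 'rV[K]_10) :
  q2 *: (p1 *: a + p2 *: b) + - p2 *: (q1 *: a + q2 *: b) = (q2 * p1 - p2 * q1) *: a + 0 *: c.
Proof. by apply/rowP => k; rewrite !mxE; ring. Qed.

(** Let M be the line spanned by e0 ^ e2 and e1 ^ e2. It meets three lines, of centers e0, e1 and e0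
    + e1 + t e2, while the points u ^ y form a fourth line avoiding these three. The hyperplane
    where the coordinate of e3 ^ e4 vanishes cuts the section only in M and the three lines; so the
    fourth line meets M, is then contained in it, and reaches the first line. *)
Lemma no_common_transversal V t (u y1 y2 : 'rV[K]_5) : smooth_section V ->
  (wedge e0 e2 <= V)%MS -> (wedge e0 e3 <= V)%MS -> (wedge e1 e2 <= V)%MS -> (wedge e1 e4 <= V)%MS ->
  (wedge (r5 1 1 t 0 0) (r5 0 0 0 1 1) <= V)%MS ->
  (forall a b, (wedge u (a *: y1 + b *: y2) <= V)%MS) ->
  (forall a b, (a != 0) || (b != 0) -> forall c d,
    [/\ wedge u (a *: y1 + b *: y2) <> c *: wedge e0 e2 + d *: wedge e0 e3,
        wedge u (a *: y1 + b *: y2) <> c *: wedge e1 e2 + d *: wedge e1 e4 &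
        wedge u (a *: y1 + b *: y2) <> c *: wedge (r5 1 1 0 0 0) e2 + d *: wedge (r5 1 1 t 0 0) (r5 0 0 0 1 1)]) ->
  False :> Prop.
Proof.
move=> [fV SV] V02 V03 V12 V14 VZ V4 D4.
(* Up to sign, these are the coordinates of e0 ^ e2, e1 ^ e2, e0 ^ e3, e1 ^ e4, e0 ^ e4; Y is what V
   contains beyond the five known wedges. *)
have [Y [Y0 YV Yz]] := exists_coords0 [tuple o10 8; o10 5; o10 7; o10 3; o10 6] fV isT.
have [z8 z5 z7 [z3 z6]] : [/\ Y 0 (o10 8) = 0, Y 0 (o10 5) = 0, Y 0 (o10 7) = 0 &
    Y 0 (o10 3) = 0 /\ Y 0 (o10 6) = 0] by split; [| | |split]; apply: Yz; rewrite !inE.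
set d := Y 0 (o10 0); pose f := - Y 0 (o10 1); pose e' := Y 0 (o10 2); pose b := - Y 0 (o10 4).
pose g := Y 0 (o10 9).
have EY : Y = wedge (r5 0 0 0 d 0) e4 + wedge (r5 0 b e' 0 0) e3 + wedge (r5 0 0 f 0 0) e4
              + wedge (r5 g 0 0 0 0) e1.
  by rewrite /d /f /e' /b /g; apply/rowP; elim/ord10_ind; rewrite ?z8 ?z5 ?z7 ?z3 ?z6 !mxE /=; ring.
(* Otherwise Y + b e0 ^ e3 is a fourth tangent direction at the point (e0 + e1) ^ e2 of M. *)
have d0 : d != 0.
  apply/eqP => d0.
  apply: (SV (r5 1 1 0 0 0) e2 (wedge e0 e2) (wedge e1 e2)
     (wedge (r5 1 1 t 0 0) (r5 0 0 0 1 1)) (Y + b *: wedge e0 e3)) => [|||| c1 c2 c3 c4 E].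
  - by apply/eqP => E; coord E 5%N => /eqP; rewrite !mulr0 mulr1 !subr0 oner_eq0.
  - have -> : wedge (r5 1 1 0 0 0) e2 = wedge e0 e2 + wedge e1 e2 :> 'rV[K]_10 by byrow.
    exact: addmx_sub.
  - by split=> //; rewrite addmx_sub // scalemx_sub.
  - split; [exists 0, (- e0) | exists 0, (- e1) | exists (r5 0 0 0 1 1), (r5 0 0 0 t t) |
      exists (r5 0 g 0 b 0), (r5 0 0 0 e' f)]; rewrite ?EY ?d0; byrow.
  have c40 : c4 = 0.
    apply: contraNeq Y0 => c40.
    have b0 : b = 0.
      coord E 6%N; coord E 7%N; rewrite ?z7 ?z6 => h7 h6; apply: (mulfI c40); rewrite mulr0.
      by apply: (lin4 (a := 1) (b := 1) (c := 0) (d := 0) h7 h6 (erefl 0) (erefl 0)); ring.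
    have c30 : c3 = 0 by coord E 6%N; rewrite z6 => h6; apply: (lin1 (a := -1) h6); ring.
    apply/eqP/rowP => k; rewrite [RHS]mxE; apply: (mulfI c40); rewrite mulr0.
    move: (coordE k E); rewrite b0 c30; ord10 k; rewrite ?z8 ?z5 ?z7 ?z3 ?z6 ?mulr0 // !mxE /= => h; apply: (lin1 (a := 1) h); ring.
  move: E; rewrite c40 => E; coord E 8%N; coord E 5%N; coord E 6%N => h6 h5 h8.
  by split=> //; [apply: (lin1 (a := -1) h8) | apply: (lin1 (a := 1) h5) | apply: (lin1 (a := -1) h6)]; ring.
(* For t = 0 consider the point (e0 + e1) ^ (c e2 + e3 + e4) of the third line, where c is the value
   that makes Y + b e0 ^ e3 tangent. *)
have t0 : t != 0.
  apply/eqP => t0; rewrite t0 in VZ; pose c := (f - e') / d.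
  have Ec : c * d = f - e' by rewrite divfK.
  have V1 : (wedge (r5 1 1 0 0 0) e2 <= V)%MS.
    have -> : wedge (r5 1 1 0 0 0) e2 = wedge e0 e2 + wedge e1 e2 :> 'rV[K]_10 by byrow.
    exact: addmx_sub.
  apply: (SV (r5 1 1 0 0 0) (r5 0 0 c 1 1) (wedge (r5 1 1 0 0 0) e2) (wedge (r5 1 1 0 0 0) (r5 0 0 0 1 1))
     (c *: wedge e1 e2 + (wedge (r5 1 1 0 0 0) (r5 0 0 0 1 1) + ((-1) *: wedge e0 e3 + wedge e1 e4)))
     (Y + b *: wedge e0 e3)) => [|||| c1 c2 c3 c4 E].
  - by apply/eqP => E; coord E 7%N => /eqP; rewrite !mulr0 mulr1 !subr0 oner_eq0.
  - have -> : wedge (r5 1 1 0 0 0) (r5 0 0 c 1 1) = c *: wedge (r5 1 1 0 0 0) e2 + wedge (r5 1 1 0 0 0) (r5 0 0 0 1 1) :> 'rV[K]_10.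
      by byrow.
    by rewrite addmx_sub // scalemx_sub.
  - split=> //; last by rewrite addmx_sub // scalemx_sub.
    by rewrite !addmx_sub // scalemx_sub.
  - split; [exists e2, 0; byrow | exists (r5 0 0 0 1 1), 0; byrow | exists e4, (- e1); byrow |].
    exists (r5 0 g 0 b 0), (r5 0 0 (- e') 0 d).
    have -> : Y = wedge (r5 0 0 0 d 0) e4 + wedge (r5 0 b e' 0 0) e3 + wedge (r5 0 0 (c * d + e') 0 0) e4
              + wedge (r5 g 0 0 0 0) e1 by rewrite Ec subrK.
    by byrow.
  have c40 : c4 = 0.
    by coord E 0%N => h; apply: (cancel0 d0); apply: (lin1 (a := 1) h); rewrite -/d; ring.
  move: E; rewrite c40 => E.
  have c10 : c1 = 0 by coord E 8%N => h; apply: (lin1 (a := -1) h); ring.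
  have c20 : c2 = 0 by coord E 7%N => h; apply: (lin1 (a := 1) h); ring.
  move: E; rewrite c10 c20 => E.
  by split=> //; coord E 6%N => h; apply: (lin1 (a := -1) h); ring.
have span (w : 'rV[K]_10) : (w <= V)%MS -> exists x1 x2 x3 x4 x5 x6 : K, w = x1 *: wedge e0 e2 + x2 *: wedge e1 e2
    + x3 *: wedge e0 e3 + x4 *: wedge e1 e4 + x5 *: wedge (r5 1 1 t 0 0) (r5 0 0 0 1 1) + x6 *: Y.
  move=> wV; apply: (span6 fV) => // x1 x2 x3 x4 x5 x6 E.
  have x60 : x6 = 0.
    by coord E 0%N => h; apply: (cancel0 d0); apply: (lin1 (a := 1) h); rewrite -/d; ring.
  move: E; rewrite x60 => E.
  have x50 : x5 = 0 by coord E 6%N => h; apply: (lin1 (a := -1) h); ring.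
  move: E; rewrite x50 => E.
  coord E 8%N; coord E 5%N; coord E 7%N; coord E 3%N => h3 h7 h5 h8.
  by split=> //; [apply: (lin1 (a := -1) h8) | apply: (lin1 (a := 1) h5) | apply: (lin1 (a := 1) h7) |
    split=> //; apply: (lin1 (a := 1) h3)]; ring.
(* In this hyperplane the coefficient of Y is 0, and the Plucker relations leave only the three
   lines, excluded by [D4], and M. *)
have onM a1 b1 : (a1 != 0) || (b1 != 0) -> wedge u (a1 *: y1 + b1 *: y2) 0 (o10 0) = 0 ->
    exists x1 x2, x1 != 0 /\ wedge u (a1 *: y1 + b1 *: y2) = x1 *: wedge e0 e2 + x2 *: wedge e1 e2.
  move=> ab r0; have DD := D4 a1 b1 ab; have := wedge_plucker_rel u (a1 *: y1 + b1 *: y2).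
  have [x1 [x2 [x3 [x4 [x5 [x6 Ew]]]]]] := span _ (V4 a1 b1); set w := wedge u _ in r0 Ew DD *.
  have x60 : x6 = 0.
    by move: r0; rewrite Ew !mxE /= => h; apply: (cancel0 d0); apply: (lin1 (a := 1) h); rewrite -/d; ring.
  have {}Ew := etrans Ew (addr_scale0 _ _ x60).
  have W1 : w 0 (o10 1) = - (t * x5) by rewrite Ew !mxE /=; ring.
  have W2 : w 0 (o10 2) = t * x5 by rewrite Ew !mxE /=; ring.
  have W3 : w 0 (o10 3) = x4 + x5 by rewrite Ew !mxE /=; ring.
  have W4 : w 0 (o10 4) = - x5 by rewrite Ew !mxE /=; ring.
  have W5 : w 0 (o10 5) = x2 by rewrite Ew !mxE /=; ring.
  have W6 : w 0 (o10 6) = - x5 by rewrite Ew !mxE /=; ring.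
  have W7 : w 0 (o10 7) = x3 + x5 by rewrite Ew !mxE /=; ring.
  have W8 : w 0 (o10 8) = - x1 by rewrite Ew !mxE /=; ring.
  have W9 : w 0 (o10 9) = 0 by rewrite Ew !mxE /=; ring.
  rewrite /= r0 W1 W2 W3 W4 W5 W6 W7 W8 W9 => -[r1 r2 r3 r4 r5]; rewrite Ew in DD *.
  have s1 : (x3 + x5) * (x4 + x5) - x5 * x5 = 0 by apply: (lin1 (a := -1) r1); ring.
  have s2 : x3 * x5 = 0.
    by apply: (cancel0 t0); apply: (lin1 (a := -1) r2); ring.
  have s3 : x4 * x5 = 0.
    by apply: (cancel0 t0); apply: (lin1 (a := 1) r3); ring.
  have s4 : (x3 + x5) * x2 - x1 * x5 = 0 by apply: (lin1 (a := 1) r4); ring.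
  have s5 : x5 * x2 - x1 * (x4 + x5) = 0 by apply: (lin1 (a := 1) r5); ring.
  have [x50|x50] := eqVneq x5 0; last first.
    have x30 : x3 = 0 by move/eqP: s2; rewrite mulf_eq0 (negPf x50) orbF => /eqP.
    have x40 : x4 = 0 by move/eqP: s3; rewrite mulf_eq0 (negPf x50) orbF => /eqP.
    have x12 : x1 = x2.
      apply/eqP; rewrite eq_sym -subr_eq0; apply/eqP; apply: (cancel0 x50).
      by apply: (lin1 (a := 1) s4); rewrite x30; ring.
    by have [_ _ []] := DD x1 x5; rewrite x30 x40 x12; apply: comb125; byrow.
  rewrite x50 in DD s1 s4 s5 *.
  have [x30|x30] := eqVneq x3 0; last first.
    have x40 : x4 = 0 by apply: (cancel0 x30); apply: (lin1 (a := 1) s1); ring.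
    have x20 : x2 = 0 by apply: (cancel0 x30); apply: (lin1 (a := 1) s4); ring.
    by have [[]] := DD x1 x3; rewrite x40 x20; exact: comb13.
  have [x10|x10] := eqVneq x1 0.
    by have [_ []] := DD x2 x4; rewrite x10 x30; exact: comb24.
  have x40 : x4 = 0 by apply: (cancel0 x10); apply: (lin1 (a := -1) s5); ring.
  exists x1, x2; split=> //; rewrite x30 x40; exact: comb12.
have lin0 a1 b1 : wedge u (a1 *: y1 + b1 *: y2) 0 (o10 0) = a1 * wedge u y1 0 (o10 0) + b1 * wedge u y2 0 (o10 0).
  by rewrite !mxE /=; ring.
have [a1 [b1 [ab1 E1]]] : exists a1 b1, (a1 != 0) || (b1 != 0) /\ wedge u (a1 *: y1 + b1 *: y2) 0 (o10 0) = 0.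
  have [z|nz] := eqVneq (wedge u y1 0 (o10 0)) 0.
    by exists 1, 0; rewrite oner_neq0 lin0 z; split=> //; ring.
  exists (wedge u y2 0 (o10 0)), (- wedge u y1 0 (o10 0)); rewrite oppr_eq0 nz orbT lin0; split=> //; ring.
have [x1 [x2 [x10 Ex]]] := onM a1 b1 ab1 E1.
(* u belongs to the pencil of x1 e0 + x2 e1 and e2. Hence the coordinate of e3 ^ e4 vanishes on the
   whole fourth line. *)
have [u3 u4] : u 0 (o5 3) = 0 /\ u 0 (o5 4) = 0.
  move: (a1 *: y1 + b1 *: y2) Ex => yy Ex; split; apply: (cancel0 x10).
    coord Ex 2%N; coord Ex 7%N; coord Ex 8%N => h8 h7 h2.
    by apply: (lin_eq3 (a := u 0 (o5 3)) (b := u 0 (o5 2)) (c := - u 0 (o5 0)) h8 h7 h2); ring.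
  coord Ex 1%N; coord Ex 6%N; coord Ex 8%N => h8 h6 h1.
  by apply: (lin_eq3 (a := u 0 (o5 4)) (b := - u 0 (o5 2)) (c := u 0 (o5 0)) h8 h6 h1); ring.
have z34 y : wedge u y 0 (o10 0) = 0 by rewrite !mxE /= u3 u4 !mul0r subr0.
have h10 : (1 != 0 :> K) || (0 != 0 :> K) by rewrite oner_neq0.
have h01 : (0 != 0 :> K) || (1 != 0 :> K) by rewrite oner_neq0 orbT.
have [p1 [p2 [p10 Ep]]] := onM 1 0 h10 (z34 _).
have [q1 [q2 [q10 Eq]]] := onM 0 1 h01 (z34 _).
have [p20|p20] := eqVneq p2 0.
  by have [[]] := D4 1 0 h10 p1 0; rewrite Ep p20 !scale0r.
have hq : (q2 != 0) || (- p2 != 0) by rewrite oppr_eq0 p20 orbT.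
(* This combination of two points of the fourth line cancels e1 ^ e2 and so lies on the first
   line. *)
have [[]] := D4 q2 (- p2) hq (q2 * p1 - p2 * q1) 0.
have -> : wedge u (q2 *: y1 + - p2 *: y2) = q2 *: wedge u (1 *: y1 + 0 *: y2) + - p2 *: wedge u (0 *: y1 + 1 *: y2).
  by apply/rowP => k; rewrite !mxE; ring.
rewrite Ep Eq; exact: comb_cancel.
Qed.

End TripleCore.

(** * Relative position of the 3-spaces of four disjoint lines *)

Section FourLines.
Variable K : numFieldType.
Variables (V : 'M[K]_(6, 10)) (l : 'I_4 -> 'rV[K]_5) (P : 'I_4 -> 'M[K]_(3, 5)) (L : 'I_4 -> 'M[K]_(2, 10)).
Hypothesis SV : smooth_section V.
Hypothesis lineL : forall i, line V (l i) (P i) (L i).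
Hypothesis disjL : forall i j, i != j -> (L i :&: L j = 0)%MS.
Implicit Types (m n p q u v w y : 'rV[K]_5) (i j k t : 'I_4).

Definition indep5 (v0 v1 v2 v3 v4 : 'rV[K]_5) := forall a b c d e : K,
  a *: v0 + b *: v1 + c *: v2 + d *: v3 + e *: v4 = 0 ->
  [/\ a = 0, b = 0 & [/\ c = 0, d = 0 & e = 0]].

Lemma center_notinP i j : i != j -> ~~ (l i <= P j)%MS.
Proof. by move=> ij; exact: center_notin SV (lineL i) (lineL j) (disjL ij). Qed.

Lemma lP i : (l i <= P i)%MS. Proof. by have [] := lineL i. Qed.
Lemma l_neq0 i : l i != 0. Proof. by have [] := lineL i. Qed.
Lemma rankP i : \rank (P i) = 3%N. Proof. by have [/eqP] := lineL i. Qed.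
Lemma wedge_L i y : (y <= P i)%MS -> (wedge (l i) y <= L i)%MS. Proof. by have [_ _ _ _ H] := lineL i; apply: H. Qed.
Lemma L_V i : (L i <= V)%MS. Proof. by have [_ _ _ []] := lineL i. Qed.
Lemma wedge_V i y : (y <= P i)%MS -> (wedge (l i) y <= V)%MS.
Proof. by move/wedge_L => H; apply: submx_trans H (L_V i). Qed.

Lemma scaled_in_sub (k : nat) (P' : 'M[K]_(k, 5)) c u : c != 0 -> (c *: u <= P')%MS -> (u <= P')%MS.
Proof. by move=> c0 H; rewrite -(scale1r u) -(mulVf c0) -scalerA scalemx_sub. Qed.

Lemma indep2_center i j m : i != j -> m != 0 -> (m <= P j)%MS -> indep2 (l i) m.
Proof.
move=> ij m0 mj c d E; have c0 : c = 0.
  apply: contraNeq (center_notinP ij) => c0. apply: (scaled_in_sub c0).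
  by move/eqP: E; rewrite addr_eq0 => /eqP ->; rewrite -scaleNr scalemx_sub.
split=> //; move/eqP: E; rewrite c0 scale0r add0r scaler_eq0 (negPf m0) orbF => /eqP //.
Qed.

(** By [no_quadric] in a basis l i, l j, m, n, e; the first four vectors are independent because no
    center lies in the 3-space of another line. *)
Lemma no_indep_cap i j m n : i != j -> (m <= P i)%MS -> (m <= P j)%MS ->
  (n <= P i)%MS -> (n <= P j)%MS -> ~ indep2 m n.
Proof.
move=> ij mi mj ni nj mn; have ji : j != i by rewrite eq_sym.
have i4 a b c d : a *: l i + b *: l j + c *: m + d *: n = 0 -> [/\ a = 0, b = 0, c = 0 & d = 0].
  move=> E; have a0 : a = 0.
    apply: contraNeq (center_notinP ij) => a0; apply: (scaled_in_sub a0).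
    have -> : a *: l i = - (b *: l j + (c *: m + d *: n)).
      by apply/eqP; rewrite -addr_eq0 !addrA E.
    by rewrite -scaleN1r scalemx_sub // !addmx_sub // scalemx_sub // lP.
  have b0 : b = 0.
    apply: contraNeq (center_notinP ji) => b0; apply: (scaled_in_sub b0).
    have -> : b *: l j = - (a *: l i + (c *: m + d *: n)).
      by apply/eqP; rewrite -addr_eq0 addrCA !addrA E.
    by rewrite -scaleN1r scalemx_sub // !addmx_sub // scalemx_sub // lP.
  by move: E; rewrite a0 b0 !scale0r !add0r => /mn[].
pose M := col_mx (l i) (col_mx (l j) (col_mx m n)).
have [e _ ne] : exists2 e : 'rV_5, (e <= (1%:M : 'M[K]_5))%MS & ~~ (e <= M)%MS.
  by apply: exists_notin_sub; rewrite mxrank1 ltnS (leq_trans (rank_leq_row _)).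
have uE : basis5 (l i) (l j) m n e \in unitmx.
  apply: basis5_unit => a b c d x E; have x0 : x = 0.
    apply: contraNeq ne => x0; apply: (scaled_in_sub x0).
    have -> : x *: e = - (a *: l i + b *: l j + c *: m + d *: n).
      by apply/eqP; rewrite -addr_eq0 addrC E.
    rewrite -scaleN1r scalemx_sub // /M.
    have H2 := sub_col_mx_r (l i) (col_mx (l j) (col_mx m n)).
    have H3 := submx_trans (sub_col_mx_r (l j) (col_mx m n)) H2.
    rewrite !addmx_sub // scalemx_sub //.
    - exact: sub_col_mx_l.
    - exact: submx_trans (sub_col_mx_l _ _) H2.
    - exact: submx_trans (sub_col_mx_l _ _) H3.
    - exact: submx_trans (sub_col_mx_r _ _) H3.
  by move: E; rewrite x0 scale0r addr0 => /i4[].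
set E := basis5 _ _ _ _ _ in uE.
apply: (no_quadric (smooth_transport uE SV)); rewrite transport_wedge // !r5_basis;
  by rewrite !scale0r !scale1r !(add0r, addr0); apply: wedge_V.
Qed.

Lemma exists_cap i j : exists m, [/\ m != 0, (m <= P i)%MS & (m <= P j)%MS].
Proof.
have : (P i :&: P j)%MS != 0.
  rewrite -mxrank_eq0 -lt0n; have := mxrank_sum_cap (P i) (P j); rewrite !rankP.
  have : (\rank (P i + P j) <= 5)%N by exact: rank_leq_col.
  by case: (\rank (P i :&: P j)%MS) => // ; rewrite addn0 => + E; rewrite E.
by case/rowV0Pn => m; rewrite sub_capmx => /andP[mi mj] m0; exists m.
Qed.

Lemma cap_unique i j m y : i != j -> m != 0 -> (m <= P i)%MS -> (m <= P j)%MS ->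
  (y <= P i)%MS -> (y <= P j)%MS -> (y <= m)%MS.
Proof.
move=> ij m0 mi mj yi yj; apply: contraT => ny.
by case: (no_indep_cap ij mi mj yi yj (indep2_notin m0 ny)).
Qed.

Lemma pair_indep i j m p q : i != j -> m != 0 -> (m <= P i)%MS -> (m <= P j)%MS ->
  (p <= P i)%MS -> (q <= P j)%MS -> indep3 (l i) m p -> indep3 (l j) m q -> indep5 (l i) (l j) m p q.
Proof.
move=> ij m0 mi mj pi qj ip iq a b c d e E.
have [x Ex] : exists x, a *: l i + c *: m + d *: p = x *: m.
  apply/sub_rVP; apply: (cap_unique ij) => //.
    by rewrite !addmx_sub // scalemx_sub // lP.
  have -> : a *: l i + c *: m + d *: p = - (b *: l j + e *: q).
    by apply/eqP; rewrite -addr_eq0 -E; apply/eqP/rowP => h; rewrite !mxE; ring.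
  by rewrite -scaleN1r scalemx_sub // addmx_sub // scalemx_sub // lP.
have [b0 x0 e0] : [/\ b = 0, x = 0 & e = 0].
  apply: iq; rewrite -Ex -E; apply/rowP => h; rewrite !mxE; ring.
have [-> -> ->] : [/\ a = 0, c = 0 & d = 0] by apply: ip; rewrite Ex x0 scale0r.
by rewrite b0 e0.
Qed.

Lemma pair_form i j m : i != j -> m != 0 -> (m <= P i)%MS -> (m <= P j)%MS ->
  exists p q, [/\ (p <= P i)%MS, (q <= P j)%MS & indep5 (l i) (l j) m p q].
Proof.
move=> ij m0 mi mj; have ji : j != i by rewrite eq_sym.
have fP h : row_free (P h) by rewrite /row_free rankP.
have [p pi ip] := line_extend (fP i) (indep2_center ij m0 mj).
have [q qj iq] := line_extend (fP j) (indep2_center ji m0 mi).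
by exists p, q; split=> //; apply: pair_indep.
Qed.

(** The line of the section that joins L i to L j and the one that joins L i to L k meet L i in
    distinct points. Otherwise one line would meet L i, L j and L k, and the line of index t would
    contradict [no_common_transversal]. *)
Lemma triple_good i j k t m m' : i != j -> i != k -> j != k -> i != t -> j != t -> k != t ->
  m != 0 -> (m <= P i)%MS -> (m <= P j)%MS -> m' != 0 -> (m' <= P i)%MS -> (m' <= P k)%MS ->
  ~~ (m' <= col_mx (l i) m)%MS.
Proof.
move=> ij ik jk it jt kt m0 mi mj m'0 m'i m'k; apply/negP => /sub_col2P[a [b Em']].
have ki : k != i by rewrite eq_sym.
have kj : k != j by rewrite eq_sym.
have b0 : b != 0.
  apply: contraNneq (center_notinP ik) => b0; rewrite b0 scale0r addr0 in Em'.
  have a0 : a != 0 by apply: contraNneq m'0 => a0; rewrite Em' a0 scale0r.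
  by apply: (scaled_in_sub a0); rewrite -Em'.
pose c := b^-1 * a; pose m2 := c *: l i + m.
have Em2 : m2 = b^-1 *: m' by rewrite Em' scalerDr !scalerA mulVf // scale1r.
have m2i : (m2 <= P i)%MS by rewrite Em2 scalemx_sub.
have m2k : (m2 <= P k)%MS by rewrite Em2 scalemx_sub.
have [p [q [pi qj ind]]] := pair_form ij m0 mi mj.
have uE := basis5_unit ind; set E := basis5 _ _ _ _ _ in uE.
have ER (v : 'rV[K]_5) : exists z0 z1 z2 z3 z4, v = r5 z0 z1 z2 z3 z4 *m E.
  by rewrite -(mulmxKV uE v) (r5_eta (v *m invmx E)); do 5 eexists.
have [z0 [z1 [z2 [z3 [z4 Ez]]]]] := ER (l k).
have sV' := smooth_transport uE SV.
have Em2' : m2 = r5 c 0 1 0 0 *m E by rewrite r5_basis !scale0r scale1r !addr0.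
have tw := transport_wedge V _ _ uE.
(* Hence l k = z0 l i + z1 l j + z2 m, and c = 0 as soon as z1 is nonzero: the vector m is common to
   the three 3-spaces. *)
have [z30 z40 cz1] : [/\ z3 = 0, z4 = 0 & c * z1 = 0].
  apply: (third_line_core (z0 := z0) (z2 := z2) sV'); rewrite tw ?r5_basis.
  1-3: by rewrite !scale0r !scale1r !(add0r, addr0); apply: wedge_V.
  by rewrite -r5_basis -/E -Ez -r5_basis -/E -Em2' wedge_V.
rewrite z30 z40 r5_basis !scale0r !addr0 in Ez.
have z10 : z1 != 0.
  apply: contraNneq (center_notinP ki) => z10; rewrite Ez z10 scale0r addr0.
  by rewrite addmx_sub // scalemx_sub // lP.
have z00 : z0 != 0.
  apply: contraNneq (center_notinP kj) => z00; rewrite Ez z00 scale0r add0r.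
  by rewrite addmx_sub // scalemx_sub // lP.
have c0 : c = 0 by move/eqP: cz1; rewrite mulf_eq0 (negPf z10) orbF => /eqP.
have mk : (m <= P k)%MS by move: m2k; rewrite /m2 c0 scale0r add0r.
have fP h : row_free (P h) by rewrite /row_free rankP.
have [r0 r0k ir0] := line_extend (fP k) (indep2_center ki m0 mi).
have [y0 [y1 [y2 [y3 [y4 Er0]]]]] := ER r0; rewrite r5_basis in Er0.
(* Multiples of l k and m are subtracted to remove the components of r0 along l j and m. *)
pose r := r0 - (y1 / z1) *: l k - (y2 - y1 / z1 * z2) *: m.
have rk : (r <= P k)%MS.
  by rewrite /r -addrA -opprD addmx_sub // -scaleN1r scalemx_sub // addmx_sub // scalemx_sub // lP.
have ir : indep2 m r.
  move=> x y; rewrite /r => Exy.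
  have [] := ir0 (- (y * (y1 / z1))) (x - y * (y2 - y1 / z1 * z2)) y; last first.
    by move=> _ + y00; rewrite y00 mul0r subr0.
  by rewrite -Exy; apply/rowP => h; rewrite !mxE; ring.
pose s0 := y0 - y1 / z1 * z0.
have Er : r = s0 *: l i + y3 *: p + y4 *: q.
  rewrite /r Er0 Ez /s0; apply/rowP => h; rewrite !mxE.
  have D : y1 / z1 * z1 = y1 by rewrite divfK.
  move: (y1 / z1) D => x D; rewrite -D; ring.
have y40 : y4 != 0.
  apply/eqP => y40; apply: (no_indep_cap ik mi mk _ rk ir).
  by rewrite Er y40 scale0r addr0 addmx_sub // scalemx_sub // lP.
have y30 : y3 != 0.
  apply/eqP => y30; pose r' := r - (s0 / z0) *: l k.
  apply: (no_indep_cap jk mj mk (n := r')).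
  - have -> : r' = y4 *: q - (s0 / z0 * z1) *: l j - (s0 / z0 * z2) *: m.
      rewrite /r' Er Ez y30; apply/rowP => h; rewrite !mxE.
      have D : s0 / z0 * z0 = s0 by rewrite divfK.
      by move: (s0 / z0) D => x D; rewrite -D; ring.
    by rewrite -addrA -opprD addmx_sub ?scalemx_sub // -scaleN1r scalemx_sub // addmx_sub // scalemx_sub // lP.
  - by rewrite /r' addmx_sub // -scaleN1r scalemx_sub // scalemx_sub // lP.
  move=> x y; rewrite /r' /r => Exy.
  have [] := ir0 (- (y * (y1 / z1) + y * (s0 / z0))) (x - y * (y2 - y1 / z1 * z2)) y; last first.
    by move=> _ + y00; rewrite y00 mul0r subr0.
  by rewrite -Exy; apply/rowP => h; rewrite !mxE; ring.
(* In this rescaled basis l k reads e0 + e1 + z2 e2 and r reads e3 + e4. *)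
pose l1 := z0 *: l i; pose l2 := z1 *: l j; pose p' := s0 *: l i + y3 *: p; pose q' := y4 *: q.
have uF : basis5 l1 l2 m p' q' \in unitmx.
  apply: basis5_unit => x0 x1 x2 x3 x4 Ex.
  have E0 : (x0 * z0 + x3 * s0) *: l i + (x1 * z1) *: l j + x2 *: m + (x3 * y3) *: p + (x4 * y4) *: q = 0.
    by rewrite -Ex; apply/rowP => h; rewrite !mxE; ring.
  have [h0 h1 [h2 h3 h4]] := ind _ _ _ _ _ E0.
  have cancel (x y : K) : y != 0 -> x * y = 0 -> x = 0.
    by move=> yn0 /eqP; rewrite mulf_eq0 (negPf yn0) orbF => /eqP.
  have x30 := cancel _ _ y30 h3; rewrite x30 mul0r addr0 in h0.
  by rewrite (cancel _ _ z00 h0) (cancel _ _ z10 h1) h2 x30 (cancel _ _ y40 h4).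
set F := basis5 _ _ _ _ _ in uF.
have [n1 [n2 [n1t n2t in12]]] := line_basis (fP t) (l_neq0 t).
have twF := transport_wedge V _ _ uF.
have F0 : e0 *m F = l1 by rewrite r5_basis !scale0r scale1r !addr0.
have F1 : e1 *m F = l2 by rewrite r5_basis !scale0r scale1r !addr0 add0r.
have F2 : e2 *m F = m by rewrite r5_basis !scale0r scale1r !addr0 !add0r.
have F3 : e3 *m F = p' by rewrite r5_basis !scale0r scale1r !addr0 !add0r.
have F4 : e4 *m F = q' by rewrite r5_basis !scale0r scale1r !add0r.
have FZ : r5 1 1 z2 0 0 *m F = l k by rewrite r5_basis !scale0r !scale1r !addr0 Ez.
have FW : r5 0 0 0 1 1 *m F = r by rewrite r5_basis !scale0r !scale1r !add0r Er.
have FL : r5 1 1 0 0 0 *m F = l k - z2 *: m.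
  by rewrite r5_basis !scale0r !scale1r !addr0 Ez -/l1 -/l2 addrK.
have p'i : (p' <= P i)%MS by rewrite addmx_sub // scalemx_sub // lP.
have q'j : (q' <= P j)%MS by rewrite scalemx_sub.
have Y4 a1 b1 : (a1 *: (n1 *m invmx F) + b1 *: (n2 *m invmx F)) *m F = a1 *: n1 + b1 *: n2.
  by rewrite mulmxDl -!scalemxAl !mulmxKV.
apply: (no_common_transversal (t := z2) (u := l t *m invmx F) (y1 := n1 *m invmx F) (y2 := n2 *m invmx F)
  (smooth_transport uF SV)).
1-4: by rewrite twF ?F0 ?F1 ?F2 ?F3 ?F4 wedgeZl scalemx_sub // wedge_V.
- by rewrite twF FZ FW wedge_V.
- by move=> a1 b1; rewrite twF mulmxKV // Y4 wedge_V // addmx_sub // scalemx_sub.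
move=> a1 b1 ab1 c1 d1.
have key h (x : 'rV[K]_10) : h != t -> (x <= L h)%MS ->
    wedge (l t) (a1 *: n1 + b1 *: n2) <> x.
  move=> ht xh Ex; have : wedge (l t) (a1 *: n1 + b1 *: n2) = 0.
    by apply: (cap0 (disjL ht)); [rewrite Ex | rewrite wedge_L // addmx_sub // scalemx_sub].
  rewrite wedgeDr !wedgeZr => /(wedge_indep in12)[a10 b10].
  by move: ab1; rewrite a10 b10 eqxx.
have back (x : 'rV[K]_10) : wedge (l t *m invmx F) (a1 *: (n1 *m invmx F) + b1 *: (n2 *m invmx F)) = x ->
    wedge (l t) (a1 *: n1 + b1 *: n2) = x *m wedge_mx F.
  by move=> <-; rewrite -wedge_mulmx mulmxKV // Y4.
split=> /back Ex.
- apply: (key i _ it _ Ex); rewrite mulmxDl -!scalemxAl -!wedge_mulmx F0 F2 F3 !wedgeZl.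
  by rewrite addmx_sub // !scalemx_sub // wedge_L.
- apply: (key j _ jt _ Ex); rewrite mulmxDl -!scalemxAl -!wedge_mulmx F1 F2 F4 [wedge l2 _]wedgeZl [wedge l2 _]wedgeZl.
  by rewrite addmx_sub // !scalemx_sub // wedge_L.
apply: (key k _ kt _ Ex); rewrite mulmxDl -!scalemxAl -!wedge_mulmx FL F2 FZ FW.
have -> : wedge (l k - z2 *: m) m = wedge (l k) m.
  by rewrite wedgeDl -scaleNr wedgeZl wedgexx scaler0 addr0.
by rewrite addmx_sub // scalemx_sub // wedge_L.
Qed.

End FourLines.

(** * The normal form of four disjoint lines *)

Section NormalCore.
Variable K : numFieldType.
Implicit Types (V : 'M[K]_(6, 10)).

(** Let U = d3 e2 + d2 e3. Removing the known wedges leaves c1 e0 ^ e4 + U ^ e4 and c2 e1 ^ U + d2 U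
    ^ e3 in V, both tangent at e0 ^ U together with e0 ^ e3 and e0 ^ e2. When U = 0 the point e0 ^
    e3 is used instead. *)
Lemma relation_core V c1 c2 d3 d2 : smooth_section V ->
  (wedge e0 e3 <= V)%MS -> (wedge e0 e2 <= V)%MS -> (wedge e1 e2 <= V)%MS -> (wedge e1 e4 <= V)%MS ->
  (wedge (r5 c1 c2 d3 d2 0) e3 <= V)%MS -> (wedge (r5 c1 c2 d3 d2 0) e4 <= V)%MS ->
  c1 != 0 -> c2 != 0 -> False :> Prop.
Proof.
move=> [_ SV] V03 V02 V12 V14 Vb3 Vb4 c10 c20.
set b3 := r5 c1 c2 d3 d2 0 in Vb3 Vb4.
have V4 : ((wedge b3 e4 + (- c2) *: wedge e1 e4)%R <= V)%MS by rewrite addmx_sub // scalemx_sub.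
have V3 : ((wedge b3 e3 + (- c1) *: wedge e0 e3)%R <= V)%MS by rewrite addmx_sub // scalemx_sub.
have [U0|U0] := boolP ((d3 == 0) && (d2 == 0)).
  have [/eqP d30 /eqP d20] := andP U0.
  apply: (SV e0 e3 (wedge e0 e3) (wedge e0 e2) (wedge b3 e3 + (- c1) *: wedge e0 e3)
             (wedge b3 e4 + (- c2) *: wedge e1 e4)) => // [||x1 x2 x3 x4 E].
  - by apply/eqP => E; coord E 7%N => /eqP; rewrite !mulr0 mulr1 !subr0 oner_eq0.
  - rewrite /b3 d30 d20; split; [exists e3, 0 | exists e2, 0 | exists 0, (- c2 *: e1) | exists (c1 *: e4), 0]; byrow.
  move: E; rewrite /b3 d30 d20 => E.
  have x30 : x3 = 0 by coord E 4%N => h; apply: (cancel0 c20); apply: (lin1 (a := -1) h); ring.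
  have x40 : x4 = 0 by coord E 6%N => h; apply: (cancel0 c10); apply: (lin1 (a := -1) h); ring.
  move: E; rewrite x30 x40 => E.
  by split=> //; [coord E 7%N => h; apply: (lin1 (a := 1) h) | coord E 8%N => h; apply: (lin1 (a := -1) h)]; ring.
apply: (SV e0 (r5 0 0 d3 d2 0) (wedge e0 e3) (wedge e0 e2) (wedge b3 e4 + (- c2) *: wedge e1 e4)
  ((c2 * d3) *: wedge e1 e2 + d2 *: (wedge b3 e3 + (- c1) *: wedge e0 e3))) => [||||x1 x2 x3 x4 E].
- apply: contraNneq U0 => E; coord E 8%N; coord E 7%N => h7 h8.
  by apply/andP; split; apply/eqP; [apply: (lin1 (a := -1) h8) | apply: (lin1 (a := 1) h7)]; ring.
- have -> : wedge e0 (r5 0 0 d3 d2 0) = d3 *: wedge e0 e2 + d2 *: wedge e0 e3 by byrow.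
  by rewrite addmx_sub // scalemx_sub.
- by split=> //; rewrite addmx_sub // scalemx_sub.
- split; [exists e3, 0 | exists e2, 0 | exists (c1 *: e4), e4 | exists 0, (- c2 *: e1 + d2 *: e3)];
    rewrite /b3; byrow.
move: E; rewrite /b3 => E.
have x30 : x3 = 0 by coord E 6%N => h; apply: (cancel0 c10); apply: (lin1 (a := -1) h); ring.
have x40 : x4 = 0.
  move: E; rewrite x30 => E; apply: contraNeq U0 => x40; apply/andP; split; apply/eqP; apply: (cancel0 x40); apply: (cancel0 c20).
    by coord E 5%N => h; apply: (lin1 (a := 1) h); ring.
  by coord E 4%N => h; apply: (lin1 (a := -1) h); ring.
move: E; rewrite x30 x40 => E.
by split=> //; [coord E 7%N => h; apply: (lin1 (a := 1) h) | coord E 8%N => h; apply: (lin1 (a := -1) h)]; ring.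
Qed.

Local Notation b2 := (r5 (-1) (-1) (-1) (-1) (-1) : 'rV[K]_5).

Lemma standard_span V w : row_free V ->
  (wedge e0 e3 <= V)%MS -> (wedge e0 e2 <= V)%MS -> (wedge e1 e2 <= V)%MS -> (wedge e1 e4 <= V)%MS ->
  (wedge b2 e3 <= V)%MS -> (wedge b2 e4 <= V)%MS -> (w <= V)%MS ->
  exists x1 x2 x3 x4 x5 x6 : K, w = x1 *: wedge e0 e3 + x2 *: wedge e0 e2 + x3 *: wedge e1 e2
    + x4 *: wedge e1 e4 + x5 *: wedge b2 e3 + x6 *: wedge b2 e4.
Proof.
move=> fV h1 h2 h3 h4 h5 h6; apply: (span6 fV) => // x1 x2 x3 x4 x5 x6 E.
have x50 : x5 = 0 by coord E 4%N => h; apply: (lin1 (a := 1) h); ring.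
have x60 : x6 = 0 by coord E 6%N => h; apply: (lin1 (a := 1) h); ring.
move: E; rewrite x50 x60 => E; coord E 7%N; coord E 8%N; coord E 5%N; coord E 3%N => g3 g5 g8 g7.
by split=> //; [apply: (lin1 (a := 1) g7) | apply: (lin1 (a := -1) g8) | apply: (lin1 (a := 1) g5) |
  split=> //; apply: (lin1 (a := 1) g3)]; ring.
Qed.

Lemma fourth_core V (u0 u1 u2 u3 u4 x y z : K) : row_free V ->
  (wedge e0 e3 <= V)%MS -> (wedge e0 e2 <= V)%MS -> (wedge e1 e2 <= V)%MS -> (wedge e1 e4 <= V)%MS ->
  (wedge b2 e3 <= V)%MS -> (wedge b2 e4 <= V)%MS ->
  (wedge (r5 u0 u1 u2 u3 u4) (r5 x 0 z y 0) <= V)%MS -> y != 0 -> z != 0 ->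
  ~ (u1 = 0 /\ u4 = 0) -> [/\ x = z, y = z, u1 = 0 & u2 = u3].
Proof.
move=> fV h1 h2 h3 h4 h5 h6 hw y0 z0 nu.
have [x1 [x2 [x3 [x4 [x5 [x6 E]]]]]] := standard_span fV h1 h2 h3 h4 h5 h6 hw.
coord E 9%N; coord E 6%N; coord E 1%N; coord E 4%N; coord E 2%N; coord E 0%N => w0 w2 w4 w1 w6 w9.
(* f1 to f4 are the four linear equations of V in P^9, evaluated at the given wedge. *)
have f1 : u1 * x = 0 by apply: (lin_eq3 (a := -1) (b := 0) (c := 0) w9 w9 w9); ring.
have f2 : u4 * (x - z) = 0 by apply: (lin_eq3 (a := 1) (b := -1) (c := 0) w6 w1 w9); ring.
have f3 : u1 * y - u2 * y + u3 * z = 0 by apply: (lin_eq3 (a := -1) (b := -1) (c := 0) w4 w2 w9); ring.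
have f4 : u1 * y + u4 * (z - y) = 0 by apply: (lin_eq3 (a := 1) (b := -1) (c := 1) w0 w4 w1); ring.
have u40 : u4 != 0.
  apply/eqP => u40; case: nu; split=> //; apply: (cancel0 y0); apply: (lin1 (a := 1) f4); rewrite u40; ring.
have xz : x = z by apply/eqP; rewrite -subr_eq0; apply/eqP/(cancel0 u40).
have u10 : u1 = 0 by apply: (cancel0 z0); rewrite -xz mulrC.
have yz : y = z.
  apply/eqP; rewrite eq_sym -subr_eq0; apply/eqP/(cancel0 u40); apply: (lin1 (a := 1) f4); rewrite u10; ring.
split=> //; apply/eqP; rewrite -subr_eq0; apply/eqP/(cancel0 z0).
by apply: (lin1 (a := -1) f3); rewrite u10 yz; ring.
Qed.

End NormalCore.

Section Frames.
Variable K : numFieldType.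

(* The four centers, and for each line two further generators of its 3-space. The hexagon of lines
   through the coordinate points is spanned by b_i ^ m_j with b_0 + b_1 + b_2 + m_0 + m_1 + m_2 = 0
   and (e0, ..., e4) = (b_0, b_1, m_2, m_1, m_0); moreover b_3 = m_0 + m_1 + m_2. *)
Definition bstd (i : 'I_4) : 'rV[K]_5 :=
  nth 0 [:: e0; e1; r5 (-1) (-1) (-1) (-1) (-1); r5 0 0 1 1 1] i.
Definition n1std (i : 'I_4) : 'rV[K]_5 := nth 0 [:: e3; e4; e4; r5 1 0 1 1 0] i.
Definition n2std (i : 'I_4) : 'rV[K]_5 := nth 0 [:: e2; e2; e3; r5 0 1 1 0 1] i.
Definition Lstd (i : 'I_4) : 'M[K]_(1 + 1, 10) :=
  col_mx (wedge (bstd i) (n1std i)) (wedge (bstd i) (n2std i)).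

Definition is_frame (L : 'I_4 -> 'M[K]_(2, 10)) (E : 'M[K]_5) :=
  E \in unitmx /\ forall i, (L i :=: Lstd i *m wedge_mx E)%MS.

Lemma Lstd_frame i (E : 'M[K]_5) : Lstd i *m wedge_mx E =
  col_mx (wedge (bstd i *m E) (n1std i *m E)) (wedge (bstd i *m E) (n2std i *m E)).
Proof. by rewrite /Lstd mul_col_mx -!wedge_mulmx. Qed.

End Frames.

Notation o4 i := (@Ordinal 4 i isT).

Lemma ord4_ind (P : 'I_4 -> Prop) : P (o4 0) -> P (o4 1) -> P (o4 2) -> P (o4 3) -> forall k, P k.
Proof.
move=> H0 H1 H2 H3; case=> m.
by do 4! (case: m => [|m]; first by move=> h; rewrite (bool_irrelevance h isT)).
Qed.

Ltac ord4 k := elim/ord4_ind: k.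

Section NormalForm.
Variable K : numFieldType.
Variables (V : 'M[K]_(6, 10)) (l : 'I_4 -> 'rV[K]_5) (P : 'I_4 -> 'M[K]_(3, 5)) (L : 'I_4 -> 'M[K]_(2, 10)).
Hypothesis SV : smooth_section V.
Hypothesis lineL : forall i, line V (l i) (P i) (L i).
Hypothesis disjL : forall i j, i != j -> (L i :&: L j = 0)%MS.
Implicit Types (m n p q u v w y : 'rV[K]_5) (i j k t : 'I_4).

Let wV i y := @wedge_V _ V l P L lineL i y.

(* i, j, k are three of the lines, mk spans P i :&: P j, etc. *)
Lemma no_short_relation i j k mi mj mk c1 c2 c3 d3 d2 : i != j -> i != k -> j != k ->
  (mk <= P i)%MS -> (mk <= P j)%MS -> (mj <= P i)%MS -> (mj <= P k)%MS ->
  (mi <= P j)%MS -> (mi <= P k)%MS -> indep5 (l i) (l j) mk mj mi ->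
  c1 *: l i + c2 *: l j + c3 *: l k + d3 *: mk + d2 *: mj = 0 ->
  c1 != 0 -> c2 != 0 -> c3 != 0 -> False :> Prop.
Proof.
move=> ij ik jk ki kj ji jk' ij' ik' ind R c10 c20 c30.
have uE := basis5_unit ind; set E := basis5 _ _ _ _ _ in uE.
have Eb : r5 c1 c2 d3 d2 0 *m E = - c3 *: l k.
  rewrite r5_basis scale0r addr0; apply/eqP; rewrite scaleNr -addr_eq0 -R; apply/eqP/rowP => h.
  by rewrite !mxE; ring.
have F2 : e2 *m E = mk by rewrite r5_basis !scale0r scale1r !(add0r, addr0).
have F3 : e3 *m E = mj by rewrite r5_basis !scale0r scale1r !(add0r, addr0).
have F4 : e4 *m E = mi by rewrite r5_basis !scale0r scale1r !(add0r, addr0).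
have F0 : e0 *m E = l i by rewrite r5_basis !scale0r scale1r !(add0r, addr0).
have F1 : e1 *m E = l j by rewrite r5_basis !scale0r scale1r !(add0r, addr0).
apply: (relation_core (d3 := d3) (d2 := d2) (smooth_transport uE SV) _ _ _ _ _ _ c10 c20);
  rewrite transport_wedge // ?F0 ?F1 ?F2 ?F3 ?F4 ?Eb.
1-4: exact: wV.
1-2: by rewrite wedgeZl scalemx_sub // wV.
Qed.

(** By [triple_good] the vector n, common to P i and P t, has nonzero components along mj and mk;
    the equations of V then make it proportional to l i + mj + mk. *)
Lemma fourth_line i j k t mi mj mk n :
  i != j -> i != k -> j != k -> i != t -> j != t -> k != t ->
  (mk <= P i)%MS -> (mk <= P j)%MS -> (mj <= P i)%MS -> (mj <= P k)%MS ->
  (mi <= P j)%MS -> (mi <= P k)%MS -> mk != 0 -> mj != 0 -> indep5 (l i) (l j) mk mj mi ->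
  l i + l j + l k + mi + mj + mk = 0 ->
  n != 0 -> (n <= P i)%MS -> (n <= P t)%MS ->
  ((l i + mj + mk)%R <= P t)%MS /\ exists a b c, l t = a *: l i + b *: mi + c *: (l i + mj + mk).
Proof.
move=> ij ik jk it jt kt ki kj ji jk' ij' ik' mk0 mj0 ind R n0 ni nt.
have uE := basis5_unit ind; set E := basis5 _ _ _ _ _ in uE.
have ti : t != i by rewrite eq_sym.
have fP h : row_free (P h) by rewrite /row_free (rankP lineL).
have i3 : indep3 (l i) mk mj.
  move=> a b c E0; have [] := ind a 0 b c 0; last by move=> -> _ [-> ->].
  by rewrite !scale0r !addr0.
have /sub_col3P[x [z [y En]]] : (n <= col_mx (l i) (col_mx mk mj))%MS.
  by rewrite -(plane_span (fP i) (lP lineL i) ki ji i3).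
have y0 : y != 0.
  apply: contraNneq (triple_good SV lineL disjL ij it jt ik jk (_ : t != k) mk0 ki kj n0 ni nt); last by rewrite eq_sym.
  by move=> y0; apply/sub_col2P; exists x, z; rewrite En y0 scale0r addr0.
have z0 : z != 0.
  apply: contraNneq (triple_good SV lineL disjL ik it kt ij (_ : k != j) (_ : t != j) mj0 ji jk' n0 ni nt); rewrite 1?eq_sym //.
  by move=> z0; apply/sub_col2P; exists x, y; rewrite En z0 scale0r addr0.
have [u0 [u1 [u2 [u3 [u4 Eu]]]]] : exists u0 u1 u2 u3 u4 : K, l t = r5 u0 u1 u2 u3 u4 *m E.
  by rewrite -(mulmxKV uE (l t)) (r5_eta (l t *m invmx E)); do 5 eexists.
have En' : n = r5 x 0 z y 0 *m E by rewrite r5_basis !scale0r !addr0.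
have Ek : r5 (-1) (-1) (-1) (-1) (-1) *m E = l k.
  rewrite r5_basis !scaleN1r; apply/eqP; rewrite eq_sym -subr_eq0 -R; apply/eqP/rowP => h.
  by rewrite !mxE; ring.
have [fV' _] := smooth_transport uE SV.
have nu : ~ (u1 = 0 /\ u4 = 0).
  move=> [u10 u40]; case/negP: (center_notinP SV lineL disjL ti); rewrite Eu u10 u40 r5_basis !scale0r !addr0.
  by rewrite !addmx_sub // scalemx_sub // (lP lineL).
have [xz yz u10 u23] : [/\ x = z, y = z, u1 = 0 & u2 = u3].
  apply: (fourth_core (u0 := u0) (u3 := u3) fV' _ _ _ _ _ _ _ y0 z0 nu); rewrite transport_wedge // -?Eu -?En' ?Ek; try exact: wV.
  1-6: by rewrite ?r5_basis !scale0r !scale1r !(add0r, addr0) wV.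
have En2 : n = z *: (l i + mj + mk) by rewrite En xz yz !scalerDr addrAC.
split; first by apply: (scaled_in_sub z0); rewrite -En2.
exists (u0 - u2), u4, u2; rewrite Eu r5_basis u10 -u23; apply/rowP => h; rewrite !mxE; ring.
Qed.

End NormalForm.

Section FrameExists.
Variable K : numFieldType.

Lemma coord5 (x y : 'rV[K]_5) (k : 'I_5) : x = y -> x 0 k = y 0 k.
Proof. by move=> ->. Qed.

Lemma std_indep3 i : indep3 (bstd K i) (n1std K i) (n2std K i).
Proof.
move=> x y z; ord4 i; rewrite /bstd /n1std /n2std /= => E.
- by have := coord5 (o5 0) E; have := coord5 (o5 3) E; have := coord5 (o5 2) E; rewrite !mxE /= => h2 h3 h0;
    split; [apply: (lin1 (a := 1) h0) | apply: (lin1 (a := 1) h3) | apply: (lin1 (a := 1) h2)]; ring.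
- by have := coord5 (o5 1) E; have := coord5 (o5 4) E; have := coord5 (o5 2) E; rewrite !mxE /= => h2 h3 h0;
    split; [apply: (lin1 (a := 1) h0) | apply: (lin1 (a := 1) h3) | apply: (lin1 (a := 1) h2)]; ring.
- have := coord5 (o5 0) E; have := coord5 (o5 4) E; have := coord5 (o5 3) E; rewrite !mxE /= => h2 h3 h0.
  by split; [apply: (lin_eq3 (a := -1) (b := 0) (c := 0) h0 h0 h0) | apply: (lin_eq3 (a := 1) (b := -1) (c := 0) h3 h0 h0)
     | apply: (lin_eq3 (a := 1) (b := -1) (c := 0) h2 h0 h0)]; ring.
have := coord5 (o5 0) E; have := coord5 (o5 1) E; have := coord5 (o5 2) E; rewrite !mxE /= => h2 h1 h0.
by split; [apply: (lin_eq3 (a := 1) (b := -1) (c := -1) h2 h1 h0) | apply: (lin_eq3 (a := 1) (b := 0) (c := 0) h0 h0 h0)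
     | apply: (lin_eq3 (a := 1) (b := 0) (c := 0) h1 h1 h1)]; ring.
Qed.

Lemma indep3_mulmx (x y z : 'rV[K]_5) E : E \in unitmx -> indep3 x y z ->
  indep3 (x *m E) (y *m E) (z *m E).
Proof.
move=> uE H a b c E0; apply: H; have : (a *: x + b *: y + c *: z) *m E = 0 by rewrite !mulmxDl -!scalemxAl.
by move/(congr1 (mulmx^~ (invmx E))); rewrite mulmxK // mul0mx.
Qed.

Lemma line_scale V (l : 'rV[K]_5) P L c : c != 0 -> line V l P L -> line V (c *: l) P L.
Proof.
move=> c0 [fP lP l0 fL wL]; split=> // [||y yP]; first exact: scalemx_sub.
  by rewrite scaler_eq0 negb_or c0.
by rewrite wedgeZl scalemx_sub // wL.
Qed.

Variables (V : 'M[K]_(6, 10)) (l : 'I_4 -> 'rV[K]_5) (P : 'I_4 -> 'M[K]_(3, 5)) (L : 'I_4 -> 'M[K]_(2, 10)).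
Hypothesis SV : smooth_section V.
Hypothesis lineL : forall i, line V (l i) (P i) (L i).
Hypothesis disjL : forall i j, i != j -> (L i :&: L j = 0)%MS.

Lemma frame_exists : exists E, is_frame L E.
Proof.
have cap := exists_cap lineL; have tg := triple_good SV lineL disjL.
have ic := indep2_center SV lineL disjL; have pind := pair_indep SV lineL disjL.
have [m2 [m20 m2_0 m2_1]] := cap (o4 0) (o4 1).
have [m1 [m10 m1_0 m1_2]] := cap (o4 0) (o4 2).
have [m0 [m00 m0_1 m0_2]] := cap (o4 1) (o4 2).
have sw (a b c : 'rV[K]_5) : indep3 a b c -> indep3 a c b.
  by move=> H x y z; rewrite addrAC => /H[-> -> ->].
have i021 : indep3 (l (o4 0)) m2 m1.
  apply: (indep3_notin (ic (o4 0) (o4 1) _ isT m20 m2_1)).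
  exact: (tg (o4 0) (o4 1) (o4 2) (o4 3) _ _ isT isT isT isT isT isT m20 m2_0 m2_1 m10 m1_0 m1_2).
have i120 : indep3 (l (o4 1)) m2 m0.
  apply: (indep3_notin (ic (o4 1) (o4 0) _ isT m20 m2_0)).
  exact: (tg (o4 1) (o4 0) (o4 2) (o4 3) _ _ isT isT isT isT isT isT m20 m2_1 m2_0 m00 m0_1 m0_2).
have i210 : indep3 (l (o4 2)) m1 m0.
  apply: (indep3_notin (ic (o4 2) (o4 0) _ isT m10 m1_0)).
  exact: (tg (o4 2) (o4 0) (o4 1) (o4 3) _ _ isT isT isT isT isT isT m10 m1_2 m1_0 m00 m0_2 m0_1).
have I01 := pind _ _ _ _ _ (isT : o4 0 != o4 1) m20 m2_0 m2_1 m1_0 m0_1 i021 i120.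
have I12 := pind _ _ _ _ _ (isT : o4 1 != o4 2) m00 m0_1 m0_2 m2_1 m1_2 (sw _ _ _ i120) (sw _ _ _ i210).
have I02 := pind _ _ _ _ _ (isT : o4 0 != o4 2) m10 m1_0 m1_2 m2_0 m0_2 (sw _ _ _ i021) i210.
have I10 := pind _ _ _ _ _ (isT : o4 1 != o4 0) m20 m2_1 m2_0 m0_1 m1_0 i120 i021.
have I20 := pind _ _ _ _ _ (isT : o4 2 != o4 0) m10 m1_2 m1_0 m0_2 m2_0 i210 (sw _ _ _ i021).
have uE0 := basis5_unit I01.
have [c0 [c1 [d2 [d1 [d0 Ec]]]]] : exists c0 c1 d2 d1 d0 : K, l (o4 2) =
    c0 *: l (o4 0) + c1 *: l (o4 1) + d2 *: m2 + d1 *: m1 + d0 *: m0.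
  rewrite -(mulmxKV uE0 (l (o4 2))) (r5_eta (l (o4 2) *m _)) r5_basis; by do 5 eexists.
have N1 : (-1 : K) != 0 by rewrite oppr_eq0 oner_neq0.
have c00 : c0 != 0.
  apply/eqP => c00; have [] := I12 c1 (-1) d0 d2 d1; last by move=> _ h; rewrite h eqxx in N1.
  by rewrite Ec c00; apply/rowP => h; rewrite !mxE; ring.
have c10 : c1 != 0.
  apply/eqP => c10; have [] := I02 c0 (-1) d1 d2 d0; last by move=> _ h; rewrite h eqxx in N1.
  by rewrite Ec c10; apply/rowP => h; rewrite !mxE; ring.
have d00 : d0 != 0.
  apply/eqP => d00.
  apply: (@no_short_relation _ _ _ _ _ SV lineL (o4 0) (o4 1) (o4 2) m0 m1 m2 c0 c1 (-1) d2 d1) => //.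
  by rewrite Ec d00; apply/rowP => h; rewrite !mxE; ring.
have d10 : d1 != 0.
  apply/eqP => d10.
  apply: (@no_short_relation _ _ _ _ _ SV lineL (o4 1) (o4 0) (o4 2) m1 m0 m2 c1 c0 (-1) d2 d0) => //.
  by rewrite Ec d10; apply/rowP => h; rewrite !mxE; ring.
have d20 : d2 != 0.
  apply/eqP => d20.
  apply: (@no_short_relation _ _ _ _ _ SV lineL (o4 2) (o4 0) (o4 1) m2 m0 m1 (-1) c0 c1 d1 d0) => //.
  by rewrite Ec d20; apply/rowP => h; rewrite !mxE; ring.
(* These factors turn [Ec] into a relation with all coefficients 1; the fourth center is normalized
   later, by [f]. *)
pose s (i : 'I_4) : K := nth 0 [:: c0; c1; -1; 1] i.
have s0 i : s i != 0 by ord4 i; rewrite /s //= oner_neq0.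
pose l' i := s i *: l i; pose M2 := d2 *: m2; pose M1 := d1 *: m1; pose M0 := d0 *: m0.
have lineL' i : line V (l' i) (P i) (L i) by apply: line_scale.
have sub_s (c : K) (m : 'rV[K]_5) i : (m <= P i)%MS -> (c *: m <= P i)%MS by apply: scalemx_sub.
have nz (c : K) (m : 'rV[K]_5) : c != 0 -> m != 0 -> c *: m != 0.
  by move=> x0 y0; rewrite scaler_eq0 negb_or x0.
have R : l' (o4 0) + l' (o4 1) + l' (o4 2) + M0 + M1 + M2 = 0.
  by rewrite /l' /s /= Ec /M0 /M1 /M2; apply/rowP => h; rewrite !mxE; ring.
have scale5 (a b c d e : K) v0 v1 v2 v3 v4 : a != 0 -> b != 0 -> c != 0 -> d != 0 -> e != 0 ->
    indep5 v0 v1 v2 v3 v4 -> indep5 (a *: v0) (b *: v1) (c *: v2) (d *: v3) (e *: v4).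
  move=> a0 b0 h0 g0 f0 H x0 x1 x2 x3 x4; rewrite !scalerA => /H[/eqP E0 /eqP E1 [/eqP E2 /eqP E3 /eqP E4]].
  move: E0 E1 E2 E3 E4; rewrite !mulf_eq0 (negPf a0) (negPf b0) (negPf h0) (negPf g0) (negPf f0) !orbF.
  by move=> /eqP -> /eqP -> /eqP -> /eqP -> /eqP ->.
have J01 : indep5 (l' (o4 0)) (l' (o4 1)) M2 M1 M0 by apply: scale5.
have J10 : indep5 (l' (o4 1)) (l' (o4 0)) M2 M0 M1 by apply: scale5.
have [n [n0 n_0 n_3]] := cap (o4 0) (o4 3).
have [n' [n'0 n'_1 n'_3]] := cap (o4 1) (o4 3).
have [N1P [a [b [c El]]]] := fourth_line SV lineL' disjL (isT : o4 0 != o4 1) (isT : o4 0 != o4 2)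
  (isT : o4 1 != o4 2) (isT : o4 0 != o4 3) (isT : o4 1 != o4 3) (isT : o4 2 != o4 3)
  (sub_s d2 _ _ m2_0) (sub_s d2 _ _ m2_1) (sub_s d1 _ _ m1_0) (sub_s d1 _ _ m1_2)
  (sub_s d0 _ _ m0_1) (sub_s d0 _ _ m0_2) (nz _ _ d20 m20) (nz _ _ d10 m10) J01 R n0 n_0 n_3.
have R' : l' (o4 1) + l' (o4 0) + l' (o4 2) + M1 + M0 + M2 = 0.
  by rewrite -R; apply/rowP => h; rewrite !mxE; ring.
have [N2P [a' [b' [c' El']]]] := fourth_line SV lineL' disjL (isT : o4 1 != o4 0) (isT : o4 1 != o4 2)
  (isT : o4 0 != o4 2) (isT : o4 1 != o4 3) (isT : o4 0 != o4 3) (isT : o4 2 != o4 3)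
  (sub_s d2 _ _ m2_1) (sub_s d2 _ _ m2_0) (sub_s d0 _ _ m0_1) (sub_s d0 _ _ m0_2)
  (sub_s d1 _ _ m1_0) (sub_s d1 _ _ m1_2) (nz _ _ d20 m20) (nz _ _ d00 m00) J10 R' n'0 n'_1 n'_3.
have uE := basis5_unit J01; set E := basis5 _ _ _ _ _ in uE.
have El3 : l' (o4 3) = c *: (M2 + M1 + M0).
  have [] := J01 (a + c) (- (a' + c')) (c - c') (c - b') (b - c').
    have := subrr (l' (o4 3)); rewrite {1}El El' => E0; rewrite -[RHS]E0.
    by apply/rowP => h; rewrite !mxE; ring.
  move=> h1 _ [h2 _ h3]; rewrite El; apply/eqP; rewrite -subr_eq0; apply/eqP/rowP => h; rewrite !mxE.
  have -> : b = c by apply/eqP; rewrite -subr_eq0; apply/eqP; apply: (lin4 (a := 1) (b := -1) (c := 0) (d := 0) h3 h2 h2 h2); ring.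
  by apply: (lin1 (a := l (o4 0) 0 h * c0) h1); rewrite ?mxE /l' /s /= ?mxE; ring.
have c_neq0 : c != 0.
  by apply: contraNneq (l_neq0 lineL' (o4 3)) => c_0; rewrite El3 c_0 scale0r.
pose f (i : 'I_4) : K := nth 0 [:: 1; 1; 1; c^-1] i.
have f0 i : f i != 0 by ord4 i; rewrite /f /= ?oner_eq0 ?invr_eq0.
have lineF i : line V (bstd K i *m E) (P i) (L i).
  suff <- : f i *: l' i = bstd K i *m E by apply: line_scale.
  ord4 i; rewrite /bstd /f [nth _ _ _]/= [nth _ [:: e0; _; _; _] _]/= r5_basis ?scale0r ?scale1r ?(add0r, addr0) //.
  - by rewrite !scaleN1r; apply/eqP; rewrite -subr_eq0 -R; apply/eqP/rowP => h; rewrite !mxE; ring.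
  - by rewrite El3 scalerA mulVf // scale1r.
have P1 i : (n1std K i *m E <= P i)%MS.
  ord4 i; rewrite /n1std [nth _ _ _]/= r5_basis ?scale0r ?scale1r ?(add0r, addr0); try exact: sub_s.
  by rewrite addrAC.
have P2 i : (n2std K i *m E <= P i)%MS.
  ord4 i; rewrite /n2std [nth _ _ _]/= r5_basis ?scale0r ?scale1r ?(add0r, addr0); try exact: sub_s.
  by rewrite addrAC.
exists E; split=> // i; rewrite Lstd_frame.
exact: line_span (lineF i) (P1 i) (P2 i) (indep3_mulmx uE (@std_indep3 i)).
Qed.

End FrameExists.

(** * Permutations of the four lines *)

Section LineData.
Variable K : numFieldType.
Implicit Types (V : 'M[K]_(6, 10)) (l m n u v w y : 'rV[K]_5) (P : 'M[K]_(3, 5)) (L M : 'M[K]_(2, 10)).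

Lemma wedge_through u v l : (l <= col_mx u v)%MS -> l != 0 ->
  exists m, wedge l m = wedge u v.
Proof.
move=> /sub_col2P[a [b ->]] ab0; have [a0|a0] := eqVneq a 0; last first.
  exists (a^-1 *: v); rewrite wedgeDl !wedgeZl !wedgeZr wedgexx !scaler0 addr0.
  by rewrite scalerA divff ?scale1r.
have b0 : b != 0 by apply: contraNneq ab0 => ->; rewrite a0 !scale0r addr0.
exists (- b^-1 *: u); rewrite a0 scale0r add0r wedgeZl wedgeZr scalerA mulrN divff // scaleN1r.
by rewrite -wedgeC.
Qed.

(** The sum is a bivector of rank 4: in the basis formed by the five vectors, one of the Plucker
    relations takes the value 1 on it. *)
Lemma indep5_sum_not_wedge u v w y t (x z : 'rV[K]_5) : indep5 u v w y t ->
  wedge u v + wedge w y <> wedge x z.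
Proof.
move=> ind E; have uE := basis5_unit ind; set B := basis5 _ _ _ _ _ in uE.
have /(congr1 (mulmx^~ (wedge_mx (invmx B)))) := E.
rewrite mulmxDl -!wedge_mulmx.
have -> : u = r5 1 0 0 0 0 *m B by rewrite r5_basis !scale0r scale1r !addr0.
have -> : v = r5 0 1 0 0 0 *m B by rewrite r5_basis !scale0r scale1r !addr0 add0r.
have -> : w = r5 0 0 1 0 0 *m B by rewrite r5_basis !scale0r scale1r !addr0 !add0r.
have -> : y = r5 0 0 0 1 0 *m B by rewrite r5_basis !scale0r scale1r !addr0 !add0r.
rewrite !mulmxK // => H.
have [_ _ _ H' _] := wedge_plucker_rel (x *m invmx B) (z *m invmx B); move: H'; rewrite -H !mxE /= => H'.
by have /eqP := @oner_neq0 K; apply; rewrite -H'; ring.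
Qed.

Lemma indep3_row_free (x y z : 'rV[K]_5) : indep3 x y z -> row_free (col_mx x (col_mx y z)).
Proof.
move=> ind; have yz : indep2 y z by move=> i j E; have [] := ind 0 i j; rewrite // scale0r add0r.
rewrite row_free_col1 /row_free indep2_rank // eqxx /=; apply/negP => /sub_col2P[i [j E]].
have [] := ind (-1) i j; first by rewrite E scaleN1r -addrA addNr.
by move=> /eqP; rewrite oppr_eq0 oner_eq0.
Qed.

(** Two points a ^ b and c ^ d span the line. Since their sum is decomposable, the two pencils share
    a form, which is the center. *)
Lemma line_form V M : row_free M -> (M <= V)%MS ->
  (forall p, p != 0 -> (p <= M)%MS -> grassmannian p) -> exists l P, line V l P M.
Proof.
move=> fM MV gM.
have [p [q EM]] : exists p q : 'rV_10, M = col_mx p q.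
  by exists (usubmx (M : 'M_(1 + 1, 10))), (dsubmx (M : 'M_(1 + 1, 10))); rewrite vsubmxK.
have pq c d : c *: p + d *: q = 0 -> c = 0 /\ d = 0.
  move=> E; move: fM; rewrite EM row_free_col1 row_free_row => /andP[q0 np].
  have c0 : c = 0.
    apply: contraNeq np => c0; apply/sub_rVP; exists (- c^-1 * d); apply: (scalerI c0).
    rewrite scalerA mulrA mulrN divff // mulN1r scaleNr; apply/eqP; by rewrite -subr_eq0 opprK E.
  split=> //; move: E; rewrite c0 scale0r add0r => /eqP; rewrite scaler_eq0 (negPf q0) orbF.
  by move/eqP.
have nz c d : ~ (c = 0 /\ d = 0) -> c *: p + d *: q != 0 by move=> H; apply/eqP => /pq.
have subM c d : ((c *: p + d *: q)%R <= M)%MS.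
  apply: addmx_sub; apply: scalemx_sub; rewrite EM.
    exact: sub_col_mx_l.
  exact: (@sub_col_mx_r _ 1 1).
have N1 : (1 : K) <> 0 by apply/eqP; rewrite oner_eq0.
have [a [b [ab0 Ep]]] : exists a b, wedge a b != 0 /\ p = wedge a b.
  have := gM _ (nz 1 0 _) (subM 1 0); rewrite scale1r scale0r addr0 => H.
  by apply/grassmannianP/H => -[].
have [c [d [cd0 Eq]]] : exists c d, wedge c d != 0 /\ q = wedge c d.
  have := gM _ (nz 0 1 _) (subM 0 1); rewrite scale1r scale0r add0r => H.
  by apply/grassmannianP/H => -[].
have [x [y [xy0 Exy]]] : exists x y, wedge x y != 0 /\ p + q = wedge x y.
  have := gM _ (nz 1 1 _) (subM 1 1); rewrite !scale1r => H.
  by apply/grassmannianP/H => -[].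
have fab := row_free_wedge a b; have fcd := row_free_wedge c d.
move: fab fcd; rewrite ab0 cd0 => fab fcd.
have [cap|] := eqVneq (col_mx a b :&: col_mx c d)%MS 0.
  have [e _ ne] : exists2 e : 'rV[K]_5, (e <= (1%:M : 'M_5))%MS & ~~ (e <= col_mx a b + col_mx c d)%MS.
    apply: exists_notin_sub; rewrite mxrank1; apply: leq_ltn_trans (mxrank_adds_leqif _ _) _.
    by move/eqP: fab => ->; move/eqP: fcd => ->.
  case: (@indep5_sum_not_wedge a b c d e x y); last by rewrite -Ep -Eq.
  move=> x0 x1 x2 x3 x4 E.
  have x40 : x4 = 0.
    apply: contraNeq ne => x40; apply: (scaled_in_sub x40).
    have -> : x4 *: e = (- x0 *: a - x1 *: b) + (- x2 *: c - x3 *: d).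
      apply/eqP; rewrite -subr_eq0 -E; apply/eqP/rowP => h; rewrite !mxE; ring.
    rewrite -!scaleNr; apply: addmx_sub_adds; apply/sub_col2P; by do 2 eexists.
  have E' : x0 *: a + x1 *: b = - x2 *: c + - x3 *: d.
    by apply/eqP; rewrite -subr_eq0 -E x40; apply/eqP/rowP => h; rewrite !mxE; ring.
  have z : x0 *: a + x1 *: b = 0.
    by apply: (cap0 cap); [|rewrite E']; apply/sub_col2P; do 2 eexists.
  have [-> ->] := row_free2P _ _ fab _ _ z.
  have /(row_free2P _ _ fcd)[/eqP + /eqP] : - x2 *: c + - x3 *: d = 0 by rewrite -E'.
  by rewrite !oppr_eq0 => /eqP -> /eqP ->.
case/rowV0Pn => l; rewrite sub_capmx => /andP[lab lcd] l0.
have [m Em] := wedge_through lab l0; have [n En] := wedge_through lcd l0.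
have ind : indep3 l m n.
  move=> i j k E; have := congr1 (wedge l) E.
  rewrite !wedgeDr !wedgeZr wedgexx scaler0 add0r Em En -Ep -Eq -(scale0r 0) wedgeZr scale0r.
  case/pq => j0 k0; split=> //; move: E; rewrite j0 k0 !scale0r !addr0 => /eqP.
  by rewrite scaler_eq0 (negPf l0) orbF => /eqP.
have fP := indep3_row_free ind.
exists l, (col_mx l (col_mx m n)); split=> //; first exact: sub_col_mx_l.
move=> z /sub_col3P[i [j [k ->]]]; rewrite !wedgeDr !wedgeZr wedgexx scaler0 add0r Em En -Ep -Eq.
exact: subM.
Qed.

Lemma sub_line V l P L p : line V l P L -> (p <= L)%MS -> exists2 y, (y <= P)%MS & p = wedge l y.
Proof.
move=> H; have [fP lP l0 _ _] := H; have [m [n [mP nP ind]]] := line_basis fP l0.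
rewrite (line_span H mP nP ind) => /sub_col2P[c [d ->]]; exists (c *: m + d *: n).
  by rewrite addmx_sub // scalemx_sub.
by rewrite wedgeDr !wedgeZr.
Qed.

(** The center is the only form, up to scalars, common to the pencils of all points of the line; the
    3-space then consists of the y with l ^ y on the line. *)
Lemma line_unique V V' l P L l' P' L' : line V l P L -> line V' l' P' L' -> (L :=: L')%MS ->
  (l' <= l)%MS /\ (P' :=: P)%MS.
Proof.
move=> H H' E; have [fP lP l0 [fL LV] w] := H; have [fP' lP' l0' [fL' LV'] w'] := H'.
have ll : (l' <= l)%MS.
  have [m [n [mP nP ind]]] := line_basis fP l0.
  have in_span y : (y <= P)%MS -> wedge l y != 0 -> (l' <= col_mx l y)%MS.
    move=> yP ly0; have := w _ yP; rewrite E => /(sub_line H')[z zP Ez].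
    exact: (wedge_inj ly0 (esym Ez)).
  have [m0 n0] := indep2_neq0 (wedge_indep ind).
  have /sub_col2P[a [b Ea]] := in_span _ mP m0; have /sub_col2P[c [d Ec]] := in_span _ nP n0.
  have [_ b0 _] : [/\ a - c = 0, b = 0 & - d = 0].
    by apply: ind; have := subrr l'; rewrite {1}Ea Ec => <-; apply/rowP => h; rewrite !mxE; ring.
  by rewrite Ea b0 scale0r addr0 scalemx_sub.
split=> //; have [c Ec] := sub_rVP ll.
have c0 : c != 0 by apply: contraNneq l0' => c0; rewrite Ec c0 scale0r.
apply: eqmx_of_rank; last by rewrite (eqP fP) (eqP fP').
apply/row_subP => i; set y := row i P'.
have := w' y (row_sub _ _); rewrite -E => /(sub_line H)[z zP]; rewrite Ec wedgeZl -wedgeZr => Ez.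
have /(wedge_eq0 l0) D : wedge l (c *: y - z) = 0.
  by rewrite wedgeDr Ez -scaleN1r wedgeZr scaleN1r subrr.
apply: (scaled_in_sub c0); rewrite -(subrK z (c *: y)) addmx_sub //.
exact: submx_trans D lP.
Qed.

Lemma line_mulmx V l P L h : h \in unitmx -> line V l P L ->
  line (V *m wedge_mx h) (l *m h) (P *m h) (L *m wedge_mx h).
Proof.
move=> uh [fP lP l0 [fL LV] w]; have uW := wedge_mx_unit uh.
split; rewrite ?submxMr //.
- by rewrite /row_free mxrankMfree ?row_free_unit.
- by apply: contraNneq l0 => E; rewrite -(mulmxK uh l) E mul0mx.
- by split=> //; rewrite /row_free mxrankMfree ?row_free_unit.
move=> y /submxP[x ->]; rewrite mulmxA wedge_mulmx submxMr // w //.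
exact: submxMl.
Qed.

End LineData.

(** * Linear maps that permute the lines *)

Section Induces.
Variable K : numFieldType.
Implicit Types (h E : 'M[K]_5) (s : 'S_4) (i : 'I_4).

Definition Pstd i : 'M[K]_(1 + (1 + 1), 5) := col_mx (bstd K i) (col_mx (n1std K i) (n2std K i)).

Definition induces (L : 'I_4 -> 'M[K]_(2, 10)) h s :=
  h \in unitmx /\ forall i, (L i *m wedge_mx h :=: L (s i))%MS.

Lemma sum_ord4 (U : zmodType) (F : 'I_4 -> U) :
  \sum_i F i = F (o4 0) + F (o4 1) + F (o4 2) + F (o4 3).
Proof.
rewrite !big_ord_recl big_ord0 addr0 !addrA.
by congr (F _ + F _ + F _ + F _); apply: val_inj.
Qed.

Lemma sum_bstd : \sum_i bstd K i = 0.
Proof. by rewrite sum_ord4; apply/rowP => k; ord5 k; rewrite !mxE /=; ring. Qed.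

Lemma bstd_relation (a : 'I_4 -> K) : \sum_i a i *: bstd K i = 0 -> forall i, a i = a (o4 3).
Proof.
rewrite sum_ord4 => E.
have := coord5 (o5 2) E; have := coord5 (o5 0) E; have := coord5 (o5 1) E; rewrite !mxE /= => h1 h0 h2.
move=> i; apply/eqP; rewrite -subr_eq0; apply/eqP; ord4 i.
- by apply: (lin_eq3 (a := 1) (b := -1) (c := 0) h0 h2 h2); ring.
- by apply: (lin_eq3 (a := 1) (b := -1) (c := 0) h1 h2 h2); ring.
- by apply: (lin_eq3 (a := -1) (b := 0) (c := 0) h2 h2 h2); ring.
by rewrite subrr.
Qed.

Variables (V : 'M[K]_(6, 10)) (L : 'I_4 -> 'M[K]_(2, 10)).
Hypothesis fV : row_free V.
Hypothesis LV : forall i, (L i <= V)%MS.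

Lemma frame_line E i : is_frame L E -> row_free (L i) -> line V (bstd K i *m E) (Pstd i *m E) (L i).
Proof.
move=> [uE fE] fL; have ind := @std_indep3 K i; have fP := indep3_row_free ind.
split=> //.
- by rewrite /row_free mxrankMfree ?row_free_unit.
- by rewrite submxMr // sub_col_mx_l.
- apply/negP => /eqP b0; have H := indep3_mulmx uE ind; have [] := H 1 0 0.
    by rewrite b0 !scale0r scaler0 !addr0.
  by move=> /eqP; rewrite oner_eq0.
move=> y /submxP[c ->]; rewrite mulmxA wedge_mulmx fE submxMr //.
have /sub_col3P[p [q [r ->]]] : (c *m Pstd i <= Pstd i)%MS by exact: submxMl.
rewrite !wedgeDr !wedgeZr wedgexx scaler0 add0r.
by apply/sub_col2P; exists q, r.
Qed.

Lemma frame_sub E (w : 'rV[K]_10) : is_frame L E -> (w <= V)%MS ->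
  (w <= L (o4 0) + L (o4 1) + L (o4 2))%MS.
Proof.
move=> [uE fE] wV.
have sub i c d : ((c *: wedge (bstd K i) (n1std K i) + d *: wedge (bstd K i) (n2std K i))%R *m wedge_mx E <= L i)%MS.
  by rewrite fE submxMr //; apply/sub_col2P; exists c, d.
have subV i c d : ((c *: wedge (bstd K i) (n1std K i) + d *: wedge (bstd K i) (n2std K i))%R <= transport V E)%MS.
  by rewrite transport_sub // (submx_trans (sub i c d)).
have n1V i : (wedge (bstd K i) (n1std K i) <= transport V E)%MS.
  by have := subV i 1 0; rewrite scale1r scale0r addr0.
have n2V i : (wedge (bstd K i) (n2std K i) <= transport V E)%MS.
  by have := subV i 0 1; rewrite scale1r scale0r add0r.
have fT : row_free (transport V E).
  by rewrite /row_free mxrankMfree // row_free_unit wedge_mx_unit ?unitmx_inv.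
have wT : (w *m wedge_mx (invmx E) <= transport V E)%MS by rewrite submxMr.
have [x1 [x2 [x3 [x4 [x5 [x6 Ew]]]]]] := standard_span fT (n1V (o4 0)) (n2V (o4 0)) (n2V (o4 1)) (n1V (o4 1))
  (n2V (o4 2)) (n1V (o4 2)) wT.
have -> : w = (x1 *: wedge (bstd K (o4 0)) (n1std K (o4 0)) + x2 *: wedge (bstd K (o4 0)) (n2std K (o4 0))) *m wedge_mx E
   + (x4 *: wedge (bstd K (o4 1)) (n1std K (o4 1)) + x3 *: wedge (bstd K (o4 1)) (n2std K (o4 1))) *m wedge_mx E
   + (x6 *: wedge (bstd K (o4 2)) (n1std K (o4 2)) + x5 *: wedge (bstd K (o4 2)) (n2std K (o4 2))) *m wedge_mx E.
  rewrite -!mulmxDl -[LHS](mulmxKV (wedge_mx_unit uE)) -wedge_mxV // Ew; congr (_ *m _).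
  by apply/rowP => k; rewrite !mxE; ring.
by rewrite !addmx_sub_adds.
Qed.

(** V is spanned by the first three lines, so a map that permutes the lines preserves it. *)
Lemma induces_V E h s : is_frame L E -> induces L h s -> (V *m wedge_mx h :=: V)%MS.
Proof.
move=> fE [uh Lh]; have uW := wedge_mx_unit uh; apply: eqmx_of_rank; last by rewrite mxrankMfree ?row_free_unit.
have VL : (V <= L (o4 0) + L (o4 1) + L (o4 2))%MS by apply/row_subP => i; apply: (frame_sub fE); exact: row_sub.
apply: submx_trans (submxMr _ VL) _; rewrite addsmxMr addsmx_sub addsmxMr addsmx_sub !Lh.
by rewrite !LV.
Qed.

Hypothesis fL : forall i, row_free (L i).

(** Each center is multiplied by its own scalar; the scalars coincide because h carries the relation
    among the centers to a relation, and there is only one up to a factor. *)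
Lemma induces_center E h s : is_frame L E -> induces L h s ->
  exists2 c : K, c != 0 & forall i, bstd K i *m E *m h = c *: (bstd K (s i) *m E).
Proof.
move=> fE [uh Lh]; have [uE _] := fE.
have /fin_all_exists[c Ec] i : exists c : K, bstd K i *m E *m h = c *: (bstd K (s i) *m E).
  apply/sub_rVP.
  by have [] := line_unique (frame_line fE (fL (s i))) (line_mulmx uh (frame_line fE (fL i))) (eqmx_sym (Lh i)).
have Ec' i : c i = c (s^-1 (o4 3))%g.
  have := @bstd_relation (fun j => c (s^-1 j)%g) _ (s i); rewrite permK; apply.
  rewrite (reindex_inj (@perm_inj _ s)) /=; under eq_bigr => j _ do rewrite permK.
  have : (\sum_i bstd K i) *m E *m h = 0 by rewrite sum_bstd !mul0mx.
  rewrite !mulmx_suml (eq_bigr _ (fun i _ => Ec i)) => H.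
  rewrite -(mulmxK uE (\sum__ _)) mulmx_suml.
  by under eq_bigr => j _ do rewrite -scalemxAl; rewrite H mul0mx.
exists (c (s^-1 (o4 3)))%g => [|i]; last by rewrite Ec Ec'.
apply/negP => /eqP c0; have := Ec (o4 0); rewrite Ec' c0 scale0r => E0.
have [_ _ /negP + _ _] := line_mulmx uh (frame_line fE (fL (o4 0))).
by rewrite E0 eqxx.
Qed.

(** In the frame, e2, e3, e4 span the pairwise intersections of the first three 3-spaces, so they
    are eigenvectors, as are e0, e1 and the third center. The latter involves all five basis
    vectors, which equates the eigenvalues. *)
Lemma induces1_scalar E h : is_frame L E -> induces L h 1 -> exists2 c, c != 0 & h = c%:M.
Proof.
move=> fE [uh Lh]; have [uE _] := fE.
pose g := E *m h *m invmx E.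
have Eg m (A : 'M_(m, 5)) : A *m g *m E = A *m E *m h by rewrite /g -!mulmxA mulVmx // mulmx1 !mulmxA.
have L1 i : (L i *m wedge_mx h :=: L i)%MS by have := Lh i; rewrite perm1.
have LE i := line_unique (frame_line fE (fL i)) (line_mulmx uh (frame_line fE (fL i))) (eqmx_sym (L1 i)).
have fullE : row_free E by rewrite row_free_unit.
have bg i : (bstd K i *m g <= bstd K i)%MS by rewrite -(submxMfree _ _ fullE) Eg; case: (LE i).
have Pg i (x : 'rV[K]_5) : (x <= Pstd i)%MS -> (x *m g <= Pstd i)%MS.
  move=> xP; apply: submx_trans (submxMr _ xP) _.
  by rewrite -(submxMfree _ _ fullE) Eg; case: (LE i) => _ ->.
have b_in i : (bstd K i <= Pstd i)%MS by apply/sub_col3P; exists 1, 0, 0; rewrite scale1r !scale0r !addr0.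
have n1_in i : (n1std K i <= Pstd i)%MS by apply/sub_col3P; exists 0, 1, 0; rewrite scale1r !scale0r !addr0 add0r.
have n2_in i : (n2std K i <= Pstd i)%MS by apply/sub_col3P; exists 0, 0, 1; rewrite scale1r !scale0r !add0r.
have [c0 E0] := sub_rVP (bg (o4 0)); have [c1 E1] := sub_rVP (bg (o4 1)).
have [c2 E2] := sub_rVP (bg (o4 2)).
have /sub_col3P[x0 [x3 [x2 X2]]] := Pg (o4 0) _ (n2_in (o4 0)).
have /sub_col3P[y1 [y4 [y2 Y2]]] := Pg (o4 1) _ (n2_in (o4 1)).
have /sub_col3P[u0 [u3 [u2 U3]]] := Pg (o4 0) _ (n1_in (o4 0)).
have /sub_col3P[v1 [v4 [v3 V3]]] := Pg (o4 2) _ (n2_in (o4 2)).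
have /sub_col3P[z1 [z4 [z2 Z4]]] := Pg (o4 1) _ (n1_in (o4 1)).
have /sub_col3P[t1 [t4 [t3 T4]]] := Pg (o4 2) _ (n1_in (o4 2)).
move: E0 E1 E2 X2 Y2 U3 V3 Z4 T4.
rewrite /bstd /n1std /n2std /= => E0 E1 E2 X2 Y2 U3 V3 Z4 T4.
move: (X2) (U3) (Z4); rewrite {1}Y2 {1}V3 {1}T4 => X Y Z.
have F2 : e2 *m g = x2 *: e2.
  have := coord5 (o5 0) X; have := coord5 (o5 3) X; rewrite !mxE /= !(mulr0, addr0, add0r, mulr1) => h3 h0.
  by rewrite X2 -h3 -h0 !scale0r !add0r.
have F3 : e3 *m g = u3 *: e3.
  have := coord5 (o5 1) Y; have := coord5 (o5 0) Y; have := coord5 (o5 2) Y.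
  rewrite !mxE /= !(mulr0, addr0, add0r, mulr1, mulrN) => h2 h0 h1.
  by rewrite U3 -h0 -h2 h1 !scale0r !(add0r, addr0).
have F4 : e4 *m g = z4 *: e4.
  have := coord5 (o5 0) Z; have := coord5 (o5 1) Z; have := coord5 (o5 2) Z.
  rewrite !mxE /= !(mulr0, addr0, add0r, mulr1, mulrN) => h2 h1 h0.
  by rewrite Z4 -h1 -h2 h0 !scale0r !(add0r, addr0).
have sumE : r5 (-1) (-1) (-1) (-1) (-1) = - e0 - e1 - e2 - e3 - e4 :> 'rV[K]_5.
  by apply/rowP => k; ord5 k; rewrite !mxE /=; ring.
move: E2; rewrite {1}sumE !mulmxBl mulNmx E0 E1 F2 F3 F4 => E2.
have k0 := coord5 (o5 0) E2; have k1 := coord5 (o5 1) E2; have k2 := coord5 (o5 2) E2.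
have k3 := coord5 (o5 3) E2; have k4 := coord5 (o5 4) E2.
move: k0 k1 k2 k3 k4; rewrite !mxE /= !(mulr0, oppr0, addr0, add0r, mulr1, mulrN1, sub0r).
move=> /oppr_inj k0 /oppr_inj k1 /oppr_inj k2 /oppr_inj k3 /oppr_inj k4.
have gE : g = c2%:M.
  apply/row_matrixP => k.
  have eD (j : 'I_5) : 'e_j = r5 (j == o5 0)%:R (j == o5 1)%:R (j == o5 2)%:R (j == o5 3)%:R (j == o5 4)%:R :> 'rV[K]_5.
    by rewrite [LHS]r5_eta !mxE /= !(eq_sym _ j).
  rewrite !rowE !mul_mx_scalar !eD; ord5 k; rewrite /=.
  - by rewrite E0 k0.
  - by rewrite E1 k1.
  - by rewrite F2 k2.
  - by rewrite F3 k3.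
  by rewrite F4 k4.
have hE : h = c2%:M.
  have : invmx E *m g *m E = h by rewrite Eg mulVmx // mul1mx.
  by rewrite gE mul_mx_scalar -scalemxAl mulVmx // scalemx1 => <-.
exists c2 => //; apply: contraTneq uh => c20; rewrite hE c20 -scalemx1 scale0r unitmxE det0.
by rewrite unitr0.
Qed.

Lemma induces_mul h h' s t : induces L h s -> induces L h' t -> induces L (h *m h') (s * t)%g.
Proof.
move=> [uh Lh] [uh' Lh']; split=> [|i]; first by rewrite unitmx_mul uh uh'.
rewrite wedge_mxM mulmxA permM; apply: eqmx_trans (Lh' (s i)); exact: eqmxMr.
Qed.

Lemma induces_inv h s : induces L h s -> induces L (invmx h) s^-1%g.
Proof.
move=> [uh Lh]; split=> [|i]; first by rewrite unitmx_inv.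
have /eqmx_sym H := Lh ((s^-1)%g i); rewrite permKV in H.
apply: (eqmx_trans (eqmxMr (wedge_mx (invmx h)) H)).
by rewrite wedge_mxV // mulmxK ?wedge_mx_unit.
Qed.

Lemma induces_unique E h h' s : is_frame L E -> induces L h s -> induces L h' s ->
  exists2 c : K, c != 0 & h' = c *: h.
Proof.
move=> fE H H'; have [uh _] := H; have := induces_mul H' (induces_inv H); rewrite mulgV.
case/(induces1_scalar fE) => c c0 Ec; exists c => //.
by rewrite -(mulmxKV uh h') Ec mul_scalar_mx.
Qed.

(** The normal form does not see the ordering: comparing a frame of the lines with one of the
    relabelled lines realizes the permutation. *)
Lemma induces_exists E E' s : is_frame L E -> is_frame (L \o s) E' ->
  induces L (invmx E *m E') s.
Proof.
move=> [uE fE] [uE' fE']; split=> [|i]; first by rewrite unitmx_mul unitmx_inv uE.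
apply: eqmx_trans (eqmx_sym (fE' i)); rewrite wedge_mxM mulmxA; apply: eqmxMr.
apply: (eqmx_trans (eqmxMr _ (fE i))); by rewrite wedge_mxV // mulmxK ?wedge_mx_unit.
Qed.

End Induces.

(** * Sections on the universal plane *)

Section Bihomog.
Variable K : fieldType.
Implicit Types (F G : {mpoly K[5 + 10]}) (a b : nat).

Lemma bihomog0 a b : bihomog a b (0 : {mpoly K[5 + 10]}).
Proof. by move=> m; rewrite msupp0. Qed.

Lemma bihomog1 : bihomog 0 0 (1 : {mpoly K[5 + 10]}).
Proof.
move=> m; rewrite msupp1 inE => /eqP ->.
by split; apply: big1 => i _; rewrite mnm0E.
Qed.

Lemma bihomogD a b F G : bihomog a b F -> bihomog a b G -> bihomog a b (F + G).
Proof.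
move=> HF HG m /msuppD_le; rewrite mem_cat => /orP[]; [exact: HF | exact: HG].
Qed.

Lemma bihomogZ a b c F : bihomog a b F -> bihomog a b (c *: F).
Proof. by move=> HF m /msuppZ_le; exact: HF. Qed.

Lemma bihomogM a b c d F G : bihomog a b F -> bihomog c d G -> bihomog (a + c) (b + d) (F * G).
Proof.
move=> HF HG m /msuppM_le /allpairsP[[m1 m2] /= [/HF[<- <-] /HG[<- <-] ->]].
by rewrite -!big_split; split; apply: eq_bigr => i _; rewrite mnmDE.
Qed.

Lemma bihomogX a b k F : bihomog a b F -> bihomog (a * k) (b * k) (F ^+ k).
Proof.
move=> HF; elim: k => [|k IH]; first by rewrite !muln0 expr0; exact: bihomog1.
by rewrite exprS !mulnS; apply: bihomogM.
Qed.

Lemma bihomog_sum (I : Type) (r : seq I) (Q : pred I) (f : I -> {mpoly K[5 + 10]}) a b :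
  (forall i, Q i -> bihomog a b (f i)) -> bihomog a b (\sum_(i <- r | Q i) f i).
Proof.
by move=> H; apply: (big_ind (bihomog a b)) => //; [exact: bihomog0 | exact: bihomogD].
Qed.

Lemma bihomog_prod (n : nat) (f : 'I_n -> {mpoly K[5 + 10]}) (a b : 'I_n -> nat) :
  (forall i, bihomog (a i) (b i) (f i)) ->
  bihomog (\sum_i a i) (\sum_i b i) (\prod_i f i).
Proof.
move=> H; apply: (big_ind3 (fun x y z => bihomog x y z)) => //; first exact: bihomog1.
by move=> *; apply: bihomogM.
Qed.

Lemma bihomog_Xl (i : 'I_5) : bihomog 1 0 ('X_(lshift 10 i) : {mpoly K[5 + 10]}).
Proof.
move=> m; rewrite msuppX inE => /eqP ->; split.
  rewrite (bigD1 i) //= mnm1E eqxx big1 ?addn0 // => j ji.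
  by rewrite mnm1E (inj_eq (@lshift_inj _ _)) eq_sym (negPf ji).
by apply: big1 => j _; rewrite mnm1E eq_lrshift.
Qed.

Lemma bihomog_Xr (i : 'I_10) : bihomog 0 1 ('X_(rshift 5 i) : {mpoly K[5 + 10]}).
Proof.
move=> m; rewrite msuppX inE => /eqP ->; split.
  by apply: big1 => j _; rewrite mnm1E eq_rlshift.
rewrite (bigD1 i) //= mnm1E eqxx big1 ?addn0 // => j ji.
by rewrite mnm1E (inj_eq (@rshift_inj _ _)) eq_sym (negPf ji).
Qed.

Lemma bihomog_eval a b F x p c d : bihomog a b F ->
  eval_at F (row_mx (c *: x) (d *: p)) = c ^+ a * d ^+ b * eval_at F (row_mx x p).
Proof.
move=> HF; rewrite /eval_at !mevalE mulr_sumr; apply: eq_big_seq => m /HF[<- <-].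
rewrite mulrCA; congr (_ * _); rewrite !big_split_ord /= -!prodrXr.
under eq_bigr => i _ do rewrite row_mxEl mxE exprMn.
under [X in _ * X = _]eq_bigr => i _ do rewrite row_mxEr mxE exprMn.
under [X in _ = _ * (X * _)]eq_bigr => i _ do rewrite row_mxEl.
under [X in _ = _ * (_ * X)]eq_bigr => i _ do rewrite row_mxEr.
by rewrite !big_split /= mulrACA.
Qed.

(** Substituting these linear forms into a polynomial in (x, p) moves the argument to (x g, p W). *)
Definition pull (g : 'M[K]_5) (W : 'M[K]_10) (i : 'I_(5 + 10)) : {mpoly K[5 + 10]} :=
  match split i with
  | inl k => \sum_l g l k *: 'X_(lshift 10 l)
  | inr k => \sum_l W l k *: 'X_(rshift 5 l)
  end.

Lemma pull_eval g W F x p : eval_at (F \mPo [tuple pull g W i | i < 5 + 10]) (row_mx x p) =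
  eval_at F (row_mx (x *m g) (p *m W)).
Proof.
rewrite /eval_at comp_mpoly_meval; apply: meval_eq => i; rewrite tnth_mktuple /pull.
rewrite -[i in RHS]splitK; case: (split i) => k /=.
  rewrite row_mxEl mxE raddf_sum; apply: eq_bigr => l _.
  by rewrite /= mevalZ mevalXU row_mxEl mulrC.
rewrite row_mxEr mxE raddf_sum; apply: eq_bigr => l _.
by rewrite /= mevalZ mevalXU row_mxEr mulrC.
Qed.

Lemma bihomog_pull a b g W F : bihomog a b F ->
  bihomog a b (F \mPo [tuple pull g W i | i < 5 + 10]).
Proof.
move=> HF; rewrite comp_mpolyE big_seq; apply: bihomog_sum => m /HF[<- <-]; apply: bihomogZ.
have -> : (\sum_(i < 5) m (lshift 10 i) = \sum_(i < 5 + 10) (if split i is inl _ then 1 else 0) * m i)%N.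
  rewrite big_split_ord /= [X in _ = (_ + X)%N]big1 ?addn0 => [|i _].
    by apply: eq_bigr => i _; rewrite (unsplitK (inl _ i)) mul1n.
  by rewrite (unsplitK (inr _ i)).
have -> : (\sum_(i < 10) m (rshift 5 i) = \sum_(i < 5 + 10) (if split i is inl _ then 0 else 1) * m i)%N.
  rewrite big_split_ord /= [X in _ = (X + _)%N]big1 ?add0n => [|i _].
    by apply: eq_bigr => i _; rewrite (unsplitK (inr _ i)) mul1n.
  by rewrite (unsplitK (inl _ i)).
apply: bihomog_prod => i; rewrite tnth_mktuple; apply: bihomogX; rewrite /pull.
case: (split i) => k; apply: bihomog_sum => l _; apply: bihomogZ; [exact: bihomog_Xl | exact: bihomog_Xr].
Qed.

Variable V : 'M[K]_(6, 10).

Lemma O_section0 m : O_section V m (fun _ _ => 0).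
Proof.
move=> x p _; exists 0%N, 0%N, 0, 1; split; [exact: bihomog0 | exact: bihomog1 | |].
  by rewrite /eval_at meval1 oner_neq0.
by move=> y q _ _; rewrite /eval_at meval0 mul0r.
Qed.

Lemma O_section_square (u : 'rV[K]_5) : O_section V 2 (fun x _ => (x *m u^T) 0 0 ^+ 2).
Proof.
move=> x p _; exists 0%N, 0%N, ((\sum_i u 0 i *: 'X_(lshift 10 i)) ^+ 2), 1; split.
- suff H : bihomog 1 0 (\sum_i u 0 i *: ('X_(lshift 10 i) : {mpoly K[5 + 10]})) by have := bihomogX (k := 2%N) H.
  apply: bihomog_sum => i _; apply: bihomogZ; exact: bihomog_Xl.
- exact: bihomog1.
- by rewrite /eval_at meval1 oner_neq0.
move=> y q _ _; rewrite /eval_at meval1 divr1 rmorphXn /=; congr (_ ^+ 2).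
rewrite mxE raddf_sum; apply: eq_bigr => i _.
by rewrite /= mevalZ mevalXU row_mxEl mxE mulrC.
Qed.

Lemma O_section_pull g W m s :
  (forall x p, univ_plane V x p -> univ_plane V (x *m g) (p *m W)) ->
  O_section V m s -> O_section V m (fun x p => s (x *m g) (p *m W)).
Proof.
move=> H Hs x p xp; have [a [b [F [G [HF HG G0 E]]]]] := Hs _ _ (H _ _ xp).
exists a, b, (F \mPo [tuple pull g W i | i < 5 + 10]), (G \mPo [tuple pull g W i | i < 5 + 10]).
split; [exact: bihomog_pull | exact: bihomog_pull | by rewrite pull_eval |].
by move=> y q yq; rewrite !pull_eval => Gyq; rewrite E //; exact: H.
Qed.

Lemma O_section_scale m s x p c d : c != 0 -> d != 0 -> O_section V m s ->
  univ_plane V x p -> univ_plane V (c *: x) (d *: p) ->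
  s (c *: x) (d *: p) = c ^+ m * s x p.
Proof.
move=> c0 d0 Hs xp cxp; have [a [b [F [G [HF HG G0 E]]]]] := Hs _ _ xp.
rewrite !E ?(bihomog_eval _ _ _ _ HF) ?(bihomog_eval _ _ _ _ HG) ?mulf_neq0 ?expf_neq0 //.
by rewrite exprD; field; rewrite !expf_neq0 ?G0.
Qed.

Lemma O_section_eq0 m n (s : 'I_n -> _) (z : 'rV[K]_n) : O_section_basis V m s ->
  (forall x p, univ_plane V x p -> \sum_i z 0 i * s i x p = 0) -> z = 0.
Proof.
move=> [_ /(_ _ (O_section0 m))[z0 [_ Hu]]] Hz; rewrite -(Hu z) => [|x p xp]; last by rewrite Hz.
by apply: Hu => x p _; rewrite big1 // => i _; rewrite mxE mul0r.
Qed.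

End Bihomog.

(** * The contragredient action on points and the pullback of sections *)

Section Dual.
Variable K : numFieldType.
Implicit Types (h g : 'M[K]_5) (x u v : 'rV[K]_5) (p : 'rV[K]_10) (V : 'M[K]_(6, 10)).

(* The action on points that is contragredient to the action of h on linear forms. *)
Definition dual h := (invmx h)^T.

Lemma dualK h : dual (dual h) = h.
Proof. by rewrite /dual trmx_inv trmxK invmxK. Qed.

Lemma dual_unit h : h \in unitmx -> dual h \in unitmx.
Proof. by move=> uh; rewrite /dual unitmx_tr unitmx_inv. Qed.

Lemma dualM h g : h \in unitmx -> g \in unitmx -> dual (h *m g) = dual h *m dual g.
Proof. by move=> uh ug; rewrite /dual -trmx_mul; congr _^T; exact: (@invrM _ h g). Qed.

Lemma dualZ c h : c != 0 -> h \in unitmx -> dual (c *: h) = c^-1 *: dual h.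
Proof. by move=> c0 uh; rewrite /dual invmxZ ?unitmxZ ?unitfE // linearZ. Qed.

Lemma dual1 : dual 1%:M = 1%:M.
Proof. by rewrite /dual invmx1 trmx1. Qed.

Lemma dual_pairing h x u : h \in unitmx -> (x *m dual h) *m (u *m h)^T = x *m u^T.
Proof.
by move=> uh; rewrite /dual trmx_mul mulmxA -(mulmxA x) -trmx_mul mulmxV // trmx1 mulmx1.
Qed.

Lemma orth_dual h x u : h \in unitmx -> orth (x *m dual h) (u *m h) = orth x u.
Proof. by move=> uh; rewrite /orth dual_pairing. Qed.

Lemma wedge_mxZ c h : wedge_mx (c *: h) = c ^+ 2 *: wedge_mx h.
Proof. by apply/matrixP => i j; rewrite !mxE; ring. Qed.

Lemma grassmannian_mulmx h p : h \in unitmx -> grassmannian p -> grassmannian (p *m wedge_mx h).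
Proof.
move=> uh /grassmannianP[u [v [uv0 ->]]]; apply/grassmannianP; exists (u *m h), (v *m h).
rewrite wedge_mulmx; split=> //; apply: contraNneq uv0 => E.
by rewrite -(mulmxK (wedge_mx_unit uh) (wedge u v)) E mul0mx.
Qed.

Lemma in_plane_dual h x p : h \in unitmx -> grassmannian p ->
  in_plane (x *m dual h) (p *m wedge_mx h) <-> in_plane x p.
Proof.
move=> uh gp; have := grassmannian_mulmx uh gp; have [u [v [uv0 ->]]] := (grassmannianP _).1 gp.
rewrite -wedge_mulmx => gp'.
have uvh0 : wedge (u *m h) (v *m h) != 0.
  apply: contraNneq uv0 => E.
  by rewrite -(mulmxK (wedge_mx_unit uh) (wedge u v)) -wedge_mulmx E mul0mx.
by rewrite !in_plane_wedge // !orth_dual.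
Qed.

Lemma orthZ c d x u : c != 0 -> d != 0 -> orth (c *: x) (d *: u) = orth x u.
Proof.
move=> c0 d0; rewrite /orth -scalemxAl linearZ /= -scalemxAr !scaler_eq0.
by rewrite (negPf c0) (negPf d0).
Qed.

Lemma grassmannianZ c p : c != 0 -> grassmannian p -> grassmannian (c *: p).
Proof.
move=> c0 /grassmannianP[u [v [uv0 ->]]]; apply/grassmannianP; exists (c *: u), v.
by rewrite wedgeZl scaler_eq0 negb_or c0.
Qed.

Lemma in_planeZ c d x p : c != 0 -> d != 0 -> grassmannian p ->
  in_plane (c *: x) (d *: p) <-> in_plane x p.
Proof.
move=> c0 d0 /grassmannianP[u [v [uv0 ->]]]; rewrite -wedgeZl in_plane_wedge; last first.
  by rewrite wedgeZl scaler_eq0 negb_or d0.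
by rewrite in_plane_wedge // orthZ // -{1}[v]scale1r orthZ ?oner_neq0.
Qed.

Lemma linear_sectionZ V c p : c != 0 -> linear_section V p -> linear_section V (c *: p).
Proof. by move=> c0 [gp pV]; split; [exact: grassmannianZ | exact: scalemx_sub]. Qed.

Lemma linear_section_neq0 V p : linear_section V p -> p != 0.
Proof. by case=> /grassmannianP[u [v [uv0 ->]]]. Qed.

Lemma univ_planeZ V c d x p : c != 0 -> d != 0 -> univ_plane V x p -> univ_plane V (c *: x) (d *: p).
Proof.
move=> c0 d0 [x0 Vp xp]; split; first by rewrite scaler_eq0 negb_or c0.
  exact: linear_sectionZ.
by apply/in_planeZ => //; case: Vp.
Qed.

Lemma linear_section_mulmx V h p : h \in unitmx -> (V *m wedge_mx h <= V)%MS ->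
  linear_section V p -> linear_section V (p *m wedge_mx h).
Proof.
move=> uh Vh [gp pV]; split; first exact: grassmannian_mulmx.
by apply: submx_trans Vh; exact: submxMr.
Qed.

Lemma univ_plane_dual V h x p : h \in unitmx -> (V *m wedge_mx h <= V)%MS ->
  univ_plane V x p -> univ_plane V (x *m dual h) (p *m wedge_mx h).
Proof.
move=> uh Vh [x0 Vp xp]; split; last by apply/in_plane_dual => //; case: Vp.
  by apply: contraNneq x0 => E; rewrite -(mulmxK (dual_unit uh) x) E mul0mx.
exact: linear_section_mulmx.
Qed.

Lemma regular_map_linear n m (X : 'rV[K]_n -> Prop) (Y : 'rV[K]_m -> Prop) (A : 'M[K]_(n, m)) :
  (forall v : 'rV[K]_n, X v -> v *m A != 0) -> (forall v : 'rV[K]_n, X v -> Y (v *m A)) -> regular_map X Y (mulmxr A).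
Proof.
move=> A0 XY; split=> // v0 Xv0; exists 1%N, (fun j => \sum_i A i j *: 'X_i).
have E (v : 'rV[K]_n) : \row_j eval_at (\sum_i A i j *: 'X_i) v = v *m A.
  apply/rowP => j; rewrite !mxE /eval_at raddf_sum; apply: eq_bigr => i _.
  by rewrite /= mevalZ mevalXU mulrC.
split=> [j||v Xv _]; rewrite ?E ?A0 //.
  by apply: rpred_sum => i _; apply: rpredZ; rewrite dhomogX /= mdeg1.
by exists 1; rewrite ?oner_neq0 ?scale1r.
Qed.

End Dual.

Section Pullback.
Variable K : numFieldType.
Variables (V : 'M[K]_(6, 10)) (m n : nat) (s : 'I_n -> 'rV[K]_5 -> 'rV[K]_10 -> K).
Hypothesis s_basis : O_section_basis V m s.
Implicit Types (h : 'M[K]_5) (M : 'M[K]_n) (x u : 'rV[K]_5) (p : 'rV[K]_10).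

(** When linear forms, and hence bivectors, move by h, points move by [dual h]; this is what
    preserves incidence. *)
Definition pullback h M := forall j x p, univ_plane V x p ->
  s j (x *m dual h) (p *m wedge_mx h) = \sum_i M i j * s i x p.

Definition stable h := h \in unitmx /\ (V *m wedge_mx h <= V)%MS.

Lemma coords_inj k (A B : 'M[K]_(n, k)) :
  (forall j x p, univ_plane V x p -> \sum_i A i j * s i x p = \sum_i B i j * s i x p) -> A = B.
Proof.
move=> E; apply/matrixP => i j; apply/eqP; rewrite -subr_eq0; apply/eqP.
have /rowP/(_ i) : \row_i (A i j - B i j) = 0; last by rewrite !mxE.
apply: (O_section_eq0 s_basis) => x p xp; under eq_bigr => t _ do rewrite mxE mulrBl.
by rewrite sumrB (E j) ?subrr.
Qed.

Lemma exists_coords k (t : 'I_k -> 'rV[K]_5 -> 'rV[K]_10 -> K) : (forall j, O_section V m (t j)) ->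
  exists A : 'M[K]_(n, k), forall j x p, univ_plane V x p -> t j x p = \sum_i A i j * s i x p.
Proof.
move=> Ht; have /fin_all_exists[z Hz] j : exists z : 'rV[K]_n, forall x p, univ_plane V x p ->
    t j x p = \sum_i z 0 i * s i x p.
  by have [z [Hz _]] := s_basis.2 _ (Ht j); exists z.
exists (\matrix_(i, j) z j 0 i) => j x p xp; rewrite (Hz j) //.
by apply: eq_bigr => i _; rewrite mxE.
Qed.

Lemma pullback_exists h : stable h -> exists M, pullback h M.
Proof.
move=> [uh Vh]; apply: (exists_coords (t := fun j x p => s j (x *m dual h) (p *m wedge_mx h))) => j.
by apply: (O_section_pull _ (s_basis.1 j)) => x p; exact: univ_plane_dual.
Qed.

Lemma pullback_unique h M M' : pullback h M -> pullback h M' -> M = M'.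
Proof. by move=> H H'; apply: coords_inj => j x p xp; rewrite -H // -H'. Qed.

Lemma pullback1 : pullback 1%:M 1%:M.
Proof.
move=> j x p xp; rewrite dual1 wedge_mx1 !mulmx1 (bigD1 j) //= mxE eqxx mul1r big1 ?addr0 // => i ij.
by rewrite mxE (negPf ij) mul0r.
Qed.

Lemma pullback_mul h h' M M' : stable h -> h' \in unitmx -> pullback h M -> pullback h' M' ->
  pullback (h *m h') (M *m M').
Proof.
move=> [uh Vh] uh' H H' j x p xp; rewrite dualM // wedge_mxM !mulmxA H'; last exact: univ_plane_dual.
under eq_bigr => i _ do rewrite H // mulr_sumr.
rewrite exchange_big /=; apply: eq_bigr => k _; rewrite mxE mulr_suml; apply: eq_bigr => i _.
by rewrite mulrCA mulrA.
Qed.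

Lemma pullback_scale h M c d j x p : stable h -> pullback h M -> c != 0 -> d != 0 -> univ_plane V x p ->
  s j (c *: (x *m dual h)) (d *: (p *m wedge_mx h)) = \sum_i (c ^+ m *: M) i j * s i x p.
Proof.
move=> [uh Vh] H c0 d0 xp; have yq := univ_plane_dual uh Vh xp.
rewrite (O_section_scale c0 d0 (s_basis.1 j) yq) ?H //; last exact: univ_planeZ.
by rewrite mulr_sumr; apply: eq_bigr => i _; rewrite mxE mulrA.
Qed.

End Pullback.

(** * The squares of the centers as quadratic sections *)

Section Squares.
Variable K : numFieldType.
Variables (V : 'M[K]_(6, 10)) (n : nat) (s : 'I_n -> 'rV[K]_5 -> 'rV[K]_10 -> K).
Hypothesis s_basis : O_section_basis V 2 s.
Variables (L : 'I_4 -> 'M[K]_(2, 10)) (E : 'M[K]_5).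
Hypothesis LV : forall i, (L i <= V)%MS.
Hypothesis fE : is_frame L E.

Definition square_coords (Z : 'M[K]_(n, 4)) := forall k x p, univ_plane V x p ->
  (x *m (bstd K k *m E)^T) 0 0 ^+ 2 = \sum_i Z i k * s i x p.

Lemma square_coords_exists : exists Z, square_coords Z.
Proof.
apply: (exists_coords s_basis (t := fun k x p => (x *m (bstd K k *m E)^T) 0 0 ^+ 2)) => k.
exact: O_section_square.
Qed.

(** Pairing with a center is preserved when points move contragrediently, so the square of the
    center k pulls back to that of the center t^-1(k). *)
Lemma square_coords_pullback Z h M (t : 'S_4) : square_coords Z -> stable V h -> pullback V s h M ->
  (forall k, bstd K k *m E *m h = bstd K (t k) *m E) -> M *m Z = col_perm t^-1%g Z.
Proof.
move=> HZ [uh Vh] HM bt; apply: (coords_inj s_basis) => k x p xp.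
under [RHS]eq_bigr => i _ do rewrite mxE.
rewrite -HZ // -(dual_pairing x _ uh) bt permKV (HZ k _ (p *m wedge_mx h)); last exact: univ_plane_dual.
under [RHS]eq_bigr => i _ do rewrite HM // mulr_sumr.
rewrite [RHS]exchange_big /=; apply: eq_bigr => j _; rewrite mxE mulr_suml; apply: eq_bigr => i _.
by rewrite mulrCA mulrA.
Qed.

Lemma frame_univ_plane i (y : 'rV[K]_5) (u := n1std K i) : wedge (bstd K i) u != 0 ->
  orth y (bstd K i) -> orth y u -> y != 0 ->
  univ_plane V (y *m dual E) (wedge (bstd K i) u *m wedge_mx E).
Proof.
move=> bu0 yb yu y0; have [uE LE] := fE.
have g : grassmannian (wedge (bstd K i) u) by apply/grassmannianP; exists (bstd K i), u.
split.
- by apply: contraNneq y0 => E0; rewrite -(mulmxK (dual_unit uE) y) E0 mul0mx.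
- split; first exact: grassmannian_mulmx.
  apply: submx_trans (LV i); rewrite LE submxMr //; exact: sub_col_mx_l.
by apply/in_plane_dual => //; rewrite in_plane_wedge.
Qed.

(** Four test points in two planes of the family suffice: e1, e2, e1 - e2 in the plane e0 ^ e3, and
    e0 in the plane e1 ^ e4. Each makes a sum of two coefficients vanish, and three of these sums
    form a triangle, which determines its coefficients since 2 is invertible. *)
Lemma square_coords_free Z : square_coords Z -> row_free Z^T.
Proof.
move=> HZ; apply: inj_row_free => a aZ.
have rel x p : univ_plane V x p -> \sum_k a 0 k * (x *m (bstd K k *m E)^T) 0 0 ^+ 2 = 0.
  move=> xp; under eq_bigr => k _ do rewrite (HZ k x p) // mulr_sumr.
  rewrite exchange_big big1 //= => i _; have /rowP/(_ i) := aZ; rewrite !mxE => H.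
  rewrite -[RHS](mul0r (s i x p)) -[X in _ = X * _]H mulr_suml; apply: eq_bigr => k _.
  by rewrite mxE mulrA.
have rel' y i : wedge (bstd K i) (n1std K i) != 0 -> orth y (bstd K i) -> orth y (n1std K i) ->
    \sum_k a 0 k * (y *m (bstd K k)^T) 0 0 ^+ 2 = 0.
  move=> bu0 yb yu; have [->|y0] := eqVneq y 0.
    by rewrite big1 // => k _; rewrite mul0mx mxE expr0n mulr0.
  apply: etrans (rel _ _ (frame_univ_plane bu0 yb yu y0)); apply: eq_bigr => k _.
  by rewrite dual_pairing //; case: fE.
have b0 : wedge (bstd K (o4 0)) (n1std K (o4 0)) != 0.
  apply/eqP => /(coordE (o10 7)); rewrite !mxE /= => /eqP; by rewrite mul0r mul1r subr0 oner_eq0.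
have b1 : wedge (bstd K (o4 1)) (n1std K (o4 1)) != 0.
  apply/eqP => /(coordE (o10 3)); rewrite !mxE /= => /eqP; by rewrite mul0r mul1r subr0 oner_eq0.
have T0 := rel' e1 (o4 0) b0; have T1 := rel' e2 (o4 0) b0.
have T2 := rel' (r5 0 1 (-1) 0 0) (o4 0) b0; have T3 := rel' e0 (o4 1) b1.
have dot (x y : 'rV[K]_5) : (x *m y^T) 0 0 = \sum_i x 0 i * y 0 i.
  by rewrite mxE; apply: eq_bigr => i _; rewrite mxE.
have orthE (x y : 'rV[K]_5) : orth x y = (\sum_i x 0 i * y 0 i == 0).
  rewrite -dot /orth; apply/eqP/eqP => [->|H]; first by rewrite mxE.
  by apply/matrixP => i j; rewrite !ord1 H mxE.
move: T0 T1 T2 T3; rewrite !orthE !sum_ord4 !dot !sum5 !mxE /= => T0 T1 T2 T3.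
have {}T0 : a 0 (o4 1) + a 0 (o4 2) = 0.
  by apply: etrans (T0 _ _); [ring | rewrite !(mul0r, mulr0, addr0) ..].
have {}T1 : a 0 (o4 2) + a 0 (o4 3) = 0.
  by apply: etrans (T1 _ _); [ring | rewrite !(mul0r, mulr0, addr0) ..].
have {}T2 : a 0 (o4 1) + a 0 (o4 3) = 0.
  by apply: etrans (T2 _ _); [ring | rewrite !(mul0r, mulr0, addr0) ..].
have {}T3 : a 0 (o4 0) + a 0 (o4 2) = 0.
  by apply: etrans (T3 _ _); [ring | rewrite !(mul0r, mulr0, addr0) ..].
have two : (2 : K) != 0 by rewrite pnatr_eq0.
apply/rowP => k; rewrite mxE; apply: (mulfI two); rewrite mulr0; ord4 k.
- by apply: (lin4 (a := -1) (b := -1) (c := 1) (d := 2) T0 T1 T2 T3); ring.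
- by apply: (lin4 (a := 1) (b := -1) (c := 1) (d := 0) T0 T1 T2 T3); ring.
- by apply: (lin4 (a := 1) (b := 1) (c := -1) (d := 0) T0 T1 T2 T3); ring.
by apply: (lin4 (a := -1) (b := 1) (c := 1) (d := 0) T0 T1 T2 T3); ring.
Qed.

End Squares.

(** * Automorphisms of the section that preserve the four lines *)

Section Automorphisms.
Variable K : numFieldType.
Implicit Types (h g : 'M[K]_5) (p q : 'rV[K]_10) (x u v : 'rV[K]_5).

Lemma plane_inj p q : grassmannian p -> grassmannian q ->
  (forall x, in_plane x p <-> in_plane x q) -> exists2 c : K, c != 0 & p = c *: q.
Proof.
move=> /grassmannianP[u [v [uv0 ->]]] /grassmannianP[u' [v' [uv0' ->]]] E.
have sub w : w \in [:: u; v] -> (w <= col_mx u' v')%MS.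
  move=> wuv; apply: (sub_annihilator uv0') => x xu' xv'.
  have /in_plane_wedge-/(_ uv0)[xu xv] : in_plane x (wedge u v) by apply/E/in_plane_wedge.
  by move: wuv; rewrite !inE => /orP[] /eqP ->.
have [c Ec] : exists c, wedge u v = c *: wedge u' v' by apply: sub_wedge; apply: sub; rewrite !inE eqxx ?orbT.
by exists c => //; apply: contraNneq uv0 => c0; rewrite Ec c0 scale0r.
Qed.

(** Pigeonhole: two of the five vectors a + t b, for t = 0, .., 4, fall in the same one of the four
    subspaces, which then contains b and a. *)
Lemma sub_union (n m : nat) (M : 'M[K]_(2, n)) (N : 'I_4 -> 'M[K]_(m, n)) :
  (forall w : 'rV_n, (w <= M)%MS -> exists i, (w <= N i)%MS) -> exists i, (M <= N i)%MS.
Proof.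
move=> H; have [a [b EM]] : exists a b : 'rV_n, M = col_mx a b.
  by exists (usubmx (M : 'M_(1 + 1, n))), (dsubmx (M : 'M_(1 + 1, n))); rewrite vsubmxK.
have /fin_all_exists[f Hf] (t : 'I_5) : exists i, ((a + t%:R *: b)%R <= N i)%MS.
  by apply: H; rewrite EM; apply/sub_col2P; exists 1, t%:R; rewrite scale1r.
have /injectivePn[t [t' tt' ft]] : ~~ injectiveb f.
  by apply: contraTN isT => /injectiveP/leq_card; rewrite !card_ord.
have d0 : (t%:R - t'%:R : K) != 0 by rewrite subr_eq0 eqr_nat.
have bN : (b <= N (f t))%MS.
  have : ((t%:R - t'%:R) *: b <= N (f t))%MS.
    have -> : (t%:R - t'%:R) *: b = (a + t%:R *: b) - (a + t'%:R *: b).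
      by apply/rowP => k; rewrite !mxE; ring.
    by rewrite addmx_sub ?eqmx_opp // ft.
  by move/(scalemx_sub (t%:R - t'%:R)^-1); rewrite scalerA mulVf // scale1r.
exists (f t); suff : (col_mx a b <= N (f t))%MS by rewrite EM.
rewrite col_mx_sub bN andbT -(addrK (t%:R *: b) a).
by rewrite addmx_sub // -scaleNr scalemx_sub.
Qed.

Variables (V : 'M[K]_(6, 10)) (L : 'I_4 -> 'M[K]_(2, 10)).
Hypothesis fL : forall i, row_free (L i).
Hypothesis LS : forall i p, p != 0 -> (p <= L i)%MS -> linear_section V p.
Hypothesis disjL : forall i j, i != j -> (L i :&: L j = 0)%MS.

Lemma lines_sub i : (L i <= V)%MS.
Proof.
apply/row_subP => k; have [->|r0] := eqVneq (row k (L i)) 0; first exact: sub0mx.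
by have [] := LS r0 (row_sub _ _).
Qed.

Lemma on_linesZ c p : c != 0 -> on_lines L (c *: p) -> on_lines L p.
Proof.
move=> c0 [cp0 [i cpi]]; split; first by apply: contraNneq cp0 => ->; rewrite scaler0.
by exists i; rewrite -(scale1r p) -(mulVf c0) -scalerA scalemx_sub.
Qed.

(** Both sides represent the image under g of the plane of p, and a plane determines its Plucker
    vector up to a scalar. *)
Lemma equivariant_linear alpha g : g \in unitmx ->
  (forall p, linear_section V p -> linear_section V (alpha p)) ->
  (forall p, linear_section V p -> forall x, in_plane (x *m g) (alpha p) <-> in_plane x p) ->
  forall p, linear_section V p -> exists2 c : K, c != 0 & alpha p = c *: (p *m wedge_mx (dual g)).
Proof.
move=> ug aS aP p Sp; have [gp _] := Sp; have udg := dual_unit ug.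
apply: plane_inj; [by case: (aS p Sp) | exact: grassmannian_mulmx |] => x.
have [Ha Hb] := aP p Sp (x *m invmx g); have [Hc Hd] := in_plane_dual (x *m invmx g) udg gp.
move: Ha Hb Hc Hd; rewrite dualK mulmxKV // => Ha Hb Hc Hd.
by split=> [/Ha/Hd|/Hc/Hb].
Qed.

(** The image of each line is covered by the four lines, hence contained in one of them by
    [sub_union]; disjointness makes the resulting map of indices injective. *)
Lemma equivariant_induces alpha g : g \in unitmx ->
  (forall p, linear_section V p -> linear_section V (alpha p)) ->
  (forall p, linear_section V p -> forall x, in_plane (x *m g) (alpha p) <-> in_plane x p) ->
  (forall p, linear_section V p -> (on_lines L (alpha p) <-> on_lines L p)) ->
  exists s : 'S_4, induces L (dual g) s.
Proof.
move=> ug aS aP aL; have udg := dual_unit ug; have uW := wedge_mx_unit udg.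
have /fin_all_exists[f Hf] i : exists j, (L i *m wedge_mx (dual g) :=: L j)%MS.
  have [w|j Hj] := @sub_union _ _ (L i *m wedge_mx (dual g)) L.
    have [->|w0] := eqVneq w 0; first by exists i; rewrite sub0mx.
    case/submxP=> y; rewrite mulmxA; set p := y *m L i => Ew.
    have p0 : p != 0 by apply: contraNneq w0 => p0; rewrite Ew p0 mul0mx.
    have pL : (p <= L i)%MS by exact: submxMl.
    have Sp := LS p0 pL; have [c c0 Ec] := equivariant_linear ug aS aP Sp.
    have /(aL p Sp) : on_lines L p by split=> //; exists i.
    by rewrite Ec -Ew => /(on_linesZ c0)[_].
  exists j; apply: eqmx_of_rank => //.
  by rewrite mxrankMfree ?row_free_unit // (eqP (fL i)) (eqP (fL j)).
have f_inj : injective f.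
  move=> i j fij; apply/eqP/negPn/negP => ij.
  have LL : (L i <= L j)%MS.
    by rewrite -(submxMfree _ _ (_ : row_free (wedge_mx (dual g)))) ?row_free_unit // Hf Hf fij.
  have := eqP (fL i); rewrite -(capmx_idPl LL) disjL // mxrank0 //.
by exists (perm f_inj); split=> // i; rewrite permE.
Qed.

Lemma induces_Aut E h s : row_free V -> is_frame L E -> induces L h s ->
  Aut_sigma V L (mulmxr (wedge_mx h)).
Proof.
move=> fV fE H; have [uh Lh] := H; have H' := induces_inv H; have [uh' Lh'] := H'.
have uW := wedge_mx_unit uh.
have VW : (V *m wedge_mx h <= V)%MS by rewrite (induces_V fV lines_sub fE H).
have VW' : (V *m wedge_mx (invmx h) <= V)%MS by rewrite (induces_V fV lines_sub fE H').
have S p := linear_section_mulmx (p := p) uh VW.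
have S' p := linear_section_mulmx (p := p) uh' VW'.
have WK p : p *m wedge_mx h *m wedge_mx (invmx h) = p by rewrite wedge_mxV // mulmxK.
have WKV p : p *m wedge_mx (invmx h) *m wedge_mx h = p by rewrite wedge_mxV // mulmxKV.
have one1 : (1 : K) != 0 := oner_neq0 K.
split.
  split; first by apply: regular_map_linear => // p /S/linear_section_neq0.
  exists (mulmxr (wedge_mx (invmx h))); split.
  - by apply: regular_map_linear => // p /S'/linear_section_neq0.
  - by move=> p _; exists 1; rewrite // scale1r /= WK.
  by move=> p _; exists 1; rewrite // scale1r /= WKV.
move=> p Sp; have p0 := linear_section_neq0 Sp; have q0 := linear_section_neq0 (S _ Sp).
split=> -[_ [i pi]]; split=> //=.
  by exists (s^-1 i)%g; rewrite -Lh' -(WK p) submxMr.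
by exists (s i); rewrite -Lh submxMr.
Qed.

End Automorphisms.

Lemma induces_scale (K : numFieldType) L (h : 'M[K]_5) s c : c != 0 -> induces L h s -> induces L (c *: h) s.
Proof.
move=> c0 [uh Lh]; split=> [|i]; first by rewrite unitmxZ ?unitfE.
by rewrite wedge_mxZ -scalemxAr; apply: eqmx_trans (Lh i); apply: eqmx_scale; rewrite expf_neq0.
Qed.

(** * The group S_4 acting on the quadratic sections *)

Section Main.
Variable K : numClosedFieldType.
Variables (V : 'M[K]_(6, 10)) (L : 'I_4 -> 'M[K]_(2, 10)) (sigma : 'rV[K]_10 -> 'rV[K]_3).
Variable s : 'I_16 -> 'rV[K]_5 -> 'rV[K]_10 -> K.
Hypothesis smoothV : smooth_surface_section V.
Hypothesis contrL : contraction V L sigma.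
Hypothesis s_basis : O_section_basis V 2 s.

Let SV : smooth_section V := smooth_sectionP smoothV.
Let fV : row_free V. Proof. by case: SV. Qed.
Let fL i : row_free (L i). Proof. by case: contrL => H _ _ _; case: (H i). Qed.
Let LS i p : p != 0 -> (p <= L i)%MS -> linear_section V p.
Proof. by case: contrL => H _ _ _; case: (H i) => _; apply. Qed.
Let disjL i j : i != j -> (L i :&: L j = 0)%MS.
Proof. by case: contrL => _ + _ _; apply. Qed.

Let LV := lines_sub LS.

Lemma frames_exist (t : 'S_4) : exists E, is_frame (L \o t) E.
Proof.
have /fin_all_exists[l Hl] i : exists l, exists P, line V l P (L i).
  by apply: line_form => // p p0 /(LS p0)[].
have [P lineL] := fin_all_exists Hl.
apply: (frame_exists SV (fun i => lineL (t i))) => i j ij.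
by apply: disjL; rewrite (inj_eq perm_inj).
Qed.

(** Asking that the centers be permuted exactly, not just up to a scalar, fixes the scalar of h;
    this turns a projective action of S_4 into a linear one. *)
Lemma normalized_exists E (t : 'S_4) : is_frame L E ->
  exists h, induces L h t /\ forall i, bstd K i *m E *m h = bstd K (t i) *m E.
Proof.
move=> fE; have [E' fE'] := frames_exist t; have H := induces_exists fE fE'.
have [c c0 Ec] := induces_center LV fL fE H.
exists (c^-1 *: (invmx E *m E')); split=> [|i]; first by apply: induces_scale; rewrite ?invr_eq0.
by rewrite -scalemxAr Ec scalerA mulVf // scale1r.
Qed.

Lemma normalized_unique E h h' (t : 'S_4) : is_frame L E -> induces L h t -> induces L h' t ->
  (forall i, bstd K i *m E *m h = bstd K (t i) *m E) ->
  (forall i, bstd K i *m E *m h' = bstd K (t i) *m E) -> h' = h.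
Proof.
move=> fE H H' b b'; have [c c0 Ec] := induces_unique LV fL fE H H'.
suff c1 : c = 1 by rewrite Ec c1 scale1r.
have := b' (t^-1 (o4 0))%g; rewrite Ec -scalemxAr b permKV => /eqP.
rewrite -subr_eq0 -{2}(scale1r (_ *m E)) -scalerBl scaler_eq0 subr_eq0 => /orP[/eqP //|].
by have [_ _ /negPf ->] := frame_line LV fE (fL (o4 0)).
Qed.

Lemma induces_stable E h t : is_frame L E -> induces L h t -> stable V h.
Proof. by move=> fE H; split; [case: H | rewrite (induces_V fV LV fE H)]. Qed.

Theorem rational_sections : rational_Proj (git_ring (acts_by V L s)).
Proof.
have [E fE] : exists E, is_frame L E.
  have [E [uE HE]] := frames_exist 1%g; exists E; split=> // i; have := HE i; by rewrite /= perm1.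
have [h Hh] := fin_all_exists (fun t => normalized_exists t fE).
have Ih t := (Hh t).1; have bh t := (Hh t).2.
have Sh t := induces_stable fE (Ih t).
have /fin_all_exists[M HM] (t : 'S_4) : exists M, pullback V s (h t) M.
  exact (pullback_exists s_basis (Sh t)).
have [Z HZ] := square_coords_exists s_basis E.
(* The inverse turns the multiplicative [M] into a family obeying the reversed law required of
   [D]. *)
pose D (t : 'S_4) := M t^-1%g.
have h1 : h 1%g = 1%:M.
  apply: (normalized_unique (t := 1%g) fE _ (Ih 1%g) _ (bh 1%g)) => [|i].
    by split=> [|i]; rewrite ?unitmx1 // wedge_mx1 mulmx1 perm1.
  by rewrite mulmx1 perm1.
have hM t t' : h (t * t')%g = h t *m h t'.
  apply: (normalized_unique fE _ (Ih _) _ (bh _)) => [|i]; first exact: induces_mul.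
  by rewrite mulmxA !bh permM.
have MM t t' : M (t * t')%g = M t *m M t'.
  apply: (pullback_unique s_basis (HM _)); rewrite hM.
  by apply: (pullback_mul (Sh t)) => //; case: (Sh t').
have D1 : D 1%g = 1%:M.
  rewrite /D invg1; apply: (pullback_unique s_basis (HM _)); rewrite h1; exact: pullback1.
have DM t t' : D (t * t')%g = D t' *m D t by rewrite /D invMg MM.
have DZ t : D t *m Z = col_perm t Z.
  by rewrite -{2}(invgK t); exact: (square_coords_pullback s_basis HZ (Sh _) (HM _) (bh _)).
have /row_freeP[B ZB] := square_coords_free LV fE HZ.
have Y0Z : B^T *m Z = 1%:M by rewrite -[Z]trmxK -trmx_mul ZB trmx1.
have [Y [YZ YD]] := equivariant_retraction DM DZ Y0Z.
(* The 16 coordinates are split as 4 + 12. *)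
have fY : row_free (Y : 'M_(4, 4 + 12)) by apply/row_freeP; exists Z.
have [Lam uY] := row_free_complete fY.
apply: (rational_quotient D1 DM YD uY) => N; split.
  case=> alpha [g [[[[aS _] _] aL] ug aP aN]].
  have [t It] := equivariant_induces fL LS disjL ug aS aP aL.
  have [c c0 Ec] := induces_unique LV fL fE (Ih t) It.
  have ut := (Ih t).1; have gE : g = c^-1 *: dual (h t) by rewrite -[g]dualK Ec dualZ.
  (* Quadratic sections are multiplied by the square of the scalar by which g differs from
     [dual (h t)]. *)
  exists t^-1%g, (c^-1 ^+ 2); split; first by rewrite expf_neq0 ?invr_eq0.
  apply: (coords_inj s_basis) => j x p xp; rewrite /D invgK.
  have [_ Sp _] := xp; have [d d0 Ed] := equivariant_linear ug aS aP Sp.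
  rewrite -aN // Ed Ec wedge_mxZ -scalemxAr scalerA gE -scalemxAr.
  by apply: (pullback_scale s_basis j (Sh t) (HM t)) => //; rewrite ?invr_eq0 ?mulf_neq0 ?expf_neq0.
(* Conversely, the scalar c on quadratic sections is produced by a square root of c on P^4. *)
case=> t [c [c0 ->]]; have ut := (Ih t^-1%g).1; have k0 : sqrtC c != 0 by rewrite sqrtC_eq0.
have uD : dual (h t^-1%g) \in unitmx by exact: dual_unit.
exists (mulmxr (wedge_mx (h t^-1%g))), (sqrtC c *: dual (h t^-1%g)); split.
- exact (induces_Aut LS fV fE (Ih _)).
- by rewrite unitmxZ ?unitfE.
- move=> p [gp _] x; rewrite /= -scalemxAr.
  rewrite -[p *m _]scale1r in_planeZ ?oner_neq0 //; last exact: grassmannian_mulmx.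
  exact: in_plane_dual.
move=> j x p xp; rewrite /= -scalemxAr -[p *m _]scale1r.
by rewrite (pullback_scale s_basis j (Sh _) (HM _)) ?oner_neq0 // sqrtCK.
Qed.

End Main.

Theorem theorem5p3 (R : realType) (V : 'M[R[i]]_(6, 10))
    (L : 'I_4 -> 'M[R[i]]_(2, 10)) (sigma : 'rV[R[i]]_10 -> 'rV[R[i]]_3)
    (s : 'I_16 -> 'rV[R[i]]_5 -> 'rV[R[i]]_10 -> R[i]) :
  smooth_surface_section V ->
  contraction V L sigma ->
  O_section_basis V 2 s ->
  rational_Proj (git_ring (acts_by V L s)).
Proof.
move=> smoothV contrL s_basis.
exact (rational_sections smoothV contrL s_basis).
Qed.
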